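(* Let $p>0$ be odd, $q$ an integer relatively prime to $p$, and let $K=K(p,q)\subset S^3$ be the 2-bridge knot whose 2-fold branched cover is the lens space $L(p,q)$, equipped with the 2-tangle decomposition $(S^3,K)=(Y,T)\cup(D,U)$ described in the context. Then $L_1:R(Y,T)\to P$ is a linearly embedded arc of slope $\frac{q-p}{q}$, and hence a restricted immersed arc. Taking $L_0=L_0^{\epsilon,0}$ with $\epsilon>0$ small, $C(L_0,L_1)$ has rank $p$, generated by the points $r_+^\epsilon$ and $x_\ell^+,x_\ell^-$, $\ell=1,\dots,\frac{p-1}{2}$. The $\mathbb Z/4$ grading is determined by $$gr(r_+^\epsilon)=\sigma(K),\qquad gr(x_\ell^+,x_\ell^-)=1,$$ and, letting $x_\ell^\circ$ denote $x_\ell^+$ if $\left|\frac{q-p}{q}\right|>1$ and $x_\ell^-$ if $\left|\frac{q-p}{q}\right|<1$, $$gr(r_+^\epsilon,x_\ell^\circ)=z(\alpha),$$ where $\alpha$ is the loop in $P^*$ which starts at $r_+^\epsilon$, follows $L_0$ to $x_\ell^\circ$, then returns to $r_+^\epsilon$ along $L_1$. All differentials are zero and hence $C(L_0,L_1)\cong H^\natural(Y,T)$.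
   Context: Pillowcase: $P=\mathbb R^2/G$ where $G$ is generated by $(\gamma,\theta)\mapsto(\gamma+2\pi,\theta)$, $(\gamma,\theta)\mapsto(\gamma,\theta+2\pi)$, $(\gamma,\theta)\mapsto(-\gamma,-\theta)$; the corners are the images of $(\pi\mathbb Z)^2$, and $P^*$ is $P$ minus the corners. $\ell_1$ is the line field on $P^*$ of slope 1; $z\in H^1(P^*;\mathbb Z/4)$ is the unique class with value $1$ on each small loop circling a corner counterclockwise. Traceless character varieties: $SU(2)$ is the group of unit quaternions. For a manifold $A$ and properly embedded codimension 2 submanifold $B$, $R(A,B)$ is the space of conjugacy classes of representations $\pi_1(A\setminus B)\to SU(2)$ sending meridians of $B$ to purely imaginary unit quaternions. For the 4-punctured sphere, with meridians $a,b,c,d$ satisfying $ba=cd$, $R(S^2,\{a,b,c,d\})\cong P$ via $(\gamma,\theta)\mapsto(a\mapsto \mathbf i,\ b\mapsto e^{\gamma\mathbf k}\mathbf i,\ c\mapsto e^{\theta\mathbf k}\mathbf i,\ d\mapsto e^{(\theta-\gamma)\mathbf k}\mathbf i)$. $(S^3,K)$ is decomposed along a 2-sphere meeting $K$ in four points into a trivial 2-tangle $(D,U)$ in a 3-ball and the complementary (also trivial) 2-tangle $(Y,T)$, the decomposition being determined by a continued fraction expansion of $p/q$; the fact recalled from earlier work is that for this decomposition $R(Y,T)$ is a smooth arc, $R(Y,T)\cong[0,\pi]$, and the restriction map $L_1:R(Y,T)\to R(S^2,\{a,b,c,d\})=P$ is $t\mapsto(qt,(q-p)t)$. $L_0^{\epsilon,0}:S^1\to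 P^*$ is the image in $P$ of $t\mapsto(t+\epsilon\sin t+\frac\pi2,\ t-\epsilon\sin t+\frac\pi2)$, $t\in[0,2\pi]$ (period $2\pi$ in $P$). It is close to the diagonal arc $\Delta=\{(\gamma,\gamma):\gamma\in[0,\pi]\}$. $L_1$ meets $\Delta$ in the points $x_\ell=(q\frac{2\pi\ell}{p},(q-p)\frac{2\pi\ell}{p})$, $\ell=0,\dots,\frac{p-1}2$. For $\ell>0$, $x_\ell^+$ (resp. $x_\ell^-$) is the intersection point of $L_1$ with $L_0$ close to $x_\ell$ lying on the part of $L_0$ of slope slightly less than 1 (resp. slightly greater than 1). $r_+^\epsilon$ is the unique continuously varying intersection point of $L_0^{\epsilon,0}$ and $L_1$ with $\lim_{\epsilon\to0}r_+^\epsilon=x_0=(0,0)$. Maslov index: for a path $\alpha$ in the domain of an immersed curve $L$, $\mu(L,\ell_1)_\alpha$ is the degree of the path of tangent lines measured relative to $\ell_1$ in the circle of lines (counterclockwise positive, rotation by $\pi$ being one full turn; degree is the signed count of preimages of the line rotated by an arbitrarily small positive angle from $\ell_1$). $\tau(m_0,m_1,\ell_1)\in\{0,1\}$ is minus the degree of the shortest clockwise path of lines from $m_0$ to $m_1$. Restricted immersed arc: the image in $P$ of a smooth immersion $\widetilde L:I\to\mathbb R^2$ taking endpoints to $(\pi\mathbb Z)^2$ and interior to the complement of $(\pi\mathbb Z)^2$, such that after removing small neighborhoods of the corners it is an immersed arc with distinct endpoints on, and transverse to, the boundary whose lifts to the universal cover are embedded. Complex: $C(L_0,L_1)$ is the $\mathbb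 F_2$ vector space on the intersection points of $L_0,L_1$ (pairs of parameters with the same image in $P^*$). The differential is $\partial x=\sum_y \#\mathcal M(x,y)\,y$, where $\mathcal M(x,y)$ is the set of orientation preserving immersed bigons in $P^*$ with convex corners $x,y$, up to reparametrization, whose clockwise boundary runs along $L_0$ from $y$ to $x$ and then along $L_1$ from $x$ to $y$. $H^\natural(Y,T)$ is its homology. Relative grading: $gr(x,y)=\mu(L_0,\ell_1)_{\alpha_0}+\mu(L_1,\ell_1)_{\alpha_1}+\tau(L_0,L_1,\ell_1)_x-\tau(L_0,L_1,\ell_1)_y+z(L_0(\alpha_0)*L_1(\alpha_1))\in\mathbb Z/4$ for any path $\alpha_0$ along $L_0$ from $x$ to $y$ and $\alpha_1$ along $L_1$ from $y$ to $x$. It is promoted to an absolute grading $gr(x)\in\mathbb Z/4$ with $gr(x,y)=gr(x)-gr(y)$ by the convention $gr(r_+^\epsilon)=\sigma(K)\bmod 4$, $\sigma(K)$ the knot signature. *)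

(* Defs.v *)
From HB Require Import structures.
From mathcomp Require Import all_boot all_order all_algebra finmap.
From mathcomp Require Import generic_quotient ring_quotient.
From mathcomp Require Import ring.
From mathcomp Require Import all_classical all_reals all_analysis.
Set Implicit Arguments.
Unset Strict Implicit.
Unset Printing Implicit Defensive.
Import Order.TTheory GRing.Theory Num.Theory numFieldNormedType.Exports.

Local Open Scope classical_set_scope.
Local Open Scope quotient_scope.
Local Open Scope ring_scope.

(* The group G generated by the two translations by 2 pi and by -1 consists of
   the maps w |-> (-1)^e w + 2 pi (k, l). *)
Definition pillow_rel {R : realType} (w w' : R * R) : bool :=
  `[< exists (e : bool) (k l : int),
        w'.1 = (-1) ^+ e * w.1 + 2 * pi * k%:~R /\
        w'.2 = (-1) ^+ e * w.2 + 2 * pi * l%:~R >].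

Lemma pillow_rel_refl (R : realType) : reflexive (@pillow_rel R).
Proof.
move=> w; apply/asboolP; exists false, 0, 0.
by rewrite expr0 !mul1r !mulr0 !addr0.
Qed.

Lemma pillow_rel_symm (R : realType) : symmetric (@pillow_rel R).
Proof.
suff H (w w' : R * R) : pillow_rel w w' -> pillow_rel w' w.
  by move=> w w'; apply/idP/idP => /H.
move=> /asboolP[e [k [l [E1 E2]]]]; apply/asboolP.
exists e, (- (-1) ^+ e * k), (- (-1) ^+ e * l).
have s2 : (-1) ^+ e * (-1) ^+ e = 1 :> R by rewrite -expr2 sqrr_sign.
have D (x y c : R) (m : int) : y = (-1) ^+ e * x + c * m%:~R ->
    x = (-1) ^+ e * y + c * (- (-1) ^+ e * m)%:~R.
  move=> ->; rewrite mulrDr mulrA s2 mul1r intrM rmorphN rmorphXn rmorphN1.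
  by rewrite mulNr mulrN mulrCA addrK.
by split; apply: D.
Qed.

Lemma pillow_rel_tr (R : realType) : transitive (@pillow_rel R).
Proof.
move=> w' w w'' /asboolP[e [k [l [E1 E2]]]] /asboolP[f [m [n [F1 F2]]]].
apply/asboolP; exists (f (+) e), ((-1) ^+ f * k + m), ((-1) ^+ f * l + n).
have D (x y v c : R) (i j : int) : y = (-1) ^+ e * x + c * i%:~R ->
    v = (-1) ^+ f * y + c * j%:~R ->
    v = (-1) ^+ (f (+) e) * x + c * ((-1) ^+ f * i + j)%:~R.
  move=> -> ->; rewrite signr_addb intrD intrM rmorphXn rmorphN1.
  by rewrite !mulrDr !mulrA addrA [(-1) ^+ f * c]mulrC.
by split; [apply: D E1 F1|apply: D E2 F2].
Qed.

Definition pillow_equiv (R : realType) : equiv_rel (R * R)%type :=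
  EquivRel (@pillow_rel R) (@pillow_rel_refl R) (@pillow_rel_symm R)
    (@pillow_rel_tr R).

Definition pillowcase (R : realType) : topologicalType :=
  quotient_topology {eq_quot (pillow_equiv R)}.

Definition pil {R : realType} (w : R * R) : pillowcase R :=
  (\pi_({eq_quot (pillow_equiv R)}) w).

Definition lattice {R : realType} : set (R * R) :=
  [set w | exists k l : int, w = (pi * k%:~R, pi * l%:~R)].

Definition corner {R : realType} : set (pillowcase R) := pil @` lattice.

(* P^* as a subset of the pillowcase *)
Definition pillow_star {R : realType} : set (pillowcase R) := ~` corner.

Definition homotopic_rel_ends {R : realType} (A : set (pillowcase R))
    (f g : R -> pillowcase R) : Prop :=
  exists H : R * R -> pillowcase R,
    {within `[0, 1] `*` `[0, 1], continuous H} /\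
    (forall u v, u \in `[0, 1] -> v \in `[0, 1] ->
       [/\ H (u, 0) = f u, H (u, 1) = g u, H (0, v) = f 0, H (1, v) = f 1
         & A (H (u, v))]).

Definition star_loop {R : realType} (f : R -> pillowcase R) : Prop :=
  [/\ {within `[0, 1], continuous f}, f 0 = f 1
    & forall u, u \in `[0, 1] -> pillow_star (f u)].

Definition freely_homotopic {R : realType} (f g : R -> pillowcase R) : Prop :=
  exists H : R * R -> pillowcase R,
    {within `[0, 1] `*` `[0, 1], continuous H} /\
    (forall u v, u \in `[0, 1] -> v \in `[0, 1] ->
       [/\ H (u, 0) = f u, H (u, 1) = g u, H (0, v) = H (1, v)
         & pillow_star (H (u, v))]).

Definition cat_path {R : realType} {T : Type} (f g : R -> T) (u : R) : T :=
  if u <= 2^-1 then f (2 * u) else g (2 * u - 1).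

(* H^1 = Hom(pi_1, Z/4): a class is given by its values on
   loops; values of z on functions that are not loops in P^* are irrelevant. *)
Definition is_H1_class {R : realType} (z : (R -> pillowcase R) -> 'Z_4) : Prop :=
  (forall f g, star_loop f -> star_loop g -> freely_homotopic f g -> z f = z g)
  /\ (forall f g, star_loop f -> star_loop g -> f 0 = g 0 ->
        z (cat_path f g) = z f + z g).

(* A half circle around a lattice point of R^2 closes up in P to a full loop
   around the corresponding corner, since the cone angle there is pi. *)
Definition corner_loop {R : realType} (m n : int) (r : R) (u : R) : pillowcase R :=
  pil (pi * m%:~R + r * cos (pi * u), pi * n%:~R + r * sin (pi * u)).

Definition is_pillow_class {R : realType} (z : (R -> pillowcase R) -> 'Z_4)
  : Prop :=
  is_H1_class z /\
  forall (m n : int) (r : R), 0 < r < pi / 2 -> z (corner_loop m n r) = 1.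

(* ((x0, x1), (x2, x3)) is x0 + x1 i + x2 j + x3 k *)
Definition quat (R : realType) : topologicalType := ((R * R) * (R * R))%type.

Definition qmul {R : realType} (x y : quat R) : quat R :=
  let: ((a, b), (c, d)) := x in let: ((a', b'), (c', d')) := y in
  ((a * a' - b * b' - c * c' - d * d', a * b' + b * a' + c * d' - d * c'),
   (a * c' - b * d' + c * a' + d * b', a * d' + b * c' - c * b' + d * a')).

Definition qconj {R : realType} (x : quat R) : quat R :=
  ((x.1.1, - x.1.2), (- x.2.1, - x.2.2)).

Definition SU2 {R : realType} : set (quat R) :=
  [set x | x.1.1 ^+ 2 + x.1.2 ^+ 2 + x.2.1 ^+ 2 + x.2.2 ^+ 2 = 1].

Definition qi {R : realType} : quat R := ((0, 1), (0, 0)).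

(* e^(t k) *)
Definition expk {R : realType} (t : R) : quat R := ((cos t, 0), (0, sin t)).

(* The group pi_1(Y \ T) with the images of the meridians of the four boundary
   punctures; every meridian of T is conjugate to one of them or its inverse. *)
Record tangle_group := TangleGroup {
  tgroup :> groupType;
  ma : tgroup; mb : tgroup; mc : tgroup; md : tgroup;
  meridian_rel : (mb * ma = mc * md)%g }.

Definition traceless {R : realType} (T : tangle_group) : set {ptws T -> quat R} :=
  [set rho | [/\ forall g, SU2 (rho g),
      forall g h, rho (g * h)%g = qmul (rho g) (rho h)
    & forall m, m \in [:: ma T; mb T; mc T; md T] -> (rho m).1.1 = 0]].

Arguments traceless {R} T _.

Definition conj_by {R : realType} (g x : quat R) : quat R :=
  qmul (qmul g x) (qconj g).

Definition conjugate_rel {R : realType} {T : tangle_group}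
    (rho rho' : traceless (R := R) T) : bool :=
  `[< exists g, SU2 g /\ forall h : T, val rho' h = conj_by g (val rho h) >].

Lemma conj_by1 (R : realType) (x : quat R) : conj_by ((1, 0), (0, 0)) x = x.
Proof. by case: x => [[a b] [c d] ]; congr (_, _, (_, _)) => /=; ring. Qed.

Lemma conj_byM (R : realType) (g h x : quat R) :
  conj_by g (conj_by h x) = conj_by (qmul g h) x.
Proof.
case: x g h => [[a b] [c d] ] [[e f] [k l] ] [[m n] [s t] ].
by congr (_, _, (_, _)) => /=; ring.
Qed.

Lemma qconjK (R : realType) (g : quat R) : SU2 g ->
  qmul (qconj g) g = ((1, 0), (0, 0)).
Proof.
case: g => [[a b] [c d] ]; rewrite /SU2 /= => E.
by congr (_, _, (_, _)) => /=; [rewrite -[RHS]E|..]; ring.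
Qed.

Lemma SU2_conj (R : realType) (g : quat R) : SU2 g -> SU2 (qconj g).
Proof. by rewrite /SU2 /= !sqrrN. Qed.

Lemma SU2_mul (R : realType) (g h : quat R) : SU2 g -> SU2 h -> SU2 (qmul g h).
Proof.
case: g h => [[a b] [c d] ] [[e f] [k l] ]; rewrite /SU2 /= => E F.
by rewrite -[RHS]mulr1 -{1}E -F; ring.
Qed.

Lemma conjugate_rel_refl (R : realType) (T : tangle_group) :
  reflexive (@conjugate_rel R T).
Proof.
move=> rho; apply/asboolP; exists ((1, 0), (0, 0)); split.
  by rewrite /SU2 /=; ring.
by move=> h; rewrite conj_by1.
Qed.

Lemma conjugate_rel_symm (R : realType) (T : tangle_group) :
  symmetric (@conjugate_rel R T).
Proof.
suff H (r r' : traceless (R := R) T) : conjugate_rel r r' -> conjugate_rel r' r.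
  by move=> r r'; apply/idP/idP => /H.
move=> /asboolP[g [Sg E] ]; apply/asboolP; exists (qconj g).
split; first exact: SU2_conj.
by move=> h; rewrite E conj_byM qconjK// conj_by1.
Qed.

Lemma conjugate_rel_trans (R : realType) (T : tangle_group) :
  transitive (@conjugate_rel R T).
Proof.
move=> r' r r'' /asboolP[g [Sg E] ] /asboolP[g' [Sg' E'] ]; apply/asboolP.
exists (qmul g' g); split; first exact: SU2_mul.
by move=> h; rewrite E' E conj_byM.
Qed.

Definition conjugate_equiv (R : realType) (T : tangle_group) :
    equiv_rel (traceless (R := R) T) :=
  EquivRel (@conjugate_rel R T) (@conjugate_rel_refl R T)
    (@conjugate_rel_symm R T) (@conjugate_rel_trans R T).

(* R(Y, T), with the quotient of the topology of pointwise convergence *)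
Definition charvar (R : realType) (T : tangle_group) : topologicalType :=
  quotient_topology {eq_quot (conjugate_equiv R T)}.

(* the restriction of rho to the four-punctured sphere is conjugate to the
   representation a |-> i, b |-> e^(gamma k) i, c |-> e^(theta k) i,
   d |-> e^((theta - gamma) k) i *)
Definition restricts_to {R : realType} {T : tangle_group} (rho : T -> quat R)
    (w : R * R) : Prop :=
  exists g, [/\ SU2 g, conj_by g (rho (ma T)) = qi,
    conj_by g (rho (mb T)) = qmul (expk w.1) qi,
    conj_by g (rho (mc T)) = qmul (expk w.2) qi
  & conj_by g (rho (md T)) = qmul (expk (w.2 - w.1)) qi].

(* L_1, through the identification R(S^2, {a,b,c,d}) = P *)
Definition restriction {R : realType} {T : tangle_group} (r : charvar R T)
  : pillowcase R :=
  xget (pil (0, 0)) [set x | exists2 w, x = pil w &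
    restricts_to (val (repr r)) w].

Definition is_arc_parametrization {R : realType} {X : topologicalType} (a b : R)
    (phi : R -> X) : Prop :=
  {within `[a, b], continuous phi} /\
  exists psi : X -> R, [/\ continuous psi, forall x, psi x \in `[a, b],
    cancel psi phi & forall t, t \in `[a, b] -> psi (phi t) = t].

Definition topological_embedding {X Y : topologicalType} (f : X -> Y) : Prop :=
  [/\ continuous f, injective f
    & forall U, open U -> exists2 V, open V & U = f @^-1` V].

(* the slope is y / x, possibly infinite (x = 0) *)
Definition linearly_embedded_arc {R : realType} {X : topologicalType}
    (f : X -> pillowcase R) (y x : R) : Prop :=
  topological_embedding f /\
  exists (a b : R) (phi : R -> X) (w v : R * R),
    [/\ a < b, is_arc_parametrization a b phi, v != 0, v.2 * x = y * v.1
      & forall t, t \in `[a, b] -> f (phi t) = pil (w.1 + t * v.1, w.2 + t * v.2)].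

Definition smooth1 {R : realType} (f : R -> R) : Prop :=
  forall n t, derivable (derive1n n f) t 1.

Definition velocity {R : realType} (L : R -> R * R) (t : R) : R * R :=
  (derive1 (fst \o L) t, derive1 (snd \o L) t).

Definition dist2 {R : realType} (w c : R * R) : R :=
  Num.sqrt ((w.1 - c.1) ^+ 2 + (w.2 - c.2) ^+ 2).

(* R^2 minus the open discs of radius d around the lattice points; its image is
   P minus neighborhoods of the corners *)
Definition truncated_plane {R : realType} (d : R) : set (R * R) :=
  [set w | forall c, lattice c -> d <= dist2 w c].

(* The point L t of the universal cover of the truncated pillowcase is modelled
   in the usual way, as the homotopy class of the path L|[a,t]. *)
Definition lift_to_universal_cover_embedded {R : realType} (d a b : R)
    (L : R -> R * R) : Prop :=
  forall s t, s \in `[a, b] -> t \in `[a, b] ->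
    homotopic_rel_ends (pil @` truncated_plane d)
      (fun u => pil (L (a + u * (s - a)))) (fun u => pil (L (a + u * (t - a)))) ->
    s = t.

Definition on_boundary_transversely {R : realType} (d : R) (L : R -> R * R)
    (t : R) : Prop :=
  exists c, [/\ lattice c, dist2 (L t) c = d
    & (velocity L t).1 * ((L t).1 - c.1) + (velocity L t).2 * ((L t).2 - c.2) != 0].

Definition restricted_immersed_arc {R : realType} (A : set (pillowcase R))
  : Prop :=
  exists (a b : R) (L : R -> R * R),
    [/\ a < b /\ A = (pil \o L) @` `[a, b],
        smooth1 (fst \o L) /\ smooth1 (snd \o L),
        forall t, t \in `[a, b] -> velocity L t != 0,
        [/\ lattice (L a), lattice (L b)
          & forall t, t \in `]a, b[ -> ~ lattice (L t)]
      & \forall d \near 0^'+, exists a' b',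
        [/\ a < a' < b' /\ b' < b,
            [set t | t \in `[a, b] /\ truncated_plane d (L t)] = [set` `[a', b']],
            on_boundary_transversely d L a' /\ on_boundary_transversely d L b',
            pil (L a') <> pil (L b')
          & lift_to_universal_cover_embedded d a' b' L]].

(* An immersed curve in P is given by a lift to R^2. If period != 0 its domain
   is the circle R / period, otherwise it is dom. *)
Record curve (R : realType) := Curve {
  lift :> R -> R * R; dom : set R; period : R }.

Definition crv {R : realType} (L : curve R) (t : R) : pillowcase R := pil (L t).

Definition same_param {R : realType} (L : curve R) (s t : R) : Prop :=
  exists k : int, t = s + k%:~R * period L.

(* one representative for each point of the domain *)
Definition params {R : realType} (L : curve R) : set R :=
  if period L == 0 then dom L else [set t | 0 <= t < period L].

Definition L0_curve {R : realType} (eps : R) : curve R :=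
  Curve (fun t => (t + eps * sin t + pi / 2, t - eps * sin t + pi / 2))
    setT (2 * pi).

Definition L1_curve (R : realType) (p : nat) (q : int) : curve R :=
  Curve (fun t => (q%:~R * t, (q - p%:Z)%:~R * t)) `[0, pi] 0.

Definition crossings {R : realType} (L0 L1 : curve R) : set (R * R) :=
  [set x | [/\ params L0 x.1, params L1 x.2, crv L0 x.1 = crv L1 x.2
             & pillow_star (crv L0 x.1)]].

(* th is an angle of the line spanned by v *)
Definition line_angle {R : realType} (v : R * R) (th : R) : Prop :=
  exists2 r, r != 0 & v = (r * cos th, r * sin th).

(* Signed number of times that a path of line angles from th0 to th1 crosses the
   lines of angle pi/4 + d, for arbitrarily small d > 0; it only depends on the
   end points of the lift of the path to the universal cover of RP^1. *)
Definition line_degree {R : realType} (th0 th1 : R) (m : int) : Prop :=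
  \forall d \near (0 : R)^'+,
    m = Num.floor ((th1 - (pi / 4 + d)) / pi) - Num.floor ((th0 - (pi / 4 + d)) / pi).

Definition maslov {R : realType} (L : curve R) (alpha : R -> R) (m : int) : Prop :=
  exists th : R -> R, [/\ {within `[0, 1], continuous th},
    forall u, u \in `[0, 1] -> line_angle (velocity L (alpha u)) (th u)
  & line_degree (th 0) (th 1) m].

Definition tau {R : realType} (L0 L1 : curve R) (x : R * R) (m : int) : Prop :=
  exists th0 th1 : R,
    [/\ line_angle (velocity L0 x.1) th0, line_angle (velocity L1 x.2) th1,
        th0 - pi < th1 <= th0 & line_degree th0 th1 (- m)].

(* paths in the domain of L, from s to t, staying over P^* *)
Definition param_path {R : realType} (L : curve R) (s t : R) (alpha : R -> R)
  : Prop :=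
  [/\ {within `[0, 1], continuous alpha}, same_param L s (alpha 0),
      same_param L t (alpha 1)
    & forall u, u \in `[0, 1] -> dom L (alpha u) /\ pillow_star (crv L (alpha u))].

Definition grading_loop {R : realType} (L0 L1 : curve R) (alpha0 alpha1 : R -> R)
  : R -> pillowcase R :=
  cat_path (crv L0 \o alpha0) (crv L1 \o alpha1).

Definition rel_grading {R : realType} (L0 L1 : curve R)
    (z : (R -> pillowcase R) -> 'Z_4) (x y : R * R) (g : 'Z_4) : Prop :=
  exists (alpha0 alpha1 : R -> R) (m0 m1 tx ty : int),
    [/\ param_path L0 x.1 y.1 alpha0 /\ param_path L1 y.2 x.2 alpha1,
        maslov L0 alpha0 m0 /\ maslov L1 alpha1 m1,
        tau L0 L1 x tx /\ tau L0 L1 y ty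
      & g = (m0 + m1 + tx - ty)%:~R + z (grading_loop L0 L1 alpha0 alpha1)].

Definition is_grading {R : realType} (L0 L1 : curve R)
    (z : (R -> pillowcase R) -> 'Z_4) (gr : R * R -> 'Z_4) : Prop :=
  forall x y g, crossings L0 L1 x -> crossings L0 L1 y ->
    rel_grading L0 L1 z x y g -> gr x - gr y = g.

Fixpoint Cn {R : realType} (n : nat) (f : R * R -> R) : Prop :=
  if n is m.+1 then
    [/\ forall w v, derivable f w v, Cn m ('D_(1, 0) f) & Cn m ('D_(0, 1) f)]
  else continuous f.

Definition smooth2 {R : realType} (f : R * R -> R * R) : Prop :=
  forall n, Cn n (fst \o f) /\ Cn n (snd \o f).

Definition jacobian {R : realType} (f : R * R -> R * R) (w : R * R) : R :=
  'D_(1, 0) (fst \o f) w * 'D_(0, 1) (snd \o f) w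
  - 'D_(0, 1) (fst \o f) w * 'D_(1, 0) (snd \o f) w.

(* The standard bigon, with corners (-1, 0) and (1, 0) of angle < pi. An
   immersion is a local diffeomorphism at the corners too, hence the image has
   convex corners there. *)
Definition bigon_domain {R : realType} : set (R * R) :=
  [set w | `|w.2| <= 1 - w.1 ^+ 2].

(* The clockwise boundary runs along the upper edge from (-1, 0) to (1, 0), and
   back along the lower edge. *)
Definition is_bigon {R : realType} (L0 L1 : curve R) (x y : R * R)
    (u : R * R -> pillowcase R) : Prop :=
  [/\ forall w, bigon_domain w -> pillow_star (u w) /\
        exists f : R * R -> R * R, [/\ smooth2 f, 0 < jacobian f w
          & \forall w' \near w, bigon_domain w' -> u w' = pil (f w')],
      exists a0 : R -> R, [/\ {within `[-1, 1], continuous a0},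
        same_param L0 y.1 (a0 (-1)), same_param L0 x.1 (a0 1)
      & forall s, s \in `[-1, 1] ->
          dom L0 (a0 s) /\ u (s, 1 - s ^+ 2) = crv L0 (a0 s)]
    & exists a1 : R -> R, [/\ {within `[-1, 1], continuous a1},
        same_param L1 y.2 (a1 (-1)), same_param L1 x.2 (a1 1)
      & forall s, s \in `[-1, 1] ->
          dom L1 (a1 s) /\ u (s, s ^+ 2 - 1) = crv L1 (a1 s)]].

(* Orientation preserving diffeomorphisms of the bigon fixing its corners. Maps
   on the bigon are compared on bigon_domain only. *)
Definition reparametrization {R : realType} (u u' : R * R -> pillowcase R)
  : Prop :=
  exists psi psi' : R * R -> R * R,
    [/\ smooth2 psi /\ smooth2 psi',
        forall w, bigon_domain w ->
          [/\ bigon_domain (psi w), bigon_domain (psi' w), psi' (psi w) = w,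
              psi (psi' w) = w & 0 < jacobian psi w],
        psi (-1, 0) = (-1, 0), psi (1, 0) = (1, 0)
      & forall w, bigon_domain w -> u' w = u (psi w)].

Definition bigons {R : realType} (L0 L1 : curve R) (x y : R * R)
  : set (set (R * R -> pillowcase R)) :=
  [set c | exists2 u, is_bigon L0 L1 x y u &
     c = [set u' | is_bigon L0 L1 x y u' /\ reparametrization u u']].

(* fset_set A is empty when A is infinite *)
Definition floer_complex {R : realType} (L0 L1 : curve R) : vectType 'F_2 :=
  {ffun fset_set (crossings L0 L1) -> ('F_2)^o}.

Definition differential_fun {R : realType} (L0 L1 : curve R)
    (c : floer_complex L0 L1) : floer_complex L0 L1 :=
  [ffun y => \sum_x c x * #|` fset_set (bigons L0 L1 (val x) (val y))|%:R].

Lemma differential_fun_linear (R : realType) (L0 L1 : curve R) :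
  linear (@differential_fun R L0 L1).
Proof.
move=> a c c'; apply/ffunP => y; rewrite !ffunE scaler_sumr -big_split /=.
by apply: eq_bigr => x _; rewrite !ffunE mulrDl -scalerAl.
Qed.

HB.instance Definition _ (R : realType) (L0 L1 : curve R) :=
  GRing.isLinear.Build 'F_2 (floer_complex L0 L1) (floer_complex L0 L1) _
    (@differential_fun R L0 L1) (@differential_fun_linear R L0 L1).

Definition differential {R : realType} (L0 L1 : curve R)
  : 'End(floer_complex L0 L1) := linfun (@differential_fun R L0 L1).

Definition cycles {R : realType} (L0 L1 : curve R) : vectType 'F_2 :=
  subvs_of (lker (differential L0 L1)).

Definition boundaries {R : realType} (L0 L1 : curve R)
  : {vspace cycles L0 L1} :=
  (linfun (@vsval _ _ (lker (differential L0 L1)))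
     @^-1: limg (differential L0 L1))%VS.

Definition homology {R : realType} (L0 L1 : curve R) : zmodType :=
  Quotient.quot (pred_of_vspace (boundaries L0 L1)).

(* 2b_1 - 1/(2b_2 - 1/( ... - 1/(2b_n))) as numerator and denominator *)
Fixpoint even_cfrac (b : seq int) : int * int :=
  if b is b1 :: s then
    (2 * b1 * (even_cfrac s).1 - (even_cfrac s).2, (even_cfrac s).1)
  else (1, 0).

(* K(p, q) is the boundary of the plumbing of a linear chain of annuli with
   b_1, ..., b_n full twists (n even). *)
Definition is_even_expansion (p : nat) (q : int) (b : seq int) : Prop :=
  ~~ odd (size b) /\
  exists2 q' : int, (q' = q %[mod p%:Z])%Z &
    even_cfrac b = (p%:Z, q') \/ even_cfrac b = (- p%:Z, - q').

Definition seifert_matrix (b : seq int) : 'M[int]_(size b) :=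
  \matrix_(i, j) if i == j then nth 0 b i else if j == i.+1 :> nat then 1 else 0.

Definition is_matrix_signature {R : realType} (n : nat) (A : 'M[R]_n) (s : int)
  : Prop :=
  exists2 e : seq R, char_poly A = \prod_(x <- e) ('X - x%:P) &
    s = (count (fun x => 0 < x) e)%:Z - (count (fun x => x < 0) e)%:Z.

(* The signature of V + V^T for a Seifert matrix V of K(p, q); it is even, so
   its class mod 4 is the same for K(p, q) and its mirror image. *)
Definition two_bridge_signature (R : realType) (p : nat) (q : int) (s : int)
  : Prop :=
  exists2 b, is_even_expansion p q b &
    is_matrix_signature
      (map_mx (fun k : int => k%:~R : R) (seifert_matrix b + (seifert_matrix b)^T))
      s.

Definition vanishing_crossing_family {R : realType} (L1 : curve R)
    (r : R -> R * R) : Prop :=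
  exists2 e0 : R, 0 < e0 &
    [/\ forall eps, 0 < eps < e0 -> crossings (L0_curve eps) L1 (r eps),
        {within `]0, e0[, continuous (fun eps => crv L1 (r eps).2)}
      & (fun eps => crv L1 (r eps).2) @ 0^'+ --> pil (0, 0)].

(* uniqueness is that of the germ at eps = 0 *)
Definition is_r_plus {R : realType} (L1 : curve R) (r : R -> R * R) : Prop :=
  vanishing_crossing_family L1 r /\
  forall r', vanishing_crossing_family L1 r' ->
    \forall eps \near 0^'+, r' eps = r eps.

Definition x_point (R : realType) (p : nat) (q : int) (l : nat) : pillowcase R :=
  crv (L1_curve R p q) (2 * pi * l%:R / p%:R).

(* x_l^+ for s = true, x_l^- for s = false *)
Definition is_x_crossing {R : realType} (p : nat) (q : int) (l : nat) (s : bool)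
    (x : R -> R * R) : Prop :=
  exists2 N0, nbhs (x_point R p q l) N0 &
    forall N, nbhs (x_point R p q l) N -> N `<=` N0 ->
    \forall eps \near 0^'+, forall y,
      [/\ crossings (L0_curve eps) (L1_curve R p q) y, N (crv (L0_curve eps) y.1)
        & let v := velocity (L0_curve eps) y.1 in
          if s then v.2 / v.1 < 1 else 1 < v.2 / v.1]
      <-> y = x eps.

(* Main.v *)
From HB Require Import structures.
Require Import Defs.
From mathcomp Require Import all_boot all_order all_algebra finmap.
From mathcomp Require Import generic_quotient ring_quotient.
From mathcomp Require Import all_classical all_reals all_analysis.
From mathcomp Require Import ring lra zify.
Import Order.TTheory GRing.Theory Num.Theory numFieldNormedType.Exports.
Local Open Scope classical_set_scope.
Local Open Scope ring_scope.

(** Everything becomes explicit in the diagonal coordinates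
    [U = (gamma + theta) / 2] and [V = (theta - gamma) / 2] of the plane.  There
    the lifts of the figure eight are the graph [V = eps * cos U] and its images
    under the deck group, and the arc is the straight segment
    [(m t / 2, - p t / 2)] with [m = 2 q - p].

    Intersections.  An intersection is a solution of
    [p t / 2 = pi l + d * cos (m t / 2)] with [d = eps] or [d = - eps].  For small
    [eps] the equation is a perturbation of [p t / 2 = pi l], it has exactly one
    solution for each [l] and [d], and the solutions in the domain of the arc are
    those with [0 <= l <= (p - 1) / 2], except that [d = - eps] is excluded for
    [l = 0] ([crossingsP]).  The two solutions for the same [l] lie on the two
    branches of the figure eight because [sin (m pi l / p)] does not vanish
    ([branch_neq0], [x_pt_cos]).

    Gradings.  The arc is never tangent to the diagonal direction and is farther
    from it than all tangent lines of the figure eight ([L1_angle_far]).  Hence the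
    Maslov index of the figure eight and the two corrections at the corners cancel,
    and the relative grading is the value of the class [z] on the loop
    ([rel_gradingP]).  That value does not depend on the paths, since the figure
    eight is a product of a counterclockwise and of a clockwise loop around two
    corners and [z] vanishes on it ([L0_loop_trivial]); it satisfies the cocycle
    identity by rotation of loops ([loop_value_cocycle]), and equals 1 from [x_l^+]
    to [x_l^-] because that loop lifts to a path that passes below a lattice point
    and joins two points exchanged by the half turn around it ([corner_ccw],
    [x_grading_value]).

    Differential.  There are no immersed bigons at all ([no_bigon]).  A bigon lifts
    to the plane ([lift_square]), where the line, being steeper than the graph,
    meets it at most once; so the edge of the bigon along the arc starts and ends
    at the same parameter ([bigon_same_param]).  By Rolle's theorem the velocity of
    that edge vanishes somewhere, against the immersion condition.

    The embedding statements hold because the arc is injective in the pillowcase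
    ([L1_inj]), which is Hausdorff, being embedded in 3-space by [cos gamma],
    [cos theta] and [sin gamma * sin theta] ([pil_sepP]). *)


(** * Trigonometry modulo [pi] *)

(** The sign [(-1)^k] of an integer [k]. *)
Definition isign {R : realType} (k : int) : R := (-1) ^+ `|k|%N.

Lemma isign_cases (R : realType) (k : int) :
  isign k = 1 :> R \/ isign k = -1 :> R.
Proof. by rewrite /isign -signr_odd; case: odd; [right|left]. Qed.

Lemma isign_sqr (R : realType) (k : int) : isign k * isign k = 1 :> R.
Proof. by case: (isign_cases R k) => ->; rewrite ?mulr1// mulrNN mulr1. Qed.

Lemma isign_double (R : realType) (k j : int) :
  isign (k + 2 * j) = isign k :> R.
Proof.
rewrite /isign -[LHS]signr_odd -[RHS]signr_odd; congr (_ ^+ nat_of_bool _); lia.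
Qed.

Lemma isignN (R : realType) (k : int) : isign (- k) = isign k :> R.
Proof. by rewrite /isign abszN. Qed.

Lemma sin_pi_nat (R : realType) (x : R) (n : nat) :
  sin (x + pi * n%:R) = (-1) ^+ n * sin x.
Proof.
elim: n x => [|n IH] x; first by rewrite mulr0 addr0 expr0 mul1r.
rewrite -natr1 mulrDr mulr1 addrA sinDpi IH exprS; ring.
Qed.

Lemma cos_pi_nat (R : realType) (x : R) (n : nat) :
  cos (x + pi * n%:R) = (-1) ^+ n * cos x.
Proof.
elim: n x => [|n IH] x; first by rewrite mulr0 addr0 expr0 mul1r.
rewrite -natr1 mulrDr mulr1 addrA cosDpi IH exprS; ring.
Qed.

Lemma sin_pi_int (R : realType) (x : R) (k : int) :
  sin (x + pi * k%:~R) = isign k * sin x.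
Proof.
case: k => n; first exact: sin_pi_nat.
have s2 : (-1) ^+ n.+1 * (-1) ^+ n.+1 = 1 :> R by rewrite -expr2 sqrr_sign.
rewrite NegzE rmorphN mulrN -[in RHS](subrK (pi * n.+1%:R) x) isignN.
by rewrite sin_pi_nat mulrA /isign absz_nat s2 mul1r.
Qed.

Lemma cos_pi_int (R : realType) (x : R) (k : int) :
  cos (x + pi * k%:~R) = isign k * cos x.
Proof.
case: k => n; first exact: cos_pi_nat.
have s2 : (-1) ^+ n.+1 * (-1) ^+ n.+1 = 1 :> R by rewrite -expr2 sqrr_sign.
rewrite NegzE rmorphN mulrN -[in RHS](subrK (pi * n.+1%:R) x) isignN.
by rewrite cos_pi_nat mulrA /isign absz_nat s2 mul1r.
Qed.

Lemma mod_pi (R : realType) (x : R) : exists k : int, 0 <= x - pi * k%:~R < pi.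
Proof.
exists (Num.floor (x / pi)); have p0 := @pi_gt0 R.
have E : x = pi * (x / pi) by rewrite mulrCA divff ?mulr1// gt_eqF.
have /andP[A B] := real_floor_itv (num_real (x / pi)).
rewrite {1 3}E -mulrBr mulr_ge0 ?(ltW p0) ?subr_ge0//=.
by rewrite -[ltRHS]mulr1 ltr_pM2l// ltrBlDl; move: B; rewrite intrD.
Qed.

Lemma mod_2pi (R : realType) (x : R) :
  exists k : int, 0 <= x - 2 * pi * k%:~R < 2 * pi.
Proof.
exists (Num.floor (x / (2 * pi))); have p0 := @pi_gt0 R.
have p2 : 0 < 2 * pi :> R by rewrite mulr_gt0.
have E : x = 2 * pi * (x / (2 * pi)) by rewrite mulrCA divff ?mulr1// gt_eqF.
have /andP[A B] := real_floor_itv (num_real (x / (2 * pi))).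
rewrite {1 3}E -mulrBr mulr_ge0 ?(ltW p2) ?subr_ge0//=.
by rewrite -[ltRHS]mulr1 ltr_pM2l// ltrBlDl; move: B; rewrite intrD.
Qed.

Lemma sin_eq0P (R : realType) (x : R) :
  sin x = 0 <-> exists k : int, x = pi * k%:~R.
Proof.
split=> [E|[k ->]]; last first.
  by rewrite -[pi * _]add0r sin_pi_int sin0 mulr0.
have [k /andP[k0 k1]] := mod_pi _ x; exists k.
apply: contrapT => /eqP; rewrite -subr_eq0 => N.
have : 0 < sin (x - pi * k%:~R).
  by apply: sin_gt0_pi; rewrite k1 lt_neqAle eq_sym N k0.
by rewrite -mulrN -rmorphN sin_pi_int E mulr0 ltxx.
Qed.

Lemma cos_eq1P (R : realType) (x : R) :
  cos x = 1 <-> exists k : int, x = 2 * pi * k%:~R.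
Proof.
split=> [E|[k ->]]; last first.
  rewrite (_ : 2 * pi * _ = 0 + pi * (0 + 2 * k)%:~R) ?cos_pi_int.
    by rewrite isign_double cos0 mulr1.
  by rewrite !add0r intrM; ring.
have : sin x = 0.
  by apply/eqP; rewrite -norm_cos_eq1 E normr1.
move=> /sin_eq0P[k xk]; move: E; rewrite xk -[pi * _]add0r cos_pi_int cos0 mulr1.
rewrite /isign -signr_odd => E.
have ev : ~~ odd `|k|%N.
  by apply/negP => o; move: E; rewrite o expr1; lra.
have {}ev : k = 2 * (k %/ 2)%Z by lia.
by exists (k %/ 2)%Z; rewrite {1}ev intrM add0r; ring.
Qed.

Lemma cos_eqP (R : realType) (x y : R) : cos x = cos y <->
  exists (e : bool) (k : int), y = (-1) ^+ e * x + 2 * pi * k%:~R.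
Proof.
split=> [E|[e [k ->]]]; last first.
  rewrite (_ : 2 * pi * _ = pi * (0 + 2 * k)%:~R) ?cos_pi_int.
    rewrite isign_double /isign expr0 mul1r.
    by case: e; rewrite ?expr1 ?mulN1r ?expr0 ?mul1r// cosN.
  by rewrite add0r intrM; ring.
have /eqP : sin ((y - x) / 2) * sin ((y + x) / 2) = 0.
  have A : (y + x) / 2 + (y - x) / 2 = y by field.
  have B : (y + x) / 2 - (y - x) / 2 = x by field.
  by move: E; rewrite -[in LHS]B -[in RHS]A cosB cosD; lra.
rewrite mulf_eq0 => /orP[]/eqP/sin_eq0P[k Ek].
  by exists false, k; rewrite expr0; lra.
by exists true, k; rewrite expr1; lra.
Qed.

(** * The pillowcase *)

Lemma pil_eqP (R : realType) (w w' : R * R) : pil w = pil w' <->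
  exists (e : bool) (k l : int),
    w'.1 = (-1) ^+ e * w.1 + 2 * pi * k%:~R /\
    w'.2 = (-1) ^+ e * w.2 + 2 * pi * l%:~R.
Proof.
rewrite /pil; split.
  by move=> /eqmodP/asboolP.
by move=> H; apply/eqmodP/asboolP.
Qed.

Lemma pil_continuous (R : realType) : continuous (@pil R).
Proof. exact: pi_continuous. Qed.

Lemma pil_surj (R : realType) (x : pillowcase R) : exists w, x = pil w.
Proof. by exists (repr x); rewrite /pil reprK. Qed.

(** The functions [cos gamma], [cos theta] and [sin gamma * sin theta] separate
    the points of the pillowcase; hence it embeds in 3-space. *)
Lemma pil_sepP (R : realType) (w w' : R * R) : pil w = pil w' <->
  [/\ cos w.1 = cos w'.1, cos w.2 = cos w'.2
    & sin w.1 * sin w.2 = sin w'.1 * sin w'.2].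
Proof.
have P2 (k : int) : 2 * pi * k%:~R = pi * (0 + 2 * k)%:~R :> R.
  by rewrite add0r intrM; ring.
have si0 (k : int) : isign (0 + 2 * k) = 1 :> R.
  by rewrite isign_double /isign expr0.
split=> [/pil_eqP[e [k [l [E1 E2]]]]|[C1 C2 S]].
  split; [by apply/cos_eqP; exists e, k|by apply/cos_eqP; exists e, l|].
  rewrite E1 E2 !P2 !sin_pi_int !si0 !mul1r.
  by case: e {E1 E2}; rewrite ?expr1 ?expr0 ?mul1r// !mulN1r !sinN mulrNN.
apply/pil_eqP.
move: C1 C2 => /cos_eqP[e [k E1]] /cos_eqP[f [l E2]].
have [fe|fe] := eqVneq f e; first by exists e, k, l; rewrite E1 E2 fe.
have S0 : sin w.1 * sin w.2 = 0.
  move: S; rewrite E1 E2 !P2 !sin_pi_int !si0 !mul1r.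
  by case: e f {E1 E2} fe => [] []//= _;
    rewrite ?expr1 ?expr0 ?mul1r ?mulN1r sinN; lra.
move: S0 => /eqP; rewrite mulf_eq0 => /orP[]/eqP/sin_eq0P[j Ej].
  exists f, (k + (if e then -1 else 1) * j), l; split=> //.
  rewrite E1 Ej intrD intrM.
  by case: e f fe {E1 E2} => [] []//= _; rewrite ?expr1 ?expr0; ring.
exists e, k, (l + (if f then -1 else 1) * j); split=> //.
rewrite E2 Ej intrD intrM.
by case: e f fe {E1 E2} => [] []//= _; rewrite ?expr1 ?expr0; ring.
Qed.

Lemma pillowcase_function_continuous (R : realType) (g : R * R -> R) :
  continuous g -> (forall w w', pil w = pil w' -> g w = g w') ->
  exists2 h : pillowcase R -> R, continuous h & forall w, h (pil w) = g w.
Proof.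
move=> cg Hg; exists (g \o (repr : pillowcase R -> R * R)).
  apply: repr_comp_continuous => // a b /eqP ab; apply/eqP; exact: Hg.
by move=> w /=; apply: Hg; rewrite /pil reprK.
Qed.

Lemma pillowcase_hausdorff (R : realType) : hausdorff_space (pillowcase R).
Proof.
move=> x y xy.
have sep (h : pillowcase R -> R) : continuous h -> h x = h y.
  move=> ch; apply: (@Rhausdorff R) => A B hA hB.
  have [z [zA zB]] := xy _ _ (ch x _ hA) (ch y _ hB).
  by exists (h z).
have [v xv] := @pil_surj _ x; have [v' yv] := @pil_surj _ y.
have cf : continuous (fun w : R * R => w.1) by move=> ?; exact: cvg_fst.
have cs : continuous (fun w : R * R => w.2) by move=> ?; exact: cvg_snd.
have [h1 ch1 H1] := @pillowcase_function_continuous R (fun w => cos w.1)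
  (fun w => continuous_comp (cf w) (@continuous_cos R _))
  (fun w w' E => let: And3 E1 _ _ := (pil_sepP _ _ _).1 E in E1).
have [h2 ch2 H2] := @pillowcase_function_continuous R (fun w => cos w.2)
  (fun w => continuous_comp (cs w) (@continuous_cos R _))
  (fun w w' E => let: And3 _ E2 _ := (pil_sepP _ _ _).1 E in E2).
have [h3 ch3 H3] := @pillowcase_function_continuous R
  (fun w => sin w.1 * sin w.2)
  (fun w => continuousM (continuous_comp (cf w) (@continuous_sin R _))
     (continuous_comp (cs w) (@continuous_sin R _)))
  (fun w w' E => let: And3 _ _ E3 := (pil_sepP _ _ _).1 E in E3).
rewrite xv yv; apply/pil_sepP.
by split; [have := sep _ ch1|have := sep _ ch2|have := sep _ ch3];
  rewrite xv yv ?H1 ?H2 ?H3.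
Qed.

Lemma lattice_pil (R : realType) (w w' : R * R) :
  pil w = pil w' -> lattice w -> lattice w'.
Proof.
move=> /pil_eqP[e [k [l [E1 E2]]]] [m [n W]].
exists ((if e then -1 else 1) * m + 2 * k), ((if e then -1 else 1) * n + 2 * l).
rewrite [w']surjective_pairing E1 E2 W /= !(intrD, intrM).
by case: e {E1 E2}; rewrite ?expr1 ?expr0; congr (_, _); ring.
Qed.

Lemma pillow_star_pil (R : realType) (w : R * R) :
  pillow_star (pil w) <-> ~ lattice w.
Proof.
split=> [H L|L [w' L' E]]; first by apply: H; exists w.
exact/L/(lattice_pil _ _ _ E).
Qed.

(** * Continuity *)

Lemma cont_cos (R : realType) (X : topologicalType) (f : X -> R) (x : X) :
  continuous_at x f -> continuous_at x (fun y => cos (f y)).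
Proof. by move=> cf; apply: continuous_comp cf _; exact: continuous_cos. Qed.

Lemma cont_sin (R : realType) (X : topologicalType) (f : X -> R) (x : X) :
  continuous_at x f -> continuous_at x (fun y => sin (f y)).
Proof. by move=> cf; apply: continuous_comp cf _; exact: continuous_sin. Qed.

Lemma cont_fst (X Y Z : topologicalType) (f : X -> Y * Z) (x : X) :
  continuous_at x f -> continuous_at x (fun y => (f y).1).
Proof. by move=> cf; apply: cvg_comp cf _; exact: cvg_fst. Qed.

Lemma cont_snd (X Y Z : topologicalType) (f : X -> Y * Z) (x : X) :
  continuous_at x f -> continuous_at x (fun y => (f y).2).
Proof. by move=> cf; apply: cvg_comp cf _; exact: cvg_snd. Qed.

Lemma cont_pair (X Y Z : topologicalType) (f : X -> Y) (g : X -> Z) (x : X) :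
  continuous_at x f -> continuous_at x g -> continuous_at x (fun y => (f y, g y)).
Proof. by move=> cf cg; exact: cvg_pair. Qed.

Lemma cont_comp (X Y Z : topologicalType) (f : Y -> Z) (g : X -> Y) (x : X) :
  continuous f -> continuous_at x g -> continuous_at x (fun y => f (g y)).
Proof. by move=> cf cg; apply: continuous_comp cg _; exact: cf. Qed.

Lemma cont_pil (R : realType) (X : topologicalType) (f : X -> R * R) (x : X) :
  continuous_at x f -> continuous_at x (fun y => pil (f y)).
Proof. by move=> cf; apply: continuous_comp cf _; exact: pil_continuous. Qed.

Section ContinuousAt.
Variables (R : realType) (X Y : topologicalType) (x : X).
Implicit Types (f g : X -> R).

Lemma contD f g : continuous_at x f -> continuous_at x g ->
  continuous_at x (fun y => f y + g y).
Proof. by move=> cf cg; apply: cvgD. Qed.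

Lemma contN f : continuous_at x f -> continuous_at x (fun y => - f y).
Proof. by move=> cf; apply: cvgN. Qed.

Lemma contM f g : continuous_at x f -> continuous_at x g ->
  continuous_at x (fun y => f y * g y).
Proof. by move=> cf cg; apply: cvgM. Qed.

Lemma cont_norm f : continuous_at x f -> continuous_at x (fun y => `|f y|).
Proof. by move=> cf; apply: cvg_norm. Qed.

Lemma cont_cst (c : Y) : continuous_at x (fun _ : X => c).
Proof. exact: cvg_cst. Qed.

Lemma cont_id : continuous_at x (fun y : X => y).
Proof. exact: cvg_id. Qed.
End ContinuousAt.

(** The affine path from [a] to [b]. *)
Definition lin {R : realType} (a b u : R) : R := a + u * (b - a).

Lemma lin0 (R : realType) (a b : R) : lin a b 0 = a.
Proof. by rewrite /lin mul0r addr0. Qed.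

Lemma lin1 (R : realType) (a b : R) : lin a b 1 = b.
Proof. by rewrite /lin mul1r addrC subrK. Qed.

Lemma cont_lin (R : realType) (X : topologicalType) (a b : R) (f : X -> R) (x : X) :
  continuous_at x f -> continuous_at x (fun y => lin a b (f y)).
Proof.
by move=> cf; apply: contD; [exact: cont_cst|apply: contM => //; exact: cont_cst].
Qed.

(** Proves continuity of an explicit expression built from functions that are
    known to be continuous. *)
Ltac cont_step :=
  lazymatch goal with
  | |- continuous_at ?x ?f =>
    lazymatch f with
    | (fun y => y) => exact (@cont_id _ _)
    | (fun _ => ?c) => exact (@cont_cst _ _ _ c)
    | (fun y => @?a y + @?b y) => apply (@contD _ _ x a b); cont_step
    | (fun y => - @?a y) => apply (@contN _ _ x a); cont_step
    | (fun y => @?a y * @?b y) => apply (@contM _ _ x a b); cont_step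
    | (fun y => `|@?a y|) => apply (@cont_norm _ _ x a); cont_step
    | (fun y => cos (@?a y)) => apply (@cont_cos _ _ a x); cont_step
    | (fun y => sin (@?a y)) => apply (@cont_sin _ _ a x); cont_step
    | (fun y => fst (@?a y)) => apply (@cont_fst _ _ _ a x); cont_step
    | (fun y => snd (@?a y)) => apply (@cont_snd _ _ _ a x); cont_step
    | (fun y => pil (@?a y)) => apply (@cont_pil _ _ a x); cont_step
    | (fun y => (@?a y, @?b y)) => apply (@cont_pair _ _ _ a b x); cont_step
    | (fun y => lin ?c ?d (@?a y)) => apply (@cont_lin _ _ c d a x); cont_step
    | (fun y => ?F (@?a y)) =>
      match goal with H : continuous _ |- _ =>
        apply (@cont_comp _ _ _ F a x H); cont_step end
    | ?F => match goal with H : continuous _ |- _ => exact (H x) end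
    end
  end.
Ltac cont := let x := fresh "x" in intro x; cbv beta; cont_step.

Lemma lin_cont (R : realType) (a b : R) : continuous (lin a b).
Proof. by move=> x; exact: (@cont_lin _ _ a b id x (@cont_id _ x)). Qed.

(** The retraction of the line onto the unit interval. *)
Definition clamp {R : realType} (x : R) : R := (1 + `|x| - `|x - 1|) / 2.

Lemma clamp_id (R : realType) (x : R) : 0 <= x <= 1 -> clamp x = x.
Proof.
move=> /andP[x0 x1]; rewrite /clamp (ger0_norm x0) ler0_norm ?subr_le0//.
by field.
Qed.

Lemma clamp01 (R : realType) (x : R) : 0 <= clamp x <= 1.
Proof.
by rewrite /clamp; case: (ger0P x) => x0; case: (ger0P (x - 1)) => x1;
  apply/andP; split; lra.
Qed.

Lemma clamp_cont (R : realType) : continuous (@clamp R).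
Proof. rewrite /clamp; cont. Qed.

Lemma within_clamp (R : realType) (X : topologicalType) (f : R -> X) :
  {within `[0, 1], continuous f} -> continuous (f \o clamp).
Proof.
move=> /subspace_continuousP cf x.
have I : `[0, 1]%classic (clamp x) by rewrite /= in_itv/= clamp01.
apply: (@cvg_comp _ _ _ clamp f _ _ _ _ (cf _ I)) => A /= fA.
have H : \forall y \near x, `[0, 1]%classic (clamp y) -> A (clamp y).
  exact: clamp_cont _ x _ fA.
by near=> y; have /(_ _)/= := near H y; apply => //; rewrite in_itv/= clamp01.
Unshelve. all: by end_near. Qed.

Lemma clamp_within (R : realType) (X : topologicalType) (f g : R -> X) :
  continuous g -> (forall x, 0 <= x <= 1 -> f x = g x) ->
  {within `[0, 1], continuous f}.
Proof.
move=> cg E; have := @continuous_subspaceT _ _ (`[(0 : R), 1]%classic : set R) g cg.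
apply: subspace_eq_continuous => x; rewrite inE /= in_itv/= => xI.
exact/esym/E.
Qed.

(** Gluing along the zero set of a continuous function. *)
Lemma paste (R : realType) (X Y : topologicalType) (h : X -> R) (f g : X -> Y) :
  continuous h -> continuous f -> continuous g ->
  (forall x, h x = 0 -> f x = g x) ->
  continuous (fun x => if h x <= 0 then f x else g x).
Proof.
move=> ch cf cg E; apply/continuous_closedP => C cC.
have -> : (fun x => if h x <= 0 then f x else g x) @^-1` C =
    (f @^-1` C `&` h @^-1` [set r | r <= 0]) `|`
    (g @^-1` C `&` h @^-1` [set r | 0 <= r]).
  apply/seteqP; split=> x /=.
    by case: lerP => hx; [left|right; split=> //; exact: ltW].
  move=> [[Cf h0]|[Cg h0]]; first by rewrite h0.
  by case: lerP => // h0'; rewrite E//; apply/le_anti; rewrite h0 h0'.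
apply: closedU; apply: closedI.
- exact: ((continuous_closedP _).1 cf).
- exact: ((continuous_closedP _).1 ch _ (@closed_le R 0)).
- exact: ((continuous_closedP _).1 cg).
- exact: ((continuous_closedP _).1 ch _ (@closed_ge R 0)).
Qed.

(** Closes a goal of any type when the hypotheses over [R] are contradictory. *)
Ltac absurd_lra R := exfalso; have : (1 : R) <= 0; [lra|by rewrite ler10].

(** * Classes in the first cohomology of the punctured pillowcase *)

(** A loop that is defined and continuous on the whole real line; only its
    values on the unit interval matter. *)
Definition loop {R : realType} (f : R -> pillowcase R) : Prop :=
  [/\ continuous f, f 0 = f 1
    & forall u, 0 <= u <= 1 -> pillow_star (f u)].

Lemma loop_star (R : realType) (f g : R -> pillowcase R) :
  loop g -> (forall u, 0 <= u <= 1 -> f u = g u) -> star_loop f.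
Proof.
move=> [cg g01 sg] E; split; first exact: clamp_within cg E.
  by rewrite !E ?lexx ?ler01.
by move=> u; rewrite in_itv/= => uI; rewrite E//; apply: sg.
Qed.

Lemma cat_continuous (R : realType) (X : topologicalType) (f g : R -> X) :
  continuous f -> continuous g -> f 1 = g 0 -> continuous (Defs.cat_path f g).
Proof.
move=> cf cg E.
have -> : Defs.cat_path f g =
    (fun u => if u - 2^-1 <= 0 then f (2 * u) else g (2 * u - 1)).
  by apply/funext => u; rewrite /Defs.cat_path subr_le0.
apply: paste; try cont.
move=> x x0; have -> : 2 * x = 1 by lra.
by rewrite subrr.
Qed.

Lemma cat0 (R : realType) (X : Type) (f g : R -> X) : Defs.cat_path f g 0 = f 0.
Proof. by rewrite /Defs.cat_path mulr0 invr_ge0 ler0n. Qed.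

Lemma cat1 (R : realType) (X : Type) (f g : R -> X) : Defs.cat_path f g 1 = g 1.
Proof.
rewrite /Defs.cat_path; case: lerP => [h|_]; first by absurd_lra R.
by congr g; ring.
Qed.

Lemma cat_all (R : realType) (X : Type) (P : X -> Prop) (f g : R -> X) :
  (forall u, 0 <= u <= 1 -> P (f u)) -> (forall u, 0 <= u <= 1 -> P (g u)) ->
  forall u, 0 <= u <= 1 -> P (Defs.cat_path f g u).
Proof.
move=> Pf Pg u u01; rewrite /Defs.cat_path; case: lerP => h; [apply: Pf|apply: Pg];
  by apply/andP; split; lra.
Qed.

Lemma cat_loop (R : realType) (f g : R -> pillowcase R) :
  continuous f -> continuous g -> f 1 = g 0 -> g 1 = f 0 ->
  (forall u, 0 <= u <= 1 -> pillow_star (f u)) ->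
  (forall u, 0 <= u <= 1 -> pillow_star (g u)) ->
  loop (Defs.cat_path f g).
Proof.
move=> cf cg E1 E0 sf sg; split; first exact: cat_continuous.
  by rewrite cat0 cat1 E0.
exact: cat_all.
Qed.

Section Cohomology.
Variables (R : realType) (z : (R -> pillowcase R) -> 'Z_4).
Hypothesis hz : is_H1_class z.

Lemma H1_eq (f g : R -> pillowcase R) :
  loop g -> (forall u, 0 <= u <= 1 -> f u = g u) -> z f = z g.
Proof.
move=> lg E; have lg' := loop_star _ _ _ lg (fun _ _ => erefl).
apply: hz.1 => //; first exact: loop_star lg E.
have [cg g01 sg] := lg.
exists (fun w => g w.1); split.
  by apply: continuous_subspaceT; cont.
move=> u v; rewrite !in_itv/= => uI vI.
by rewrite !E// g01; split=> //; exact: sg.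
Qed.

Lemma H1_homotopy (H : R * R -> pillowcase R) : continuous H ->
  (forall u v, 0 <= u <= 1 -> 0 <= v <= 1 -> pillow_star (H (u, v))) ->
  (forall v, 0 <= v <= 1 -> H (0, v) = H (1, v)) ->
  z (fun u => H (u, 0)) = z (fun u => H (u, 1)).
Proof.
move=> cH sH EH.
have lp v : 0 <= v <= 1 -> loop (fun u => H (u, v)).
  by move=> vI; split; [cont|exact: EH|move=> u uI; exact: sH].
have I0 : 0 <= (0 : R) <= 1 by rewrite lexx ler01.
have I1 : 0 <= (1 : R) <= 1 by rewrite lexx ler01.
apply: hz.1; first exact: loop_star (lp 0 I0) (fun _ _ => erefl).
  exact: loop_star (lp 1 I1) (fun _ _ => erefl).
exists H; split; first exact: continuous_subspaceT.
by move=> u v; rewrite !in_itv/= => uI vI; split=> //; [exact: EH|exact: sH].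
Qed.

Lemma H1_cat (f g : R -> pillowcase R) : loop f -> loop g -> f 0 = g 0 ->
  z (Defs.cat_path f g) = z f + z g.
Proof.
move=> lf lg E; apply: hz.2 => //.
  exact: loop_star lf (fun _ _ => erefl).
exact: loop_star lg (fun _ _ => erefl).
Qed.

Lemma H1_cst (c : pillowcase R) : pillow_star c -> z (fun=> c) = 0.
Proof.
move=> sc; have lc : loop (fun=> c) by split=> //; cont.
have := H1_cat _ _ lc lc erefl.
have -> : Defs.cat_path (fun _ : R => c) (fun=> c) = (fun=> c).
  by apply/funext => u; rewrite /Defs.cat_path; case: ifP.
by move/eqP; rewrite -[X in X == _]addr0 (inj_eq (addrI _)) => /eqP/esym.
Qed.

(** Running a loop forth and back is null-homotopic. *)
Lemma H1_rev (f : R -> pillowcase R) : loop f -> z (fun u => f (1 - u)) = - z f.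
Proof.
move=> lf; have [cf f01 sf] := lf.
have lr : loop (fun u => f (1 - u)).
  split; [cont|by rewrite subr0 subrr f01|].
  by move=> u uI; apply: sf; apply/andP; split; lra.
apply/eqP; rewrite -addr_eq0 addrC -H1_cat ?subr0//; apply/eqP.
have sI (u v : R) : 0 <= u <= 1 -> 0 <= v <= 1 ->
    0 <= (1 - v) * (1 - `|2 * u - 1|) <= 1.
  by move=> uI vI; case: (ger0P (2 * u - 1)) => h; apply/andP; split; nra.
(* at time [v], run along [f] up to [1 - v] and back *)
pose H (w : R * R) := f ((1 - w.2) * (1 - `|2 * w.1 - 1|)).
rewrite (_ : z _ = z (fun u => H (u, 0))).
  rewrite H1_homotopy.
  - rewrite /H/= -[RHS](H1_cst (f 0)); last by apply: sf; rewrite lexx ler01.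
    by congr z; apply/funext => u; rewrite subrr mul0r.
  - by rewrite /H; cont.
  - by move=> u v uI vI; apply: sf; exact: sI.
  - move=> v vI; rewrite /H/= mulr0 mulr1 add0r normrN1 subrr mulr0.
    by rewrite -addrA subrr addr0 normr1 subrr mulr0.
apply: H1_eq.
  split; first by rewrite /H; cont.
    rewrite /H/= mulr0 mulr1 add0r normrN1 subrr mulr0.
    by rewrite -addrA subrr addr0 normr1 subrr mulr0.
  by move=> u uI; apply: sf; apply: sI => //; rewrite lexx ler01.
move=> u uI; rewrite /H/= subr0 mul1r /Defs.cat_path; case: lerP => h; congr f.
  by rewrite ler0_norm; lra.
by rewrite ger0_norm; lra.
Qed.

(** A loop made of four paths may be started at the end of the third one. *)
Lemma H1_rotate (f g k h : R -> pillowcase R) :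
  continuous f -> continuous g -> continuous k -> continuous h ->
  (forall u, 0 <= u <= 1 -> pillow_star (f u)) ->
  (forall u, 0 <= u <= 1 -> pillow_star (g u)) ->
  (forall u, 0 <= u <= 1 -> pillow_star (k u)) ->
  (forall u, 0 <= u <= 1 -> pillow_star (h u)) ->
  f 1 = g 0 -> g 1 = k 0 -> k 1 = h 0 -> h 1 = f 0 ->
  z (Defs.cat_path (Defs.cat_path f g) (Defs.cat_path k h)) =
  z (Defs.cat_path (Defs.cat_path h f) (Defs.cat_path g k)).
Proof.
move=> cf cg ck ch sf sg sk sh Efg Egk Ekh Ehf.
set F := Defs.cat_path (Defs.cat_path f g) (Defs.cat_path k h).
have cF : continuous F.
  by do !apply: cat_continuous => //; rewrite ?cat0 ?cat1.
have sF : forall u, 0 <= u <= 1 -> pillow_star (F u).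
  by apply: (cat_all _ _ pillow_star); apply: (cat_all _ _ pillow_star).
have F01 : F 0 = F 1 by rewrite /F !cat0 !cat1.
pose P x := if x - 1 <= 0 then F x else F (x - 1).
have cP : continuous P.
  apply: paste; try cont.
  by move=> x x0; rewrite x0 F01; congr F; lra.
pose H (w : R * R) := P (w.1 + 3 / 4 * w.2).
have sP x : 0 <= x <= 2 -> pillow_star (P x).
  move=> xI; rewrite /P; case: lerP => h1; apply: sF; apply/andP; split; lra.
have cH : continuous H by rewrite /H; cont.
have sH u v : 0 <= u <= 1 -> 0 <= v <= 1 -> pillow_star (H (u, v)).
  by move=> uI vI; apply: sP => /=; apply/andP; split; lra.
have EH v : 0 <= v <= 1 -> H (0, v) = H (1, v).
  move=> vI; rewrite /H/= /P add0r; case: lerP => h1; last by absurd_lra R.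
  case: lerP => h2; last by congr F; lra.
  have -> : v = 0 by lra.
  by rewrite mulr0 addr0.
have I0 : 0 <= (0 : R) <= 1 by rewrite lexx ler01.
have I1 : 0 <= (1 : R) <= 1 by rewrite lexx ler01.
transitivity (z (fun u => H (u, 0))).
  apply: H1_eq; first by split; [cont|exact: EH|move=> u uI; exact: sH].
  move=> u uI; rewrite /H/= mulr0 addr0 /P.
  by case: lerP => //; move=> ?; absurd_lra R.
rewrite H1_homotopy//; apply/esym/H1_eq.
  by split; [cont|exact: EH|move=> u uI; exact: sH].
move=> u uI; rewrite /H/= mulr1 /P /F /Defs.cat_path.
do ![case: lerP => ?].
all: first [by congr f; lra|by congr g; lra|by congr k; lra|by congr h;
  lra|by absurd_lra R|idtac].
(* the only remaining case is [u = 0], the end point of [k] *)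
rewrite (_ : 2 * (2 * u) = 0); last by lra.
by rewrite (_ : 2 * (2 * (u + 3 / 4) - 1) = 1) ?Ekh//; lra.
Qed.

End Cohomology.

(** * Loops that run along one curve and return along another *)

Lemma lin_convex (R : realType) (c d a b u : R) :
  c < a < d -> c < b < d -> 0 <= u <= 1 -> c < lin a b u < d.
Proof.
rewrite /lin => /andP[ca ad] /andP[cb bd] /andP[u0 u1].
by have [ab|ab] := lerP a b; apply/andP; split; nra.
Qed.

Section CatHomotopy.
Variables (R : realType) (z : (R -> pillowcase R) -> 'Z_4).
Hypothesis hz : is_H1_class z.

Lemma H1_cat_homotopy (A B : R * R -> pillowcase R) :
  continuous A -> continuous B ->
  (forall u v, 0 <= u <= 1 -> 0 <= v <= 1 -> pillow_star (A (u, v))) ->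
  (forall u v, 0 <= u <= 1 -> 0 <= v <= 1 -> pillow_star (B (u, v))) ->
  (forall v, 0 <= v <= 1 -> A (1, v) = B (0, v)) ->
  (forall v, 0 <= v <= 1 -> B (1, v) = A (0, v)) ->
  z (Defs.cat_path (fun u => A (u, 0)) (fun u => B (u, 0))) =
  z (Defs.cat_path (fun u => A (u, 1)) (fun u => B (u, 1))).
Proof.
move=> cA cB sA sB EAB EBA.
pose H (w : R * R) := if w.1 - 2^-1 <= 0 then A (2 * w.1, clamp w.2)
                      else B (2 * w.1 - 1, clamp w.2).
have cc := @clamp_cont R.
have cH : continuous H.
  apply: paste; try cont.
  move=> w w0; rewrite (_ : 2 * w.1 = 1) ?subrr ?EAB ?clamp01//; lra.
have E (v : R) : 0 <= v <= 1 -> (fun u => H (u, v)) =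
    Defs.cat_path (fun u => A (u, v)) (fun u => B (u, v)).
  move=> vI; apply/funext => u.
  by rewrite /H/= clamp_id// subr_le0.
rewrite -!E ?lexx ?ler01//; apply: H1_homotopy => //.
  move=> u v uI vI; rewrite /H/= clamp_id// subr_le0.
  by case: lerP => h; [apply: sA|apply: sB] => //; apply/andP; split; lra.
move=> v vI; rewrite /H/= clamp_id// !subr_le0; case: lerP; last first.
  by move=> h; absurd_lra R.
move=> _; case: lerP => h; first by absurd_lra R.
by rewrite mulr0 mulr1 -EBA//; congr (B (_, _)); lra.
Qed.

Lemma H1_swap (f g : R -> pillowcase R) :
  continuous f -> continuous g -> f 1 = g 0 -> g 1 = f 0 ->
  (forall u, 0 <= u <= 1 -> pillow_star (f u)) ->
  (forall u, 0 <= u <= 1 -> pillow_star (g u)) ->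
  z (Defs.cat_path f g) = z (Defs.cat_path g f).
Proof.
move=> cf cg Efg Egf sf sg.
have E (h : R -> pillowcase R) :
    h = Defs.cat_path (fun u => h (u / 2)) (fun u => h ((1 + u) / 2)).
  apply/funext => u; rewrite /Defs.cat_path.
  by case: ifP => _; congr h; field.
have I (u : R) : 0 <= u <= 1 -> 0 <= u / 2 <= 1.
  by move=> uI; apply/andP; split; lra.
have J (u : R) : 0 <= u <= 1 -> 0 <= (1 + u) / 2 <= 1.
  by move=> uI; apply/andP; split; lra.
rewrite {1}[f]E {1}[g]E [in RHS](E f) [in RHS](E g).
do 2 (rewrite (H1_rotate _ z hz); try cont;
  try (by move=> u uI; first [exact: sf (I _ uI)|exact: sg (I _ uI)
                             |exact: sf (J _ uI)|exact: sg (J _ uI)]);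
  try by rewrite ?mul0r ?addr0 ?divff// -?Efg -?Egf//; congr (_ _); field).
Qed.

End CatHomotopy.

Section TwoCurves.
Variables (R : realType) (z : (R -> pillowcase R) -> 'Z_4).
Hypothesis hz : is_H1_class z.
Variables (L0 L1 : R -> R * R).
Hypothesis cL0 : continuous L0.
Hypothesis cL1 : continuous L1.
Hypothesis sL0 : forall s, ~ lattice (L0 s).
Hypothesis sL1 : forall t, 0 < t < pi -> ~ lattice (L1 t).

(** The value of the class on the loop along the first curve from parameter [s0]
    to [s1] and back along the second one from [t1] to [t0]. *)
Definition loop_value (s0 s1 t1 t0 : R) : 'Z_4 :=
  z (Defs.cat_path (fun u => pil (L0 (lin s0 s1 u)))
                   (fun u => pil (L1 (lin t1 t0 u)))).

Lemma loop_value_path (s0 s1 t1 t0 : R) (a0 a1 : R -> R) :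
  {within `[0, 1], continuous a0} -> {within `[0, 1], continuous a1} ->
  a0 0 = s0 -> a0 1 = s1 -> a1 0 = t1 -> a1 1 = t0 ->
  (forall u, 0 <= u <= 1 -> 0 < a1 u < pi) ->
  pil (L0 s0) = pil (L1 t0) -> pil (L0 s1) = pil (L1 t1) ->
  z (Defs.cat_path (fun u => pil (L0 (a0 u))) (fun u => pil (L1 (a1 u)))) =
  loop_value s0 s1 t1 t0.
Proof.
move=> /within_clamp ca0 /within_clamp ca1 a00 a01 a10 a11 a1I E0 E1.
have I0 : 0 <= (0 : R) <= 1 by rewrite lexx ler01.
have I1 : 0 <= (1 : R) <= 1 by rewrite lexx ler01.
pose A (w : R * R) := pil (L0 (lin ((a0 \o clamp) w.1) (lin s0 s1 w.1) w.2)).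
pose B (w : R * R) := pil (L1 (lin ((a1 \o clamp) w.1) (lin t1 t0 w.1) w.2)).
have cA : continuous A.
  have ca := ca0; rewrite /A /lin; cont.
have cB : continuous B by rewrite /B /lin; cont.
have a1c u : 0 < a1 (clamp u) < pi by apply: a1I; exact: clamp01.
have t1I : 0 < t1 < pi by rewrite -a10 a1I.
have t0I : 0 < t0 < pi by rewrite -a11 a1I.
have E : z (Defs.cat_path (fun u => A (u, 0)) (fun u => B (u, 0))) =
         loop_value s0 s1 t1 t0.
  rewrite (H1_cat_homotopy _ z hz) //; first by congr z; congr Defs.cat_path;
    apply/funext => u; rewrite /A /B/= lin1.
  - by move=> u v uI vI; apply/pillow_star_pil/sL0.
  - move=> u v uI vI; apply/pillow_star_pil/sL1 => /=; apply: lin_convex => //.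
    exact: lin_convex.
  - by move=> v vI; rewrite /A /B/= !clamp_id// a01 a10 lin0 lin1 /lin !subrr
    !mulr0 !addr0.
  - by move=> v vI; rewrite /A /B/= !clamp_id// a00 a11 lin0 lin1 /lin !subrr
    !mulr0 !addr0.
rewrite -E; apply: (H1_eq _ z hz).
  apply: cat_loop; [cont|cont|..].
  - by rewrite /A /B/= !clamp_id// a01 a10 !lin0.
  - by rewrite /A /B/= !clamp_id// a00 a11 !lin0.
  - by move=> u uI; apply/pillow_star_pil/sL0.
  - by move=> u uI; apply/pillow_star_pil/sL1 => /=; rewrite lin0 a1c.
move=> u uI; rewrite /Defs.cat_path; case: lerP => h; rewrite /A /B/= lin0 clamp_id//;
  by apply/andP; split; lra.
Qed.

Lemma loop_value_cocycle (s0 s1 s2 t0 t1 t2 : R) :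
  0 < t0 < pi -> 0 < t1 < pi -> 0 < t2 < pi ->
  pil (L0 s0) = pil (L1 t0) -> pil (L0 s1) = pil (L1 t1) ->
  pil (L0 s2) = pil (L1 t2) ->
  loop_value s0 s2 t2 t0 = loop_value s0 s1 t1 t0 + loop_value s1 s2 t2 t1.
Proof.
move=> t0I t1I t2I E0 E1 E2.
have c0 : continuous (Defs.cat_path (lin s0 s1) (lin s1 s2)).
  by apply: cat_continuous; rewrite ?lin0 ?lin1//; exact: lin_cont.
have c1 : continuous (Defs.cat_path (lin t2 t1) (lin t1 t0)).
  by apply: cat_continuous; rewrite ?lin0 ?lin1//; exact: lin_cont.
have D X Y (f : X -> Y) (a b : R -> X) :
    (fun u => f (Defs.cat_path a b u)) =
    Defs.cat_path (fun u => f (a u)) (fun u => f (b u)).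
  by apply/funext => u; rewrite /Defs.cat_path; case: ifP.
rewrite -(loop_value_path s0 s2 t2 t0 (Defs.cat_path (lin s0 s1) (lin s1 s2))
  (Defs.cat_path (lin t2 t1) (lin t1 t0))); try assumption; last first.
- apply: (cat_all _ _ (fun t => is_true (0 < t < pi))) => u uI; exact: lin_convex.
- by rewrite cat1 lin1.
- by rewrite cat0 lin0.
- by rewrite cat1 lin1.
- by rewrite cat0 lin0.
- exact: continuous_subspaceT.
- exact: continuous_subspaceT.
rewrite (D _ _ (fun t => pil (L0 t))) (D _ _ (fun t => pil (L1 t))).
have S0 a b u : 0 <= u <= 1 -> pillow_star (pil (L0 (lin a b u))).
  by move=> _; apply/pillow_star_pil/sL0.
have S1 a b u : 0 < a < pi -> 0 < b < pi -> 0 <= u <= 1 ->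
    pillow_star (pil (L1 (lin a b u))).
  by move=> aI bI uI; apply/pillow_star_pil/sL1/lin_convex.
rewrite (H1_rotate _ z hz); try cont; try (by rewrite !lin0 !lin1);
  try (by move=> u; apply: S0); try (by move=> u; apply: S1).
rewrite (H1_cat _ z hz); try (by rewrite !cat0 ?cat1 ?lin0 ?lin1);
  try (apply: cat_loop; try cont; try (by rewrite !lin0 !lin1);
       try (by move=> u; apply: S0); try (by move=> u; apply: S1)).
congr (_ + _); rewrite (H1_swap _ z hz)//; try cont; try (by rewrite !lin0 !lin1);
  try (by move=> u; apply: S0); try (by move=> u; apply: S1).
Qed.

Lemma loop_value_refl (s t : R) : 0 < t < pi -> pil (L0 s) = pil (L1 t) ->
  loop_value s s t t = 0.
Proof.
move=> tI E; have := loop_value_cocycle s s s t t t tI tI tI E E E.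
by move/eqP; rewrite -[X in X == _]addr0 (inj_eq (addrI _)) => /eqP/esym.
Qed.

Hypothesis per : forall s, pil (L0 (s + 2 * pi)) = pil (L0 s).
Hypothesis L0_trivial : z (fun u => pil (L0 (2 * pi * u))) = 0.

Lemma loop_value_period (s t : R) : 0 < t < pi -> pil (L0 s) = pil (L1 t) ->
  loop_value s (s + 2 * pi) t t = 0.
Proof.
move=> tI E; rewrite -L0_trivial.
pose a := Defs.cat_path (lin s (s + 2 * pi)) (fun=> s + 2 * pi).
have ca : continuous a.
  by apply: cat_continuous; rewrite ?lin1//; [exact: lin_cont|cont].
pose H (w : R * R) := pil (L0 (lin (a w.1) (2 * pi * w.1) w.2)).
transitivity (z (fun u => H (u, 0))).
  congr z; apply/funext => u; rewrite /H/= lin0 /a /Defs.cat_path; case: ifP => // _.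
  by rewrite per E /lin subrr mulr0 addr0.
rewrite (H1_homotopy _ z hz); first by rewrite /H/=; congr z; apply/funext => u;
  rewrite lin1.
- rewrite /H /lin; cont.
- by move=> u v _ _; apply/pillow_star_pil/sL0.
move=> v vI; rewrite /H/= /a cat0 cat1 lin0 -per /lin; congr (pil (L0 _)); ring.
Qed.

Lemma loop_value_shift (s t : R) (k : int) : 0 < t < pi ->
  pil (L0 s) = pil (L1 t) -> loop_value s (s + 2 * pi * k%:~R) t t = 0 /\
  pil (L0 (s + 2 * pi * k%:~R)) = pil (L1 t).
Proof.
move=> tI.
have nat_case (n : nat) s' : pil (L0 s') = pil (L1 t) ->
    loop_value s' (s' + 2 * pi * n%:R) t t = 0 /\
    pil (L0 (s' + 2 * pi * n%:R)) = pil (L1 t).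
  move=> E; elim: n => [|n [IH1 IH2]].
    by rewrite mulr0 addr0; split=> //; exact: loop_value_refl.
  have -> : s' + 2 * pi * n.+1%:R = s' + 2 * pi * n%:R + 2 * pi.
    by rewrite -[n.+1%:R]natr1; ring.
  rewrite per; split=> //.
  rewrite (loop_value_cocycle _ (s' + 2 * pi * n%:R) _ _ t)// ?per// IH1 add0r.
  exact: loop_value_period.
case: k => n E; first exact: nat_case.
rewrite NegzE rmorphN mulrN.
have N m s' : pil (L0 (s' - 2 * pi * m%:R)) = pil (L0 s').
  elim: m => [|m IH]; first by rewrite mulr0 subr0.
  by rewrite -IH -[LHS]per; congr (pil (L0 _)); rewrite -[m.+1%:R]natr1; ring.
have E' : pil (L0 (s - 2 * pi * n.+1%:R)) = pil (L1 t) by rewrite N.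
split=> //; have := loop_value_cocycle s (s - 2 * pi * n.+1%:R) s t t t tI tI tI
  E E' E.
rewrite loop_value_refl// => /esym/eqP; rewrite addr_eq0 => /eqP ->.
have [+ _] := nat_case n.+1 _ E'; rewrite subrK => ->; exact: oppr0.
Qed.

Lemma loop_value_mod (s0 s1 t1 t0 : R) (k0 k1 : int) :
  0 < t0 < pi -> 0 < t1 < pi ->
  pil (L0 s0) = pil (L1 t0) -> pil (L0 s1) = pil (L1 t1) ->
  loop_value (s0 + 2 * pi * k0%:~R) (s1 + 2 * pi * k1%:~R) t1 t0 =
  loop_value s0 s1 t1 t0.
Proof.
move=> t0I t1I E0 E1.
have [Z0 E0'] := loop_value_shift s0 t0 k0 t0I E0.
have [Z1 E1'] := loop_value_shift s1 t1 k1 t1I E1.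
have := loop_value_cocycle s0 (s0 + 2 * pi * k0%:~R) (s1 + 2 * pi * k1%:~R) t0 t0 t1.
move=> /(_ t0I t0I t1I E0 E0' E1'); rewrite Z0 add0r => <-.
by rewrite (loop_value_cocycle s0 s1 _ t0 t1 t1)// Z1 addr0.
Qed.

End TwoCurves.

(** * Half turns around a corner *)

(** The point with diagonal coordinates [X] (along the line of slope 1) and [Y]
    (across it) relative to the lattice point [(pi n, pi n)]. *)
Definition diag_pt {R : realType} (n : int) (X Y : R) : R * R :=
  (pi * n%:~R + X - Y, pi * n%:~R + X + Y).

Lemma diag_pt_rot (R : realType) (n : int) (X Y : R) :
  pil (diag_pt n X Y) = pil (diag_pt n (- X) (- Y)).
Proof.
by apply/pil_eqP; exists true, n, n; rewrite /diag_pt /= expr1; split; ring.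
Qed.

Lemma pi_int_small (R : realType) (k : int) :
  - pi < pi * (k%:~R : R) < pi -> k = 0.
Proof.
move=> /andP[h1 h2]; have p0 := @pi_gt0 R.
have {}h1 : (- 1 < k)%R.
  rewrite -(@ltr_int R) rmorphN1 ltNge; apply/negP => h; nra.
have {}h2 : (k < 1)%R.
  by rewrite -(@ltr_int R) -(ltr_pM2l p0) mulr1.
lia.
Qed.

Lemma diag_pt_lattice (R : realType) (n : int) (X Y : R) :
  - pi < X < pi -> - pi < 2 * Y < pi -> lattice (diag_pt n X Y) ->
  X = 0 /\ Y = 0.
Proof.
move=> XI YI [k [l [E1 E2]]].
have Y0 : l - k = 0.
  by apply: (@pi_int_small R); rewrite rmorphB/= mulrBr -E1 -E2; apply/andP;
    split; lra.
have {}Y0 : Y = 0.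
  have : pi * (l - k)%:~R = 0 :> R by rewrite Y0 mulr0.
  by rewrite rmorphB/= mulrBr -E1 -E2; lra.
split=> //; have X0 : k - n = 0.
  by apply: (@pi_int_small R); rewrite rmorphB/= mulrBr -E1 Y0; apply/andP;
    split; lra.
have : pi * (k - n)%:~R = 0 :> R by rewrite X0 mulr0.
by rewrite rmorphB/= mulrBr -E1 Y0; lra.
Qed.

Section Corner.
Variables (R : realType) (z : (R -> pillowcase R) -> 'Z_4).
Hypothesis hz : is_pillow_class z.

(** Loops whose lifts join points exchanged by the half turn around the same
    lattice point are compared by affine homotopies of their lifts. *)
Lemma diag_homotopy (n : int) (X Y X' Y' : R -> R) :
  continuous X -> continuous Y -> continuous X' -> continuous Y' ->
  (forall u, 0 <= u <= 1 ->
     [/\ - pi < X u < pi, - pi < 2 * Y u < pi, - pi < X' u < pi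
       & - pi < 2 * Y' u < pi]) ->
  (forall u v, 0 <= u <= 1 -> 0 <= v <= 1 -> lin (X u) (X' u) v = 0 ->
     lin (Y u) (Y' u) v = 0 -> False) ->
  X 1 = - X 0 -> Y 1 = - Y 0 -> X' 1 = - X' 0 -> Y' 1 = - Y' 0 ->
  z (fun u => pil (diag_pt n (X u) (Y u))) =
  z (fun u => pil (diag_pt n (X' u) (Y' u))).
Proof.
move=> cX cY cX' cY' B N EX EY EX' EY'.
pose H (w : R * R) :=
  pil (diag_pt n (lin (X w.1) (X' w.1) w.2) (lin (Y w.1) (Y' w.1) w.2)).
transitivity (z (fun u => H (u, 0))).
  by congr z; apply/funext => u; rewrite /H/= !lin0.
rewrite (H1_homotopy _ z hz.1); first by congr z; apply/funext => u;
  rewrite /H/= !lin1.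
- rewrite /H /diag_pt /lin; cont.
- move=> u v uI vI; apply/pillow_star_pil => /= L.
  have [BX BY BX' BY'] := B _ uI.
  have [||] := diag_pt_lattice _ _ _ _ _ _ L; [exact: lin_convex| |exact: N].
  rewrite (_ : 2 * _ = lin (2 * Y u) (2 * Y' u) v); first exact: lin_convex.
  by rewrite /lin/=; ring.
move=> v vI; rewrite /H/= diag_pt_rot EX EY EX' EY'; congr (pil (diag_pt n _ _));
  by rewrite /lin; ring.
Qed.

(** Up to a rotation, this is the generating loop around the corner. *)
Lemma half_turn (n : int) (r : R) : 0 < r < pi / 2 ->
  z (fun u => pil (diag_pt n (- (r * cos (pi / 4)) * cos (pi * u))
                             (- (r * cos (pi / 4)) * sin (pi * u)))) = 1.
Proof.
move=> rI; rewrite -(hz.2 n n r rI).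
pose H (w : R * R) := let a := pi * w.1 + lin (pi + pi / 4) 0 w.2 in
  pil (pi * n%:~R + r * cos a, pi * n%:~R + r * sin a).
have E4 : sin (pi / 4) = cos (pi / 4) :> R.
  by rewrite -cosBpihalf -cosN; congr cos; field.
transitivity (z (fun u => H (u, 0))).
  congr z; apply/funext => u; rewrite /H/= lin0.
  rewrite (_ : pi * u + (pi + pi / 4) = pi * u + pi / 4 + pi); last by ring.
  rewrite sinDpi cosDpi sinD cosD E4 /diag_pt.
  by congr (pil (_, _)); ring.
rewrite (H1_homotopy _ z hz.1).
- by congr z; apply/funext => u; rewrite /H/= /corner_loop lin1 addr0.
- rewrite /H/= /lin; cont.
- move=> u v uI vI; apply/pillow_star_pil => -[k [l [E1 E2]]].
  pose a := pi * u + lin (pi + pi / 4) 0 v.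
  have C (x : R) (j : int) : -1 <= x <= 1 -> pi * n%:~R + r * x = pi * j%:~R -> x = 0.
    move=> xI E; have j0 : j - n = 0.
      apply: (@pi_int_small R); rewrite rmorphB/= mulrBr -E.
      by have p0 := @pi_gt0 R; apply/andP; split; nra.
    have /eqP : r * x = 0.
      have : pi * (j - n)%:~R = 0 :> R by rewrite j0 mulr0.
      by rewrite rmorphB/= mulrBr -E; lra.
    by rewrite mulf_eq0 => /orP[]/eqP// r0; move: rI; rewrite r0 ltxx.
  have := cos2Dsin2 a.
  rewrite (C (cos a) _ _ E1) ?cos_geN1 ?cos_le1// (C (sin a) _ _ E2) ?sin_geN1
    ?sin_le1//.
  by rewrite expr0n/= addr0 => /eqP; rewrite eq_sym oner_eq0.
move=> v vI; rewrite /H/=; set b := lin _ _ _.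
rewrite mulr0 add0r mulr1 [pi + b]addrC sinDpi cosDpi.
by apply/pil_eqP; exists true, n, n; rewrite expr1/=; split; ring.
Qed.

(** A loop of the pillowcase that lifts to a path passing below the lattice point
    [(pi n, pi n)], between points that are exchanged by the half turn around it,
    circles the corner once counterclockwise. *)
Lemma corner_ccw (n : int) (X Y : R -> R) :
  continuous X -> continuous Y ->
  (forall u, 0 <= u <= 1 -> [/\ - pi < X u < pi, - pi < 2 * Y u < pi
     & X u = 0 -> Y u < 0]) ->
  X 0 < 0 -> X 1 = - X 0 -> Y 1 = - Y 0 ->
  z (fun u => pil (diag_pt n (X u) (Y u))) = 1.
Proof.
move=> cX cY B X0 EX EY.
have p2 := @pi_ge2 R.
have k0 : 0 < cos (pi / 4) :> R by apply: cos_gt0_pihalf; apply/andP; split; lra.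
have k1 := @cos_le1 R (pi / 4).
have rI : 0 < (1 / 2 : R) < pi / 2 by apply/andP; split; lra.
rewrite -(half_turn n (1 / 2) rI).
set k := 1 / 2 * _; have kI : 0 < k <= 1 / 2 by apply/andP; split; rewrite /k; lra.
have trig (u : R) : 0 <= u <= 1 ->
    [/\ -1 <= cos (pi * u) <= 1, 0 <= sin (pi * u) <= 1
      & sin (pi * u) = 0 -> u = 0 \/ u = 1].
  move=> uI; rewrite cos_geN1 cos_le1 sin_le1; split=> //.
    by rewrite andbT; apply: sin_ge0_pi; apply/andP; split; nra.
  move=> s0; apply: contrapT => /not_orP[/eqP u0 /eqP u1].
  have : 0 < sin (pi * u); last by rewrite s0 ltxx.
  have uI' : 0 < u < 1 by rewrite !lt_neqAle eq_sym u0 u1 /=; move: uI.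
  by apply: sin_gt0_pi; apply/andP; split; nra.
(* first deform the height into that of a half circle, then the other
   coordinate *)
rewrite (diag_homotopy n X Y X (fun u => - k * sin (pi * u))) //.
- apply: diag_homotopy => //; try cont.
  + move=> u uI; have [BX _ _] := B u uI; have [c1 s1 _] := trig u uI.
    by split=> //; apply/andP; split; nra.
  + move=> u v uI vI EX0 EY0; have [c1 s1 s0] := trig u uI.
    have {}EY0 : k * sin (pi * u) = 0 by move: EY0; rewrite /lin; lra.
    have : u = 0 \/ u = 1.
      apply: s0; apply/eqP; move/eqP: EY0; rewrite mulf_eq0 => /orP[|//].
      by move=> /eqP k00; move: kI; rewrite k00 ltxx.
    move=> [] u0; move: EX0; rewrite u0 /lin ?EX ?mulr0 ?mulr1 ?cos0 ?cospi; nra.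
  + by rewrite mulr0 mulr1 sinpi sin0 !mulr0 oppr0.
  + by rewrite mulr0 mulr1 cospi cos0; ring.
  + by rewrite mulr0 mulr1 sinpi sin0 !mulr0 oppr0.
- cont.
- move=> u uI; have [BX BY _] := B u uI; have [c1 s1 _] := trig u uI.
  by split=> //; apply/andP; split; nra.
- move=> u v uI vI; rewrite {1}/lin subrr mulr0 addr0 => EX0 EY0.
  have [_ _ /(_ EX0) Y0] := B u uI; have [c1 s1 s0] := trig u uI.
  have u01 : u != 0 /\ u != 1.
    by split; apply/eqP => u0; move: EX0; rewrite u0 ?EX; lra.
  have ks : 0 < k * sin (pi * u).
    apply: mulr_gt0; first by case/andP: kI.
    rewrite lt_neqAle eq_sym; apply/andP; split; last by case/andP: s1.
    by apply/eqP => /s0; case: u01 => /eqP ? /eqP ? [].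
  move: EY0; rewrite /lin mulNr; move: (k * _) ks => s ks EY0.
  case/andP: vI => v0 v1; have [v2|v2] := lerP v (1 / 2).
    have : 0 <= (1 / 2 - v) * - Y u by apply: mulr_ge0; lra.
    have : 0 <= v * s by apply: mulr_ge0; lra.
    by lra.
  have : 0 <= (v - 1 / 2) * s by apply: mulr_ge0; lra.
  have : 0 <= (1 - v) * - Y u by apply: mulr_ge0; lra.
  by lra.
- by rewrite mulr0 mulr1 sinpi sin0 !mulr0 oppr0.
Qed.

End Corner.

(** * The figure eight curve *)

Lemma L0_diag (R : realType) (eps s : R) (n : int) :
  L0_curve eps s = diag_pt n (s + pi / 2 - pi * n%:~R) (- (eps * sin s)).
Proof. by rewrite /diag_pt /=; congr (_, _); ring. Qed.

Lemma L0_not_lattice (R : realType) (eps s : R) : 0 < eps < 1 ->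
  ~ lattice (L0_curve eps s).
Proof.
move=> /andP[e0 e1].
have [n /andP[n0 n1]] := mod_pi _ (s + pi / 2).
have p2 := @pi_ge2 R; have s1 := @sin_le1 R s; have s2 := @sin_geN1 R s.
rewrite (L0_diag _ _ _ n) => /diag_pt_lattice[||X0 /eqP].
- by apply/andP; split; lra.
- by apply/andP; split; nra.
rewrite oppr_eq0 mulf_eq0 gt_eqF//= => /eqP/sin_eq0P[k sk].
have N : pi * (2 * (n - k) - 1)%:~R = 0 :> R.
  by rewrite rmorphB rmorphM rmorphB/= !mulrBr mulr1 -/(2%:~R); move: X0;
    rewrite sk; lra.
move/eqP: N; rewrite mulf_eq0 gt_eqF ?pi_gt0//= intr_eq0; lia.
Qed.

Lemma L0_continuous (R : realType) (eps : R) : continuous (L0_curve eps : R -> R * R).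
Proof. rewrite /=; cont. Qed.

Lemma L0_period (R : realType) (eps s : R) :
  pil (L0_curve eps (s + 2 * pi)) = pil (L0_curve eps s).
Proof.
apply/pil_eqP; exists false, (-1), (-1); rewrite expr0 /=.
rewrite (_ : s + 2 * pi = s + pi + pi) ?sinDpi; last by ring.
by split; ring.
Qed.

(** The figure eight is a product of the counterclockwise loop around the corner
    [(pi, pi)] and of the clockwise loop around [(0, 0)]. *)
Lemma L0_loop_trivial (R : realType) (z : (R -> pillowcase R) -> 'Z_4) (eps : R) :
  is_pillow_class z -> 0 < eps < 1 ->
  z (fun u => pil (L0_curve eps (2 * pi * u))) = 0.
Proof.
move=> hz eI; have p2 := @pi_ge2 R.
pose f u := pil (L0_curve eps (pi * u)).
pose g u := pil (L0_curve eps (pi + pi * u)).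
have cL := @L0_continuous R eps.
have cf : continuous f by rewrite /f; cont.
have cg : continuous g by rewrite /g; cont.
have sL s : pillow_star (pil (L0_curve eps s)) by
  apply/pillow_star_pil/L0_not_lattice.
have E0 : f 1 = g 0 by rewrite /f /g mulr0 mulr1 addr0.
have E1 : g 1 = f 0.
  by rewrite /f /g mulr0 mulr1 -[RHS]L0_period; congr (pil (L0_curve _ _)); ring.
have Em : f 0 = f 1.
  apply/pil_eqP; exists true, 1, 1; rewrite expr1 mulr0 mulr1 /= sin0 sinpi.
  by split; field.
have lf : loop f by split=> // u _; exact: sL.
have lg : loop g by split=> [//||u _]; [rewrite E1 -E0|exact: sL].
have -> : (fun u => pil (L0_curve eps (2 * pi * u))) = Defs.cat_path f g.
  apply/funext => u; rewrite /Defs.cat_path /f /g.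
  by case: ifP => _; congr (pil (L0_curve _ _)); ring.
rewrite (H1_cat _ z hz.1)//; last by rewrite Em.
pose X (u : R) := pi * u - pi / 2.
pose Y (u : R) := - (eps * sin (pi * u)).
have W n : z (fun u => pil (diag_pt n (X u) (Y u))) = 1.
  apply: corner_ccw => //; rewrite /X /Y; try cont.
  - move=> u uI; have s1 := @sin_le1 R (pi * u); have s2 := @sin_geN1 R (pi * u).
    split; [by apply/andP; split; nra|by apply/andP; split; nra|].
    move=> u2; have -> : pi * u = pi / 2 by lra.
    by rewrite sin_pihalf mulr1; lra.
  - by rewrite mulr0; lra.
  - by rewrite mulr0 mulr1; field.
  - by rewrite mulr0 mulr1 sin0 sinpi mulr0 !oppr0.
have -> : z f = 1.
  rewrite -(W 1); congr z; apply/funext => u; rewrite /f (L0_diag _ _ _ 1).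
  by congr (pil (diag_pt 1 _ _)); rewrite /X; field.
have -> : z g = - 1; last exact: subrr.
apply/eqP; rewrite -eqr_oppLR -(H1_rev _ z hz.1)//; apply/eqP.
rewrite -(W 2); congr z; apply/funext => u; rewrite /g (L0_diag _ _ _ 2) diag_pt_rot.
congr (pil (diag_pt 2 _ _)); rewrite /X /Y; first by field.
rewrite opprK (_ : pi + pi * (1 - u) = - (pi * u) + pi + pi); last by ring.
by rewrite !sinDpi opprK sinN mulrN.
Qed.

(** * Maslov indices *)

Lemma pi_multiple_constant (R : realType) (a b : R) (h : R -> R) : a <= b ->
  {within `[a, b], continuous h} ->
  (forall x, a <= x <= b -> sin (h x) = 0) -> h a = h b.
Proof.
move=> ab ch H.
have /sin_eq0P[k Ek] : sin (h a) = 0 by apply: H; rewrite lexx ab.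
have /sin_eq0P[l El] : sin (h b) = 0 by apply: H; rewrite lexx ab.
have p0 := @pi_gt0 R.
have half (j : int) : sin (pi * j%:~R + pi / 2) <> 0 :> R.
  rewrite addrC sin_pi_int sin_pihalf mulr1.
  by case: (isign_cases R j) => -> /eqP; rewrite ?oppr_eq0 oner_eq0.
have le_int (i j : int) : i < j -> pi * i%:~R + pi <= pi * j%:~R :> R.
  move=> ij; have -> : pi * i%:~R + pi = pi * (i + 1)%:~R :> R.
    by rewrite rmorphD/=; ring.
  by rewrite ler_pM2l// ler_int; lia.
case: (ltgtP k l) => [kl|lk|kl]; last by rewrite Ek El kl.
- have := le_int _ _ kl => kl'.
  have [|c] := @IVT R h a b (pi * k%:~R + pi / 2) ab ch.
    rewrite Ek El min_l ?max_r; [by apply/andP; split; lra|lra|lra].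
  by rewrite in_itv/= => /H + E; rewrite E => /half.
- have := le_int _ _ lk => lk'.
  have [|c] := @IVT R h a b (pi * l%:~R + pi / 2) ab ch.
    rewrite Ek El min_r ?max_l; [by apply/andP; split; lra|lra|lra].
  by rewrite in_itv/= => /H + E; rewrite E => /half.
Qed.

(** The half turn in which the angle [th] of a line lies, counted from the
    direction [pi / 4]. *)
Definition level {R : realType} (th : R) : int := Num.ceil ((th - pi / 4) / pi).

Lemma levelP (R : realType) (th : R) (k : int) :
  pi * (k - 1)%:~R < th - pi / 4 <= pi * k%:~R -> level th = k.
Proof.
have p0 := @pi_gt0 R; move=> /andP[h1 h2]; apply: ceil_def.
by rewrite ltr_pdivlMr// ler_pdivrMr// ![_ * pi]mulrC h1.
Qed.

Lemma level_shift (R : realType) (th : R) (k : int) :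
  level (th + pi * k%:~R) = level th + k.
Proof.
have p0 := @pi_gt0 R; have /andP[] := ceil_itv ((th - pi / 4) / pi).
rewrite ltr_pdivlMr// ler_pdivrMr// => h1 h2; apply: levelP.
rewrite -/(level th) in h1 h2 *; move: h1 h2; rewrite !rmorphB !rmorphD/=.
by move: (level th)%:~R => x h1 h2; apply/andP; split; lra.
Qed.

Lemma line_degreeP (R : realType) (th0 th1 : R) (m : int) :
  line_degree th0 th1 m <-> m = level th1 - level th0.
Proof.
have p0 := @pi_gt0 R.
have E (th : R) : \forall d \near (0 : R)^'+,
    Num.floor ((th - (pi / 4 + d)) / pi) = level th - 1.
  have /andP[] := ceil_itv ((th - pi / 4) / pi); rewrite -/(level th).
  rewrite ltr_pdivlMr// ler_pdivrMr// -subr_gt0 => h1 h2.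
  near=> d; have d0 : 0 < d by near: d; exact: nbhs_right_gt.
  have d1 : d < th - pi / 4 - (level th - 1)%:~R * pi.
    by near: d; exact: nbhs_right_lt.
  apply: floor_def; rewrite ler_pdivlMr// ltr_pdivrMr// subrK.
  by apply/andP; split; lra.
split=> [H|->].
  near (0 : R)^'+ => d.
  have -> : m = Num.floor ((th1 - (pi / 4 + d)) / pi)
              - Num.floor ((th0 - (pi / 4 + d)) / pi) by near: d.
  have -> : Num.floor ((th1 - (pi / 4 + d)) / pi) = level th1 - 1.
    by near: d; exact: E.
  have -> : Num.floor ((th0 - (pi / 4 + d)) / pi) = level th0 - 1.
    by near: d; exact: E.
  by lia.
near=> d.
have -> : Num.floor ((th1 - (pi / 4 + d)) / pi) = level th1 - 1.
  by near: d; exact: E.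
have -> : Num.floor ((th0 - (pi / 4 + d)) / pi) = level th0 - 1.
  by near: d; exact: E.
by lia.
Unshelve. all: by end_near.
Qed.

Lemma line_angle_diff (R : realType) (v : R * R) (th th' : R) :
  line_angle v th -> line_angle v th' -> sin (th' - th) = 0.
Proof.
move=> [r r0 ->] [r' r'0 [E1 E2]]; apply/eqP.
have := mulf_neq0 r0 r'0; rewrite sinB => rr.
rewrite -(inj_eq (mulfI rr)) mulr0; apply/eqP.
have -> : r * r' * (sin th' * cos th - cos th' * sin th) =
  (r' * sin th') * (r * cos th) - (r' * cos th') * (r * sin th) by ring.
by rewrite -E1 -E2; ring.
Qed.

Lemma line_angle_shift (R : realType) (v : R * R) (th : R) (k : int) :
  line_angle v th -> line_angle v (th + pi * k%:~R).
Proof.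
move=> [r r0 ->]; exists (isign k * r).
  by case: (isign_cases R k) => ->; rewrite ?mul1r// mulN1r oppr_eq0.
by rewrite cos_pi_int sin_pi_int; congr (_, _); rewrite mulrACA isign_sqr mul1r.
Qed.

Lemma cos_pi4_gt0 (R : realType) : 0 < cos (pi / 4) :> R.
Proof.
by have p0 := @pi_gt0 R; apply: cos_gt0_pihalf; apply/andP; split; lra.
Qed.

Lemma sin_pi4 (R : realType) : sin (pi / 4) = cos (pi / 4) :> R.
Proof. by rewrite -cosBpihalf -cosN; congr cos; field. Qed.

Lemma cos_atan_gt0 (R : realType) (x : R) : 0 < cos (atan x).
Proof. by apply: cos_gt0_pihalf; rewrite atan_gtNpi2 atan_ltpi2. Qed.

Lemma sin_atan (R : realType) (x : R) : sin (atan x) = x * cos (atan x).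
Proof. by rewrite -{2}[x]atanK /tan divfK// gt_eqF// cos_atan_gt0. Qed.

Lemma line_angle_rot (R : realType) (r x : R) : r != 0 ->
  line_angle (r * (1 - x), r * (1 + x)) (pi / 4 + atan x).
Proof.
move=> r0; have k0 := @cos_pi4_gt0 R; have c0 := @cos_atan_gt0 R x.
exists (r / (cos (pi / 4) * cos (atan x))).
  by rewrite mulf_neq0// invr_eq0 mulf_neq0// gt_eqF.
rewrite cosD sinD sin_pi4 sin_atan; congr (_, _); field;
  by rewrite !gt_eqF.
Qed.

Lemma line_angle_exists (R : realType) (v : R * R) : v != 0 ->
  exists th, line_angle v th.
Proof.
case: v => a b ab; have [e|e] := eqVneq (a + b) 0.
  exists (pi / 4 + pi / 2); exists (b / cos (pi / 4)).
    apply: mulf_neq0; last by rewrite invr_eq0 gt_eqF// cos_pi4_gt0.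
    apply/eqP => b0; move: ab; rewrite (_ : a = 0) ?b0 ?eqxx//.
    by move: e; rewrite b0 addr0.
  rewrite cosDpihalf sinDpihalf sin_pi4; congr (_, _); last first.
    by rewrite divfK// gt_eqF// cos_pi4_gt0.
  by rewrite mulrN divfK ?gt_eqF ?cos_pi4_gt0//; lra.
exists (pi / 4 + atan ((b - a) / (a + b))).
have := @line_angle_rot R ((a + b) / 2) ((b - a) / (a + b)).
rewrite (_ : _ / 2 * (1 - _) = a); last by field.
rewrite (_ : _ / 2 * (1 + _) = b); last by field.
by apply; rewrite mulf_neq0// invr_eq0.
Qed.

Lemma L0_velocity (R : realType) (eps s : R) :
  velocity (L0_curve eps) s = (1 + eps * cos s, 1 - eps * cos s).
Proof.
have D1 : is_derive s 1 (fst \o L0_curve eps) (1 + eps * cos s).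
  rewrite /comp/=; apply: is_derive_eq.
  by rewrite addr0.
have D2 : is_derive s 1 (snd \o L0_curve eps) (1 - eps * cos s).
  rewrite /comp/=; apply: is_derive_eq.
  by rewrite addr0.
by rewrite /velocity !derive1E; congr (_, _); exact: derive_val.
Qed.

Lemma L1_velocity (R : realType) (p : nat) (q : int) (t : R) :
  velocity (L1_curve R p q) t = (q%:~R, (q - p%:Z)%:~R).
Proof.
have D (c : R) : is_derive t 1 (fun t => c * t) c.
  by apply: is_derive_eq; rewrite -[RHS]mulr1.
by rewrite /velocity !derive1E; congr (_, _);
  exact: (@derive_val _ _ _ _ _ _ _ (D _)).
Qed.

(** An angle of the tangent line of the figure eight. *)
Definition L0_angle {R : realType} (eps s : R) : R :=
  pi / 4 + atan (- (eps * cos s)).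

Lemma L0_line_angle (R : realType) (eps s : R) :
  line_angle (velocity (L0_curve eps) s) (L0_angle eps s).
Proof.
rewrite L0_velocity; have := @line_angle_rot R 1 (- (eps * cos s)) (oner_neq0 _).
by rewrite opprK !mul1r.
Qed.

Lemma L0_level (R : realType) (eps s : R) : 0 < eps ->
  level (L0_angle eps s) = (cos s < 0)%R.
Proof.
move=> e0; have p0 := @pi_gt0 R; apply: levelP.
rewrite /L0_angle addrAC subrr add0r.
have a1 := @atan_ltpi2 R (- (eps * cos s)).
have a2 := @atan_gtNpi2 R (- (eps * cos s)).
have [h|h] := ltrP (cos s) 0.
  rewrite subrr mulr0 mulr1; apply/andP; split; last by lra.
  by rewrite -[ltLHS]atan0; apply: lt_atan; nra.
rewrite sub0r mulr0 rmorphN1 mulrN1; apply/andP; split; first by lra.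
by rewrite -[leRHS]atan0; apply: le_atan; nra.
Qed.

(** The Maslov index does not depend on the lift of the path of tangent lines. *)
Lemma maslov_constant (R : realType) (L : curve R) (alpha th th' : R -> R) :
  {within `[0, 1], continuous th} -> {within `[0, 1], continuous th'} ->
  (forall u, u \in `[0, 1] -> line_angle (velocity L (alpha u)) (th u)) ->
  (forall u, u \in `[0, 1] -> line_angle (velocity L (alpha u)) (th' u)) ->
  level (th 1) - level (th 0) = level (th' 1) - level (th' 0).
Proof.
move=> ct ct' A A'.
have H u : 0 <= u <= 1 -> sin (th' u - th u) = 0.
  move=> uI; apply: line_angle_diff; first by apply: A; rewrite in_itv.
  by apply: A'; rewrite in_itv.
have E : th' 0 - th 0 = th' 1 - th 1.
  apply: (@pi_multiple_constant R 0 1 (fun u => th' u - th u)) => //.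
  by move=> u; apply: cvgB; [exact: ct'|exact: ct].
have /sin_eq0P[k Ek] : sin (th' 0 - th 0) = 0 by apply: H; rewrite lexx ler01.
have -> : th' 0 = th 0 + pi * k%:~R by lra.
have -> : th' 1 = th 1 + pi * k%:~R by lra.
rewrite !level_shift; lia.
Qed.

Lemma maslov_L0 (R : realType) (eps : R) (alpha : R -> R) (m : int) : 0 < eps ->
  {within `[0, 1], continuous alpha} ->
  maslov (L0_curve eps) alpha m <->
  m = (cos (alpha 1) < 0)%R%:Z - (cos (alpha 0) < 0)%R%:Z.
Proof.
move=> e0 ca.
have ct : {within `[0, 1], continuous (fun u => L0_angle eps (alpha u))}.
  have cc := within_clamp _ _ _ ca.
  apply: (@clamp_within _ _ _ (fun u => L0_angle eps ((alpha \o clamp) u))).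
    have cat : continuous (@atan R) by move=> x; exact: continuous_atan.
    by rewrite /L0_angle; cont.
  by move=> u uI; rewrite /= clamp_id.
have A u : u \in `[0, 1] ->
    line_angle (velocity (L0_curve eps) (alpha u)) (L0_angle eps (alpha u)).
  by move=> _; exact: L0_line_angle.
rewrite -!(L0_level _ eps)//; split.
  move=> [th [cth Ath /line_degreeP ->]]; exact: maslov_constant cth ct Ath A.
by move=> ->; exists (fun u => L0_angle eps (alpha u)); split=> //;
  apply/line_degreeP.
Qed.

Lemma L1_velocity_neq0 (R : realType) (p : nat) (q : int) : (0 < p)%N ->
  (q%:~R, (q - p%:Z)%:~R) != 0 :> R * R.
Proof.
move=> p0; apply/eqP => -[/eqP E1 /eqP E2]; move: E1 E2; rewrite !intr_eq0; lia.
Qed.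

Lemma maslov_L1 (R : realType) (p : nat) (q : int) (alpha : R -> R) (m : int) :
  (0 < p)%N -> maslov (L1_curve R p q) alpha m <-> m = 0.
Proof.
move=> p0; have [t0 A0] := line_angle_exists _ _ (L1_velocity_neq0 R p q p0).
have ct : {within `[0, 1], continuous (fun _ : R => t0)}.
  by apply: continuous_subspaceT; cont.
have A u : u \in `[0, 1] -> line_angle (velocity (L1_curve R p q) (alpha u)) t0.
  by move=> _; rewrite L1_velocity.
split=> [[th [cth Ath /line_degreeP ->]]|->].
  by rewrite (maslov_constant _ _ _ _ _ cth ct Ath A) subrr.
by exists (fun=> t0); split=> //; apply/line_degreeP; rewrite subrr.
Qed.

(** The line of slope [(q - p) / q] is farther from the diagonal direction than
    any tangent line of the figure eight. *)
Lemma L1_angle_far (R : realType) (p : nat) (q : int) (eps x th w : R) :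
  0 < eps -> eps * `|(2 * q - p%:Z)%:~R| < p%:R -> `|x| <= eps ->
  line_angle (q%:~R, (q - p%:Z)%:~R) th -> sin (th - pi / 4 - w) = 0 ->
  (0 <= w <= atan x) || (atan x <= w <= 0) -> False.
Proof.
move=> e0 em xe [r r0 [E1 E2]] /sin_eq0P[k Ek] wI.
have cx := cos_atan_gt0 _ x; have sx := sin_atan _ x.
have x1 := @atan_gtNpi2 R x; have x2 := @atan_ltpi2 R x.
have p0 := @pi_gt0 R.
have cw : 0 < cos w.
  by apply: cos_gt0_pihalf; case/orP: wI => /andP[h1 h2]; apply/andP; split; lra.
have sw : `|sin w| <= eps * cos w.
  case/orP: wI => /andP[h1 h2].
    have : 0 <= sin (atan x - w) by apply: sin_ge0_pi; apply/andP; split; lra.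
    rewrite sinB sx => h3; rewrite ger0_norm; last first.
      by apply: sin_ge0_pi; apply/andP; split; lra.
    have : sin w <= x * cos w by rewrite -(ler_pM2r cx); lra.
    by move/le_trans; apply; rewrite ler_pM2r//; move: xe; rewrite ler_norml;
      case/andP.
  have : 0 <= sin (w - atan x) by apply: sin_ge0_pi; apply/andP; split; lra.
  rewrite sinB sx => h3; rewrite ler0_norm; last first.
    by rewrite -oppr_ge0 -sinN; apply: sin_ge0_pi; apply/andP; split; lra.
  have h4 : x * cos w <= sin w by rewrite -(ler_pM2r cx); lra.
  have : - x <= eps by move: xe; rewrite ler_norml; case/andP; lra.
  by rewrite -(ler_pM2r cw); lra.
have tE : th = w + pi / 4 + pi * k%:~R by lra.
have k4 := @cos_pi4_gt0 R; have s4 := sin_pi4 R.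
have [i i0 E] : exists2 i : R, i != 0 & p%:R = i * sin w /\ (2 * q - p%:Z)%:~R =
  - i * cos w.
  exists (- 2 * (r * isign k) * cos (pi / 4)).
    have ik : isign k != 0 :> R.
      by case: (isign_cases R k) => ->; rewrite ?oppr_eq0 oner_eq0.
    by rewrite !mulf_neq0// ?oppr_eq0 ?pnatr_eq0 ?gt_eqF.
  have Ep : p%:R = q%:~R - (q - p%:Z)%:~R :> R by rewrite rmorphB/=; ring.
  have Em : (2 * q - p%:Z)%:~R = q%:~R + (q - p%:Z)%:~R :> R.
    by rewrite !rmorphB rmorphM/=; ring.
  rewrite Em Ep E1 E2 tE cos_pi_int sin_pi_int cosD sinD s4.
  by split; ring.
case: E => Ep Em; move: em; rewrite Em normrM normrN (gtr0_norm cw) => em.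
have : p%:R = `|i| * `|sin w| by rewrite -normrM -Ep ger0_norm.
have i1 : 0 < `|i| by rewrite normr_gt0.
nra.
Qed.

Lemma tau_L0_L1 (R : realType) (p : nat) (q : int) (eps : R) (x : R * R) (t : int) :
  0 < eps -> eps * `|(2 * q - p%:Z)%:~R| < p%:R -> (0 < p)%N ->
  tau (L0_curve eps) (L1_curve R p q) x t <-> t = (cos x.1 < 0)%R.
Proof.
move=> e0 em p0; have pi0 := @pi_gt0 R.
have A0 := L0_line_angle _ eps x.1; have lev0 := L0_level _ eps x.1 e0.
set a := - (eps * cos x.1).
have ae : `|a| <= eps.
  by rewrite /a normrN normrM (gtr0_norm e0) ler_piMr ?cos_max// ltW.
have lev1 th1 (j : int) : line_angle (velocity (L1_curve R p q) x.2) th1 ->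
    atan a - pi < th1 - pi / 4 - pi * j%:~R <= atan a -> level th1 = j.
  rewrite L1_velocity => A1 /andP[h1 h2].
  have far w := L1_angle_far R p q eps a th1 w e0 em ae A1.
  apply: levelP; rewrite rmorphB/= mulrBr mulr1; apply/andP; split.
    rewrite ltNge; apply/negP => h.
    apply: (far (th1 - pi / 4 - pi * (j - 1)%:~R)).
      by apply/sin_eq0P; exists (j - 1); ring.
    by rewrite rmorphB/= mulrBr mulr1; apply/orP; right; apply/andP; split; lra.
  rewrite leNgt; apply/negP => h.
  apply: (far (th1 - pi / 4 - pi * j%:~R)).
    by apply/sin_eq0P; exists j; ring.
  by apply/orP; left; apply/andP; split; lra.
split=> [[th0 [th1 [B0 B1 /andP[h1 h2] /line_degreeP E]]]|->].
  have /sin_eq0P[j Ej] := line_angle_diff _ _ _ _ A0 B0.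
  have th0E : th0 = L0_angle eps x.1 + pi * j%:~R by lra.
  have l1 : level th1 = j.
    apply: lev1 => //; move: h1 h2; rewrite th0E /L0_angle -/a => h1 h2.
    by apply/andP; split; lra.
  move: E; rewrite l1 th0E level_shift lev0; lia.
have [th A1] := line_angle_exists _ _ (L1_velocity_neq0 R p q p0).
have [k /andP[k0 k1]] := mod_pi _ (L0_angle eps x.1 - th).
exists (L0_angle eps x.1), (th + pi * k%:~R); split=> //.
- by rewrite L1_velocity; exact: line_angle_shift.
- by apply/andP; split; lra.
apply/line_degreeP; rewrite lev0 (lev1 _ 0) ?sub0r//.
  by rewrite L1_velocity; exact: line_angle_shift.
by move: k0 k1; rewrite mulr0 subr0 /L0_angle -/a => k0 k1; apply/andP; split; lra.
Qed.

(** The Maslov indices and the corrections at the corners cancel, so that the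
    relative grading is the value of the cohomology class. *)
Lemma rel_gradingP (R : realType) (p : nat) (q : int) (eps : R)
    (z : (R -> pillowcase R) -> 'Z_4) (x y : R * R) (g : 'Z_4) :
  0 < eps -> eps * `|(2 * q - p%:Z)%:~R| < p%:R -> (0 < p)%N ->
  let L0 := L0_curve eps in let L1 := L1_curve R p q in
  rel_grading L0 L1 z x y g <->
  exists a0 a1, [/\ param_path L0 x.1 y.1 a0, param_path L1 y.2 x.2 a1
    & g = z (grading_loop L0 L1 a0 a1)].
Proof.
move=> e0 em p0 L0 L1.
have cosP s t : same_param L0 s t -> cos t = cos s.
  move=> [k ->]; apply/cos_eqP; exists false, (- k).
  by rewrite expr0 mul1r rmorphN /L0/=; ring.
split.
  move=> [a0 [a1 [m0 [m1 [tx [ty [[P0 P1] [M0 M1] [Tx Ty] ->]]]]]]].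
  exists a0, a1; split=> //.
  have [ca0 sx sy _] := P0; have [ca1 _ _ _] := P1.
  move/(maslov_L0 _ _ _ _ e0 ca0): M0 => ->.
  move/(maslov_L1 _ _ _ _ _ p0): M1 => ->.
  move/(tau_L0_L1 _ _ _ _ _ _ e0 em p0): Tx => ->.
  move/(tau_L0_L1 _ _ _ _ _ _ e0 em p0): Ty => ->.
  rewrite (cosP _ _ sx) (cosP _ _ sy).
  rewrite (_ : (_ + _ + _ - _)%R = 0 :> int) ?add0r//; ring.
move=> [a0 [a1 [P0 P1 ->]]].
have [ca0 sx sy _] := P0; have [ca1 _ _ _] := P1.
exists a0, a1, ((cos y.1 < 0)%R%:Z - (cos x.1 < 0)%R%:Z), 0,
  (cos x.1 < 0)%R%:Z, (cos y.1 < 0)%R%:Z; split=> //.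
- split; last exact/maslov_L1.
  by apply/maslov_L0 => //; rewrite (cosP _ _ sx) (cosP _ _ sy).
- by split; apply/tau_L0_L1.
by rewrite (_ : (_ + _ + _ - _)%R = 0 :> int) ?add0r//; ring.
Qed.

(** * Intersection points *)

Lemma MVT_lipschitz (R : realType) (f df : R -> R) (a b : R) :
  (forall x : R, is_derive x 1 f (df x)) -> (forall x, `|df x| <= 1) ->
  `|f a - f b| <= `|a - b|.
Proof.
move=> D B; wlog ab : a b / a <= b => [W|].
  have [/W//|/W h] := orP (le_total a b).
  by rewrite distrC [leRHS]distrC.
have cf : {within `[a, b], continuous f}.
  apply: continuous_subspaceT => x; apply: differentiable_continuous.
  by apply/derivable1_diffP; exact: ex_derive.
have [c _ E] := @MVT_segment R f df a b ab (fun x _ => D x) cf.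
by rewrite distrC E normrM distrC ler_piMl.
Qed.

Lemma cos_lipschitz (R : realType) (a b : R) : `|cos a - cos b| <= `|a - b|.
Proof.
by apply: (@MVT_lipschitz R cos (fun x => - sin x)) => x; rewrite normrN sin_max.
Qed.

Lemma sin_lipschitz (R : realType) (a b : R) : `|sin a - sin b| <= `|a - b|.
Proof.
by apply: (@MVT_lipschitz R sin cos) => x; exact: cos_max.
Qed.

(** The representative of [x] modulo [2 pi] in [[0, 2 pi)]. *)
Definition wrap2pi {R : realType} (x : R) : R :=
  x - 2 * pi * (Num.floor (x / (2 * pi)))%:~R.

Lemma wrap2pi_itv (R : realType) (x : R) : 0 <= wrap2pi x < 2 * pi.
Proof.
have p2 : 0 < 2 * pi :> R by rewrite mulr_gt0// pi_gt0.
have /andP[A B] := real_floor_itv (num_real (x / (2 * pi))).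
move: A B; rewrite ler_pdivlMr// ltr_pdivrMr// rmorphD/= /wrap2pi => A B.
by apply/andP; split; lra.
Qed.

Lemma wrap2piE (R : realType) (x : R) : exists k : int, wrap2pi x = x + 2 * pi *
  k%:~R.
Proof.
by exists (- Num.floor (x / (2 * pi))); rewrite rmorphN /wrap2pi mulrN.
Qed.

Lemma wrap2pi_uniq (R : realType) (x y : R) (k : int) :
  0 <= y < 2 * pi -> y = x + 2 * pi * k%:~R -> y = wrap2pi x.
Proof.
move=> yI E; have [j Ej] := wrap2piE _ x; have wI := wrap2pi_itv _ x.
have p2 := @pi_gt0 R.
have k0 : k - j = 0.
  apply: (@pi_int_small R); rewrite rmorphB/=; apply/andP; split; lra.
by rewrite E Ej (_ : k = j)//; lia.
Qed.

Section Solution.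
Variables (R : realType) (p : nat) (q : int).
Hypothesis p0 : (0 < p)%N.
Let m : R := (2 * q - p%:Z)%:~R.
Let P : R := p%:R.

Let P0 : 0 < P. Proof. by rewrite ltr0n. Qed.

(** The parameter, close to [2 pi l / p], at which the arc meets the lift of the
    figure eight to the plane; [d] is the perturbation up to sign. *)
Definition crossing_time (l : int) (d : R) : R :=
  xget 0 [set t | P * t / 2 = pi * l%:~R + d * cos (m * t / 2)].

Lemma crossing_time_eq (l : int) (d : R) :
  P * crossing_time l d / 2 = pi * l%:~R + d * cos (m * crossing_time l d / 2).
Proof.
suff [t tE] : exists t, P * t / 2 = pi * l%:~R + d * cos (m * t / 2).
  by rewrite /crossing_time; case: xgetP => [t' -> //|/(_ t)] []; exact: tE.
pose f (t : R) := P * t / 2 - d * cos (m * t / 2).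
have cf : continuous f by rewrite /f; cont.
pose a := 2 * (pi * l%:~R - `|d|) / P; pose b := 2 * (pi * l%:~R + `|d|) / P.
have Pa : P * a / 2 = pi * l%:~R - `|d| by rewrite /a; field; rewrite gt_eqF.
have Pb : P * b / 2 = pi * l%:~R + `|d| by rewrite /b; field; rewrite gt_eqF.
have dx x : - `|d| <= d * cos x <= `|d|.
  by rewrite -ler_norml normrM ler_piMr// cos_max.
have d0 : 0 <= `|d| by [].
have ab : a <= b by rewrite -(ler_pM2l P0); lra.
have fa : f a <= pi * l%:~R by rewrite /f Pa; have := dx (m * a / 2); lra.
have fb : pi * l%:~R <= f b by rewrite /f Pb; have := dx (m * b / 2); lra.
have [|t _ tE] := @IVT R f a b (pi * l%:~R) ab (continuous_subspaceT cf).
  by rewrite min_l ?max_r ?fa ?fb//; lra.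
by exists t; rewrite -tE /f; lra.
Qed.

Lemma crossing_time_near (l : int) (d : R) : `|P * crossing_time l d / 2 - pi *
  l%:~R| <= `|d|.
Proof.
by rewrite crossing_time_eq addrAC subrr add0r normrM ler_piMr// cos_max.
Qed.

Lemma crossing_time_lipschitz (k : int) (d d' t t' : R) : `|d| * `|m| * 2 <= P ->
  P * t / 2 = pi * k%:~R + d * cos (m * t / 2) ->
  P * t' / 2 = pi * k%:~R + d' * cos (m * t' / 2) ->
  P * `|t - t'| <= 4 * `|d - d'|.
Proof.
move=> dm E E'.
have : P * `|t - t'| / 2 <= `|d - d'| + `|d| * `|m| * `|t - t'| / 2.
  have -> : P * `|t - t'| / 2 = `|P * t / 2 - P * t' / 2|.
    rewrite (_ : P * t / 2 - P * t' / 2 = (P / 2) * (t - t')); last by field.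
    by rewrite normrM ger0_norm; [field|rewrite divr_ge0// ltW].
  rewrite E E' (_ : _ - _ = (d - d') * cos (m * t' / 2) +
     d * (cos (m * t / 2) - cos (m * t' / 2))); last by ring.
  apply: (le_trans (ler_normD _ _)); rewrite !normrM lerD// ?ler_piMr ?cos_max//.
  rewrite -!mulrA ler_wpM2l//; apply: (le_trans (cos_lipschitz _ _ _)).
  rewrite -mulrBr -mulrBl.
  by rewrite !normrM [ `|2^-1| ]ger0_norm// invr_ge0.
have : `|d| * `|m| * 2 * `|t - t'| <= P * `|t - t'| by apply: ler_wpM2r.
have : 0 <= `|t - t'| by [].
lra.
Qed.

Lemma crossing_time_uniq (l : int) (d t : R) : `|d| * `|m| * 2 <= P ->
  P * t / 2 = pi * l%:~R + d * cos (m * t / 2) -> t = crossing_time l d.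
Proof.
move=> dm E; have := crossing_time_lipschitz l d d t (crossing_time l d) dm E
  (crossing_time_eq l d).
rewrite subrr normr0 mulr0 pmulr_rle0// normr_le0 subr_eq0; exact: eqP.
Qed.

Lemma crossing_time_continuous (l : int) (d : R) : `|d| * `|m| * 2 <= P ->
  {for d, continuous (crossing_time l)}.
Proof.
move=> dm; apply/cvgrPdist_lt => e e0; near=> d'.
have h1 := crossing_time_lipschitz l d d' _ _ dm (crossing_time_eq l d)
  (crossing_time_eq l d').
have h2 : `|d - d'| < P * e / 4.
  near: d'; apply: cvgr_dist_lt => //; by rewrite !mulr_gt0.
by rewrite -(ltr_pM2l P0); lra.
Unshelve. all: by end_near.
Qed.

Lemma crossing_time0 (l : int) : crossing_time l 0 = 2 * pi * l%:~R / P.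
Proof.
apply/esym/crossing_time_uniq; first by rewrite normr0 !mul0r ltW.
by field; rewrite gt_eqF.
Qed.

End Solution.

(** In diagonal coordinates the arc is the line [(m t / 2, - p t / 2)] with
    [m = 2 q - p]. *)
Section Crossings.
Variables (R : realType) (p : nat) (q : int).
Hypothesis podd : odd p.
Hypothesis pq : coprimez p%:Z q.
Let m : R := (2 * q - p%:Z)%:~R.
Let P : R := p%:R.
Let L1 := L1_curve R p q.

Lemma p_gt0 : (0 < p)%N. Proof. by case: p podd. Qed.
Let P0 : 0 < P. Proof. by rewrite ltr0n p_gt0. Qed.

Let cqp : (q - p%:Z)%:~R = q%:~R - P :> R.
Proof. by rewrite rmorphB. Qed.
Let cm : m = 2 * q%:~R - P.
Proof. by rewrite /m rmorphB rmorphM. Qed.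

Lemma L1_coords (t : R) : L1 t = (m * t / 2 + P * t / 2, m * t / 2 - P * t / 2).
Proof. by rewrite /L1 /= cqp cm; congr (_, _); field. Qed.

(** Since [2 q - p] is prime to [p]. *)
Lemma p_dvd (k l : int) : (2 * q - p%:Z) * l = p%:Z * k -> (p%:Z %| l)%Z.
Proof.
move=> E; have : (p%:Z %| q * (2 * l))%Z.
  by apply/dvdzP; exists (k + l); rewrite -[RHS]mulrC mulrDr -E; ring.
rewrite Gauss_dvdzr// Gauss_dvdzr//.
by rewrite coprimezE -[absz _]/p -[absz _]/2%N coprimen2.
Qed.

Lemma L1_star (t : R) : 0 < t < pi -> ~ lattice (L1 t).
Proof.
move=> tI [k [l [E1 E2]]].
have {}E1 : q%:~R * t = pi * k%:~R by [].
have {}E2 : (q%:~R - P) * t = pi * l%:~R by rewrite -cqp.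
have Et : P * t = pi * (k - l)%:~R by rewrite rmorphB/= mulrBr -E1 -E2; ring.
have Em : m * t = pi * (k + l)%:~R by rewrite rmorphD/= mulrDr -E1 -E2 cm; ring.
have pi0 := @pi_gt0 R.
have /p_dvd/dvdzP[j Ej] : (2 * q - p%:Z) * (k - l) = p%:Z * (k + l).
  apply/eqP; rewrite -(eqr_int R) !rmorphM/= -/m -/P; apply/eqP.
  by apply: (mulfI (lt0r_neq0 pi0)); rewrite mulrCA -Et [RHS]mulrCA -Em; ring.
have tj : t = pi * j%:~R.
  apply: (mulfI (lt0r_neq0 P0)); rewrite Et Ej rmorphM/= -[(p%:Z)%:~R]/P; ring.
have j0 : j = 0.
  by apply: (@pi_int_small R); rewrite -tj; apply/andP; split; lra.
by move: tI; rewrite tj j0 mulr0 ltxx.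
Qed.

Lemma L1_inj (t t' : R) : 0 <= t <= pi -> 0 <= t' <= pi ->
  pil (L1 t) = pil (L1 t') -> t = t'.
Proof.
move=> tI tI' /pil_eqP[e [k [l [E1 E2]]]].
have pi0 := @pi_gt0 R.
pose x := t' - (-1) ^+ e * t.
have {}E1 : q%:~R * t' = (-1) ^+ e * (q%:~R * t) + 2 * pi * k%:~R by [].
have {}E2 : (q%:~R - P) * t' = (-1) ^+ e * ((q%:~R - P) * t) + 2 * pi * l%:~R.
  by rewrite -cqp.
have Et : P * x = pi * (2 * (k - l))%:~R by rewrite /x rmorphM rmorphB/=; lra.
have Em : m * x = pi * (2 * (k + l))%:~R by rewrite /x cm rmorphM rmorphD/=; lra.
have /p_dvd/dvdzP[j Ej] : (2 * q - p%:Z) * (2 * (k - l)) = p%:Z * (2 * (k + l)).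
  apply/eqP; rewrite -(eqr_int R) rmorphM/= [X in _ == X]rmorphM/= -/m -/P; apply/eqP.
  by apply: (mulfI (lt0r_neq0 pi0)); rewrite mulrCA -Et [RHS]mulrCA -Em; ring.
have [i Ei] : exists i, j = 2 * i.
  by exists (j %/ 2)%Z; move: (dvdz_mulr (k - l) (dvdzz 2)); rewrite Ej; lia.
have xi : x = 2 * (pi * i%:~R).
  apply: (mulfI (lt0r_neq0 P0)); rewrite Et Ej Ei !rmorphM/= -[(p%:Z)%:~R]/P; ring.
move: xi; rewrite /x; case: e {E1 E2 Et Em x} => xi; rewrite ?expr1 ?expr0 in xi.
  have [i0|i1] : i = 0 \/ i = 1.
    have h1 : (-1 < i)%R.
      by rewrite -(@ltr_int R) -(ltr_pM2l pi0) rmorphN1; lra.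
    have h2 : (i < 2)%R.
      by rewrite -(@ltr_int R) -(ltr_pM2l pi0) -[2%:~R]/(2%:R); lra.
    lia.
    by move: xi; rewrite i0 mulr0 mulr0; lra.
  by move: xi; rewrite i1 mulr1; lra.
have i0 : i = 0.
  apply: (@pi_int_small R); apply/andP; split; lra.
by move: xi; rewrite i0 mulr0 mulr0; lra.
Qed.

(** The point where the arc meets the figure eight near its [l]-th crossing with
    the diagonal, on the branch determined by the sign of [d]; [|d|] is the
    perturbation. *)
Definition crossing_pt (l : nat) (d : R) : R * R :=
  (wrap2pi (- (isign l%:Z * Num.sg d) * (m * crossing_time R p q l%:Z d / 2 - pi
    * l%:R) - pi / 2),
   crossing_time R p q l%:Z d).

Lemma crossing_pil (eps : R) (e : bool) (l j : int) (s t d : R) :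
  d = - ((-1) ^+ e * isign l * eps) -> P * t / 2 = pi * l%:~R + d * cos (m * t / 2) ->
  s = (-1) ^+ e * (m * t / 2 - pi * l%:~R) - pi / 2 + 2 * pi * j%:~R ->
  pil (L0_curve eps s) = pil (L1 t).
Proof.
move=> dE tE sE.
have ss : sin s = - (isign l * cos (m * t / 2)).
  rewrite -[s](addrK (pi / 2)) sinBpihalf; congr (- _).
  rewrite sE (_ : _ - pi / 2 + _ + _ = (-1) ^+ e * (m * t / 2 - pi * l%:~R) + pi
    * (0 + 2 * j)%:~R); last first.
    by rewrite add0r rmorphM/= -/(2%:~R); ring.
  rewrite cos_pi_int isign_double /isign expr0 mul1r.
  rewrite (_ : cos ((-1) ^+ e * _) = cos (m * t / 2 + pi * (- l)%:~R)).
    by rewrite cos_pi_int isignN.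
  by case: e {dE sE}; rewrite ?expr1 ?expr0 ?mul1r ?mulN1r ?cosN rmorphN mulrN.
have s2 : (-1) ^+ e * (-1) ^+ e = 1 :> R by rewrite -expr2 sqrr_sign.
apply/pil_eqP; exists e, (l - (if e then -1 else 1) * j), (- ((if e then -1 else
  1) * j)).
rewrite L1_coords /= ss tE dE sE rmorphB !rmorphN !rmorphM/=.
by case: e {s2 dE sE}; rewrite ?expr1 ?expr0 ?rmorphN1 ?rmorph1; split; ring.
Qed.

End Crossings.

Lemma half_p (p l : nat) : odd p -> (l <= p.-1./2)%N = (l.*2.+1 <= p)%N.
Proof. lia. Qed.

Section CrossingList.
Variables (R : realType) (p : nat) (q : int).
Hypothesis podd : odd p.
Hypothesis pq : coprimez p%:Z q.
Let m : R := (2 * q - p%:Z)%:~R.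
Let P : R := p%:R.
Let L1 := L1_curve R p q.
Let P0 : 0 < P. Proof. by rewrite ltr0n p_gt0. Qed.

(** The bounds on the perturbation under which the intersection points are the
    expected ones. *)
Definition small (eps : R) : Prop :=
  [/\ 0 < eps, eps < 1 / 2 & eps * `|m| * 2 < P].

Lemma small_norm (eps d : R) : small eps -> d = eps \/ d = - eps ->
  `|d| = eps /\ `|d| * `|m| * 2 <= P.
Proof.
move=> [e0 e1 em] dE; have -> : `|d| = eps.
  by case: dE => ->; rewrite ?normrN gtr0_norm.
by split=> //; exact: ltW.
Qed.

Lemma crossing_pt_sign (l : nat) (eps d : R) : 0 < eps -> d = eps \/ d = - eps ->
  exists2 e : bool, - (isign l%:Z * Num.sg d) = (-1) ^+ e &
    d = - ((-1) ^+ e * isign l%:Z * eps).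
Proof.
move=> e0 dE; case: (isign_cases R l%:Z) => El; case: dE => dE.
- by exists true; rewrite dE El ?gtr0_sg// expr1; ring.
- by exists false; rewrite dE El ?sgrN ?gtr0_sg// expr0; ring.
- by exists false; rewrite dE El ?gtr0_sg// expr0; ring.
- by exists true; rewrite dE El ?sgrN ?gtr0_sg// expr1; ring.
Qed.

Lemma crossing_pt_pil (l : nat) (eps d : R) : 0 < eps -> d = eps \/ d = - eps ->
  pil (L0_curve eps (crossing_pt R p q l d).1) = pil (L1 (crossing_pt R p q l d).2).
Proof.
move=> e0 dE; have [e Ee Ed] := crossing_pt_sign l eps d e0 dE.
rewrite /crossing_pt Ee /=;
  have [j ->] := wrap2piE R ((-1) ^+ e * (m * crossing_time R p q l d / 2 - pi *
    l%:R) - pi / 2).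
apply: (crossing_pil R p q eps e l j _ _ d Ed) => //.
exact: (crossing_time_eq R p q (p_gt0 _ podd)).
Qed.

Lemma crossing_pt_cos_small (eps d : R) : small eps -> d = eps \/ d = - eps ->
  forall t, `|P * t / 2| <= `|d| -> 0 < cos (m * t / 2).
Proof.
move=> sm dE t tI; have [_ em] := small_norm _ _ sm dE.
have p2 := @pi_ge2 R.
have : `|m * t / 2| <= 1 / 2.
  rewrite -(ler_pM2l P0) -{1}(gtr0_norm P0) -normrM.
  rewrite (_ : P * (m * t / 2) = m * (P * t / 2)); last by field.
  rewrite normrM; have := ler_wpM2l (normr_ge0 m) tI.
  by move=> h; apply: (le_trans h); lra.
rewrite ler_norml => /andP[h1 h2].
by apply: cos_gt0_pihalf; apply/andP; split; lra.
Qed.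

Lemma crossing_pt_itv (l : nat) (eps d : R) : small eps ->
  d = eps \/ (d = - eps /\ (0 < l)%N) -> (l <= p.-1./2)%N ->
  0 < crossing_time R p q l d < pi.
Proof.
move=> sm dE lp.
have dE' : d = eps \/ d = - eps by case: dE => [|[]]; [left|right].
have [de em] := small_norm _ _ sm dE'; have [e0 e1 _] := sm.
have near := crossing_time_near R p q (p_gt0 _ podd) l d.
have p2 := @pi_ge2 R.
have lP : l%:R * 2 + 1 <= P.
  by rewrite /P -[2]/(2%:R) -natrM natr1 ler_nat muln2 -half_p//.
have t1 : crossing_time R p q l d < pi.
  rewrite -(ltr_pM2l P0); move: near; rewrite de ler_norml => /andP[_ h].
  have : pi * (l%:R * 2 + 1) <= pi * P by rewrite ler_pM2l ?pi_gt0.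
  by rewrite -[l%:~R]/(l%:R) in h *; rewrite /P; lra.
rewrite t1 andbT -(pmulr_rgt0 _ P0).
case: l lp dE lP near {t1} => [|l] lp dE lP near.
  case: dE => [dE|[]//].
  have := crossing_pt_cos_small eps d sm (or_introl dE) (crossing_time R p q 0%:Z d).
  rewrite -/P in near.
  move: near; rewrite mulr0 subr0 => near /(_ near) c0.
  have := crossing_time_eq R p q (p_gt0 _ podd) 0 d;
    rewrite -/P -/m mulr0 add0r dE => E.
  have : 0 < eps * cos (m * crossing_time R p q 0 eps / 2) by apply: mulr_gt0;
    rewrite // -dE.
  by rewrite -E; lra.
move: near; rewrite de ler_norml => /andP[h _].
have : pi * 1 <= pi * l.+1%:R :> R by rewrite ler_pM2l ?pi_gt0// ler1n.
by rewrite -[l.+1%:~R]/(l.+1%:R) in h *; rewrite /P; lra.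
Qed.

Lemma crossing_pt_crossing (l : nat) (eps d : R) : small eps ->
  d = eps \/ (d = - eps /\ (0 < l)%N) -> (l <= p.-1./2)%N ->
  crossings (L0_curve eps) L1 (crossing_pt R p q l d).
Proof.
move=> sm dE lp; have := crossing_pt_itv l eps d sm dE lp => /andP[t0 t1].
have dE' : d = eps \/ d = - eps by case: dE => [|[]]; [left|right].
have [e0 e1 _] := sm; have pi0 := @pi_gt0 R.
have E := crossing_pt_pil l eps d e0 dE'.
split=> //.
- by rewrite /params /= mulf_eq0 pnatr_eq0 (gt_eqF pi0) /=; exact: wrap2pi_itv.
- by rewrite /params /L1 /= eqxx /= in_itv/= !ltW.
- by rewrite /crv E; apply/pillow_star_pil/L1_star => //; rewrite t0 t1.
Qed.

Lemma crossingsP (eps : R) (y : R * R) : small eps ->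
  crossings (L0_curve eps) L1 y <->
  exists l d, [/\ (l <= p.-1./2)%N, d = eps \/ (d = - eps /\ (0 < l)%N)
    & y = crossing_pt R p q l d].
Proof.
move=> sm; split=> [|[l [d [lp dE ->]]]]; last exact: crossing_pt_crossing.
case: y => s t [/= ps pt E star].
have [e0 e1 em] := sm; have pi0 := @pi_gt0 R; have pi2 := @pi_ge2 R.
have {}ps : 0 <= s < 2 * pi.
  by move: ps; rewrite /params /= mulf_eq0 pnatr_eq0 (gt_eqF pi0).
have {}pt : 0 <= t <= pi.
  by move: pt; rewrite /params /L1 /= eqxx /= in_itv.
have /pil_eqP[e [k [l [E1 E2]]]] := E.
move: E1 E2; rewrite L1_coords -/m -/P /= => E1 E2.
have [N NE] : exists N, N = k - l by exists (k - l).
have [M ME] : exists M, M = k + l by exists (k + l).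
have MN : M = N + 2 * l by rewrite ME NE; ring.
have ET : P * t / 2 = (-1) ^+ e * (eps * sin s) + pi * N%:~R.
  by rewrite NE rmorphB/=; lra.
have EU : m * t / 2 = (-1) ^+ e * (s + pi / 2) + pi * M%:~R.
  by rewrite ME rmorphD/=; lra.
have s2 : (-1) ^+ e * (-1) ^+ e = 1 :> R by rewrite -expr2 sqrr_sign.
have NM : isign M = isign N :> R.
  by rewrite MN isign_double.
have ss : sin s = - (isign N * cos (m * t / 2)).
  rewrite EU cos_pi_int NM mulrA isign_sqr mul1r.
  have -> : cos ((-1) ^+ e * (s + pi / 2)) = cos (s + pi / 2).
    by case: e {E1 E2 ET EU s2}; rewrite ?expr1 ?mulN1r ?cosN// expr0 mul1r.
  by rewrite cosDpihalf opprK.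
pose d := - ((-1) ^+ e * isign N * eps).
have dE : d = eps \/ d = - eps.
  rewrite /d; case: (isign_cases R N) => ->; case: e {E1 E2 ET EU s2 d};
    rewrite ?expr1 ?expr0 ?mulr1 ?mul1r ?mulrNN ?mulr1 ?mul1r ?mulN1r ?opprK;
      by [left|right].
have EP : P * t / 2 = pi * N%:~R + d * cos (m * t / 2).
  by rewrite ET ss /d; ring.
have [de dm] := small_norm _ _ sm dE.
have tE : t = crossing_time R p q N d by apply: crossing_time_uniq => //;
  exact: p_gt0.
have near : `|P * t / 2 - pi * N%:~R| <= eps.
  by rewrite -de tE; exact: crossing_time_near R p q (p_gt0 _ podd) N d.
move: near; rewrite ler_norml => /andP[n1 n2].
have Pt : 0 <= P * t <= P * pi.
  case/andP: pt => t0 t1; apply/andP; split; last by rewrite ler_pM2l.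
  by apply: mulr_ge0 => //; exact: ltW.
have N0 : 0 <= N.
  rewrite leNgt; apply/negP => NN.
  have : pi * N%:~R <= pi * (-1)%:~R :> R by rewrite ler_pM2l// ler_int;
    move: NN; clear; lia.
  by rewrite rmorphN1; lra.
have Np : 2 * N < p%:Z + 1.
  rewrite ltNge; apply/negP => NN.
  have : pi * (p%:Z + 1)%:~R <= pi * (2 * N)%:~R :> R by rewrite ler_pM2l// ler_int.
  rewrite rmorphD rmorphM/= -[(p%:Z)%:~R]/P mulrDr; lra.
clear NE; case: N N0 Np MN NM ss @d dE EP de dm tE n1 n2 ET EU => [n|//] _ Np MN
  NM ss d dE EP de dm tE n1 n2 ET EU.
exists n, d; split.
- by rewrite half_p//; move: Np podd; clear; lia.
- case: dE => [->|dE]; [by left|right; split=> //].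
  case: n Np MN NM ss @d dE EP de dm tE n1 n2 ET EU => [|//] Np MN NM ss d dE EP
    de dm tE n1 n2 ET EU.
  move: EP; rewrite mulr0 add0r => EP.
  have := crossing_pt_cos_small eps d sm (or_intror dE) t.
  rewrite EP normrM ler_piMr ?cos_max// => /(_ isT) c0.
  move: EP; rewrite dE => EP; exfalso.
  by have : 0 < eps * cos (m * t / 2); [exact: mulr_gt0|lra].
rewrite /crossing_pt -tE; congr (_, _).
have [e' Ee' Ed'] := crossing_pt_sign n eps d e0 dE.
have ee : (-1) ^+ e' = (-1) ^+ e :> R.
  have : (-1) ^+ e' * (isign n%:Z * eps) = (-1) ^+ e * (isign n%:Z * eps).
    by move: Ed'; rewrite {1}/d; lra.
  apply: mulIf; apply: mulf_neq0; last by rewrite gt_eqF.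
  by case: (isign_cases R n%:Z) => ->; rewrite ?oppr_eq0 oner_eq0.
rewrite Ee' ee; apply: (@wrap2pi_uniq _ _ _ ((if e then -1 else 1) * - l)) => //.
rewrite EU -[n%:R]/((n%:Z)%:~R) (_ : n%:Z = M - 2 * l); last first.
  by move: NM => _; move: MN; clear; lia.
rewrite rmorphM rmorphB rmorphN rmorphM/=.
clear E1 E2 ET EU ss s2 Ee' ee Ed' dE EP de dm tE d.
by case: e => /=; rewrite ?expr1 ?expr0 ?rmorphN1 ?rmorph1; field.
Qed.

End CrossingList.

Section CrossingTypes.
Variables (R : realType) (p : nat) (q : int).
Hypothesis podd : odd p.
Hypothesis pq : coprimez p%:Z q.
Let m : R := (2 * q - p%:Z)%:~R.
Let P : R := p%:R.
Let L1 := L1_curve R p q.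
Let P0 : 0 < P. Proof. by rewrite ltr0n p_gt0. Qed.

(** The branch of the figure eight that a crossing near the [l]-th diagonal
    point lies on is read off from the sign of this number. *)
Definition branch (l : nat) : R := sin (m * (2 * pi * l%:R / P) / 2).

Lemma branch_neq0 (l : nat) : (1 <= l <= p.-1./2)%N -> branch l != 0.
Proof.
move=> lI; apply/eqP => /sin_eq0P[k Ek]; have pi0 := @pi_gt0 R.
have E : m * l%:R = P * k%:~R.
  apply: (mulfI (lt0r_neq0 pi0)); rewrite mulrCA [RHS]mulrCA -Ek.
  by field; rewrite gt_eqF.
have /(p_dvd _ _ podd pq) : (2 * q - p%:Z) * l%:Z = p%:Z * k.
  by apply/eqP; rewrite -(eqr_int R) rmorphM [X in _ == X]rmorphM/=; apply/eqP.
rewrite /dvdz /= => /dvdn_leq; move: podd lI; lia.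
Qed.

(** The point [x_l^+] for [b = true], and [x_l^-] for [b = false]. *)
Definition x_pt (l : nat) (b : bool) (eps : R) : R * R :=
  crossing_pt R p q l ((if b then -1 else 1) * Num.sg (branch l) * eps).

(** The point [r_+]. *)
Definition r_pt (eps : R) : R * R := crossing_pt R p q 0 eps.

(** The bounds on the perturbation which also separate the two branches. *)
Definition good (eps : R) : Prop :=
  small R p q eps /\
  forall l, (1 <= l <= p.-1./2)%N -> eps * `|m| < P * `|branch l|.

Lemma near_forall_nat (F : set_system R) (Q : nat -> R -> Prop) (n : nat) :
  Filter F -> (forall l, (l <= n)%N -> F (Q l)) ->
  F [set e | forall l, (l <= n)%N -> Q l e].
Proof.
move=> FF; elim: n => [|n IH] H.
  apply: filterS (H 0 (leqnn 0)) => e Q0 l; rewrite leqn0 => /eqP ->; exact: Q0.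
have A := IH (fun l ln => H l (leqW ln)).
apply: filterS (filterI A (H n.+1 (leqnn _))) => e [Qn Qn1] l.
by rewrite leq_eqVlt => /orP[/eqP ->//|]; exact: Qn.
Qed.

Lemma small_near : \forall eps \near 0^'+, small R p q eps.
Proof.
have m0 := normr_ge0 m.
have m1 : 0 < P / (2 * (`|m| + 1)) by apply: divr_gt0 => //; lra.
have h2 : 0 < 1 / 2 :> R by lra.
near=> eps; have e0 : 0 < eps by near: eps; exact: nbhs_right_gt.
have e1 : eps < 1 / 2 by near: eps; exact: nbhs_right_lt.
have : eps < P / (2 * (`|m| + 1)) by near: eps; exact: nbhs_right_lt.
by rewrite ltr_pdivlMr => [e2|]; [split=> //; rewrite -/m -/P; nra|lra].
Unshelve. all: by end_near.
Qed.

Lemma good_near : \forall eps \near 0^'+, good eps.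
Proof.
suff A : \forall eps \near 0^'+, forall l, (l <= p.-1./2)%N ->
    (0 < l)%N -> eps * `|m| < P * `|branch l|.
  near=> eps; split; first by near: eps; exact: small_near.
  move=> l /andP[l0 lp]; move: l lp l0; near: eps; exact: A.
apply: (near_forall_nat (0^'+)
  (fun l eps => (0 < l)%N -> eps * `|m| < P * `|branch l|)) => l lp.
have [l0|l0] := boolP (0 < l)%N; last by near=> e.
have b0 : 0 < `|branch l| by rewrite normr_gt0 branch_neq0// l0.
have m0 := normr_ge0 m.
have m1 : 0 < P * `|branch l| / (`|m| + 1).
  by apply: divr_gt0; [exact: mulr_gt0|lra].
near=> e => _.
have e0 : 0 < e by near: e; exact: nbhs_right_gt.
have : e < P * `|branch l| / (`|m| + 1) by near: e; exact: nbhs_right_lt.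
by rewrite ltr_pdivlMr => [e2|]; [nra|lra].
Unshelve. all: by end_near.
Qed.

Lemma x_pt_d (l : nat) (b : bool) (eps : R) : (1 <= l <= p.-1./2)%N ->
  let d := (if b then -1 else 1) * Num.sg (branch l) * eps in
  d = eps \/ (d = - eps /\ (0 < l)%N).
Proof.
move=> lI; have l0 : (0 < l)%N by case/andP: lI.
have := branch_neq0 l lI; case: (ltgtP (branch l) 0) => [h|h|_]; last by [].
  by rewrite (ltr0_sg h); case: b => _ /=; [left; ring|right; split; [ring|]].
by rewrite (gtr0_sg h); case: b => _ /=; [right; split; [ring|]|left; ring].
Qed.

Lemma x_pt_all (l : nat) (eps d : R) : (1 <= l <= p.-1./2)%N ->
  d = eps \/ d = - eps -> exists b, crossing_pt R p q l d = x_pt l b eps.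
Proof.
move=> lI dE; have := branch_neq0 l lI; rewrite /x_pt.
case: (ltgtP (branch l) 0) => [h|h|_]; last by [].
  rewrite (ltr0_sg h) => _.
  by case: dE => ->; [exists true|exists false]; congr crossing_pt; ring.
rewrite (gtr0_sg h) => _.
by case: dE => ->; [exists false|exists true]; congr crossing_pt; ring.
Qed.

Lemma cos_wrap2pi (x : R) : cos (wrap2pi x) = cos x.
Proof.
have [k ->] := wrap2piE _ x; apply/esym/cos_eqP; exists false, k.
by rewrite expr0 mul1r.
Qed.

Lemma crossing_pt_cos (l : nat) (d : R) : d != 0 ->
  cos (crossing_pt R p q l d).1 = - Num.sg d * sin (m * crossing_time R p q l d / 2).
Proof.
move=> d0; rewrite /crossing_pt /= cos_wrap2pi cosBpihalf -/m.
set x := _ * _ / 2.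
have -> : sin (- (isign l%:Z * Num.sg d) * (x - pi * l%:R)) =
    - (isign l%:Z * Num.sg d) * sin (x - pi * l%:R).
  have [->|->] : isign l%:Z * Num.sg d = 1 \/ isign l%:Z * Num.sg d = -1.
  - have [->|->] : Num.sg d = 1 \/ Num.sg d = -1.
      by case: sgrP d0 => // _ _; [left|right].
    + by rewrite mulr1; exact: isign_cases.
    + by case: (isign_cases R l%:Z) => ->; [right|left]; ring.
  - by rewrite !mulN1r sinN.
  - by rewrite opprK !mul1r.
rewrite (_ : x - pi * l%:R = x + pi * (- l%:Z)%:~R); last by rewrite rmorphN mulrN.
rewrite sin_pi_int isignN; have := isign_sqr R l%:Z.
by move: (isign _) => s s2; rewrite -[in RHS](mul1r (sin x)) -s2; ring.
Qed.

Lemma branch_near (l : nat) (eps d : R) : good eps -> (1 <= l <= p.-1./2)%N ->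
  d = eps \/ d = - eps -> 0 < branch l * sin (m * crossing_time R p q l d / 2).
Proof.
move=> [sm gd] lI dE; have [de _] := small_norm _ _ _ _ _ sm dE.
have := crossing_time_near R p q (p_gt0 _ podd) l d; rewrite de.
set t := crossing_time _ _ _ _ _ => tn.
have : `|sin (m * t / 2) - branch l| < `|branch l|.
  apply: (le_lt_trans (sin_lipschitz _ _ _)).
  rewrite -(ltr_pM2l P0); apply: le_lt_trans (gd l lI).
  rewrite -{1}(gtr0_norm P0) -normrM.
  rewrite (_ : P * _ = m * (p%:R * t / 2 - pi * l%:~R)).
    by rewrite normrM mulrC ler_wpM2r.
  by rewrite -/P; field; rewrite gt_eqF.
case: (ltgtP (branch l) 0) (branch_neq0 l lI) => [h|h|_]; last by [].
  by rewrite (ltr0_norm h) ltr_norml => _ /andP[h1 h2]; rewrite nmulr_rgt0//; lra.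
by rewrite (gtr0_norm h) ltr_norml => _ /andP[h1 h2]; rewrite pmulr_rgt0//; lra.
Qed.

Lemma x_pt_cos (l : nat) (b : bool) (eps : R) : good eps -> (1 <= l <= p.-1./2)%N ->
  0 < (if b then 1 else -1) * cos (x_pt l b eps).1.
Proof.
move=> gd lI; have [[e0 _ _] _] := gd.
have dE := x_pt_d l b eps lI; rewrite /= in dE.
have dE' : (if b then -1 else 1) * Num.sg (branch l) * eps = eps \/
  (if b then -1 else 1) * Num.sg (branch l) * eps = - eps.
  by case: dE => [|[]]; [left|right].
have B := branch_near l eps _ gd lI dE'.
rewrite /x_pt crossing_pt_cos; last by case: dE' => ->; rewrite ?oppr_eq0 gt_eqF.
move: B; move: (sin _) => t; rewrite !sgrM (gtr0_sg e0) mulr1 sgr_id.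
case: (ltgtP (branch l) 0) (branch_neq0 l lI) => [h|h|_]; last by [].
  rewrite (ltr0_sg h) nmulr_rgt0// => _.
  by case: b {dE dE'} => h' /=; rewrite ?sgrN ?sgr1; lra.
rewrite (gtr0_sg h) pmulr_rgt0// => _.
by case: b {dE dE'} => h' /=; rewrite ?sgrN ?sgr1; lra.
Qed.

Lemma crossing_pt_index (l l' : nat) (eps d d' : R) : small R p q eps ->
  d = eps \/ d = - eps -> d' = eps \/ d' = - eps ->
  (crossing_pt R p q l d).2 = (crossing_pt R p q l' d').2 -> l = l'.
Proof.
move=> sm dE dE' /= E; have [e0 e1 _] := sm.
have [de _] := small_norm _ _ _ _ _ sm dE.
have [de' _] := small_norm _ _ _ _ _ sm dE'.
have := crossing_time_near R p q (p_gt0 _ podd) l d.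
have := crossing_time_near R p q (p_gt0 _ podd) l' d'.
rewrite E de de' !ler_norml => /andP[h1 h2] /andP[h3 h4].
have p2 := @pi_ge2 R.
have : l%:Z - l'%:Z = 0.
  by apply: (@pi_int_small R); rewrite rmorphB/=; apply/andP; split; lra.
lia.
Qed.

Lemma crossings_list (eps : R) : small R p q eps ->
  crossings (L0_curve eps) L1 =
  [set y | y = r_pt eps \/ exists2 l, (1 <= l <= p.-1./2)%N &
             y = x_pt l true eps \/ y = x_pt l false eps].
Proof.
move=> sm; apply/seteqP; split=> y.
  move=> /(crossingsP _ _ _ podd pq _ _ sm)[[|l] [d [lp dE ->]]].
    by left; case: dE => [->//|[]].
  right; exists l.+1; first by rewrite lp.
  have [|b ->] := x_pt_all l.+1 eps d lp; first by case: dE => [|[]]; [left|right].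
  by case: b; [left|right].
move=> [->|[l lI H]]; apply/(crossingsP _ _ _ podd pq _ _ sm).
  by exists 0%N, eps; split=> //; left.
have lp : (l <= p.-1./2)%N by case/andP: lI.
have X b : exists l' d, [/\ (l' <= p.-1./2)%N, d = eps \/ (d = - eps /\ (0 < l')%N)
    & x_pt l b eps = crossing_pt R p q l' d].
  by exists l, ((if b then -1 else 1) * Num.sg (branch l) * eps); split=> //;
    exact: x_pt_d.
by case: H => ->; exact: X.
Qed.

(** The intersection points in a single list. *)
Definition crossing_seq (eps : R) (k : nat) : R * R :=
  if k == 0%N then r_pt eps else x_pt (uphalf k) (odd k) eps.

Lemma crossing_seq_image (eps : R) : small R p q eps ->
  crossings (L0_curve eps) L1 = crossing_seq eps @` `I_p.
Proof.
move=> sm; rewrite crossings_list//; apply/seteqP; split=> y.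
  move=> [->|[l lI H]]; first by exists 0%N => //=; exact: p_gt0.
  case: H => ->.
    exists l.*2.-1; first by rewrite /=; move: podd lI; lia.
    rewrite /crossing_seq ifF; last by move: lI; lia.
    by congr x_pt; move: lI; lia.
  exists l.*2; first by rewrite /=; move: podd lI; lia.
  rewrite /crossing_seq ifF; last by move: lI; lia.
  by congr x_pt; move: lI; lia.
move=> [k /= kp <-]; rewrite /crossing_seq; case: eqP => k0; first by left.
right; exists (uphalf k); first by move: podd; lia.
by case: (odd k); [left|right].
Qed.

Lemma crossing_seq_inj (eps : R) : good eps ->
  {in `I_p &, injective (crossing_seq eps)}.
Proof.
move=> gd i j; rewrite !inE /= => ip jp; have [sm _] := gd; have [e0 _ _] := sm.
have xd l b := x_pt_d l b eps.
have xd' l b : (1 <= l <= p.-1./2)%N ->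
  (if b then -1 else 1) * Num.sg (branch l) * eps = eps \/
  (if b then -1 else 1) * Num.sg (branch l) * eps = - eps.
  by move=> /(xd l b) [|[]]; [left|right].
rewrite /crossing_seq; case: eqP => i0; case: eqP => j0 E; first by rewrite i0.
- have jI : (1 <= uphalf j <= p.-1./2)%N by move: podd; lia.
  have := crossing_pt_index 0 (uphalf j) eps _ _ sm (or_introl erefl) (xd' _ (odd
    j) jI).
  by rewrite -/(r_pt eps) E => /(_ erefl); lia.
- have iI : (1 <= uphalf i <= p.-1./2)%N by move: podd; lia.
  have := crossing_pt_index (uphalf i) 0 eps _ _ sm (xd' _ (odd i) iI) (or_introl
    erefl).
  by rewrite -/(r_pt eps) -E => /(_ erefl); lia.
have jI : (1 <= uphalf j <= p.-1./2)%N by move: podd; lia.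
have iI : (1 <= uphalf i <= p.-1./2)%N by move: podd; lia.
have ij : uphalf i = uphalf j.
  exact: crossing_pt_index (uphalf i) (uphalf j) eps _ _ sm (xd' _ (odd i) iI)
    (xd' _ (odd j) jI) (congr1 snd E).
have := x_pt_cos _ (odd i) _ gd iI; have := x_pt_cos _ (odd j) _ gd jI.
rewrite E; case: (boolP (odd i)) => oi; case: (boolP (odd j)) => oj h1 h2.
- by move: ij oi oj; clear; lia.
- by absurd_lra R.
- by absurd_lra R.
- by move: ij oi oj; clear; lia.
Qed.

End CrossingTypes.

Section CrossingFamilies.
Variables (R : realType) (p : nat) (q : int).
Hypothesis podd : odd p.
Hypothesis pq : coprimez p%:Z q.
Let m : R := (2 * q - p%:Z)%:~R.
Let P : R := p%:R.
Let L1 := L1_curve R p q.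
Let P0 : 0 < P. Proof. by rewrite ltr0n p_gt0. Qed.

Lemma L1_continuous : continuous (L1 : R -> R * R).
Proof. rewrite /L1 /=; cont. Qed.

Lemma pil_L1_continuous : continuous (fun t => pil (L1 t)).
Proof. by have c := L1_continuous; cont. Qed.

Lemma arc_closed (a b : R) : closed ((fun t => pil (L1 t)) @` `[a, b]).
Proof.
apply: compact_closed; first exact: pillowcase_hausdorff.
apply: continuous_compact; last exact: segment_compact.
by apply: continuous_subspaceT; exact: pil_L1_continuous.
Qed.

Lemma arc_nbhs (a b t : R) : 0 <= a -> b <= pi -> 0 <= t <= pi ->
  ~~ (a <= t <= b) ->
  nbhs (pil (L1 t)) (~` ((fun t => pil (L1 t)) @` `[a, b])).
Proof.
move=> a0 bp tI tab; apply: open_nbhs_nbhs; split.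
  by apply: closed_openC; exact: arc_closed.
move=> [u /=]; rewrite in_itv/= => uI E; move/negP: tab; apply.
rewrite -(L1_inj R p q podd pq u t _ tI E)//.
by case/andP: uI => u1 u2; rewrite (le_trans a0 u1) (le_trans u2 bp).
Qed.

Lemma small_le (e eps : R) : small R p q e -> 0 < eps <= e -> small R p q eps.
Proof.
move=> [e0 e1 e2] /andP[p1 p2]; split=> //; first exact: le_lt_trans e1.
apply: le_lt_trans e2; rewrite ler_wpM2r// ler_wpM2r//.
Qed.

Lemma small_bound (eps : R) : small R p q eps -> `|eps| * `|m| * 2 <= P.
Proof. by move=> sm; have [] := small_norm _ _ _ _ eps sm (or_introl erefl). Qed.

(** An intersection point close to the [l]-th diagonal point is one of those
    numbered [l]. *)
Lemma crossing_index (eps : R) (y : R * R) (l : nat) : small R p q eps ->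
  crossings (L0_curve eps) L1 y -> pi * (2 * l%:R - 1) < P * y.2 < pi * (2 * l%:R
    + 1) ->
  exists d, [/\ d = eps \/ (d = - eps /\ (0 < l)%N), (l <= p.-1./2)%N
    & y = crossing_pt R p q l d].
Proof.
move=> sm /(crossingsP _ _ _ podd pq _ _ sm)[k [d [kp dE ->]]] /=.
have dE' : d = eps \/ d = - eps by case: dE => [|[]]; [left|right].
have [de _] := small_norm _ _ _ _ _ sm dE'; have [_ e1 _] := sm.
have := crossing_time_near R p q (p_gt0 _ podd) k d; rewrite de ler_norml -/P.
move=> /andP[h1 h2] /andP[h3 h4]; have p2 := @pi_ge2 R.
have E : k = l.
  have h5 : k%:Z - l%:Z < 1.
    rewrite -(@ltr_int R) rmorphB/= -(ltr_pM2l (@pi_gt0 R)); lra.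
  have h6 : -1 < k%:Z - l%:Z.
    rewrite -(@ltr_int R) rmorphB/= rmorphN1 -(ltr_pM2l (@pi_gt0 R)); lra.
  by move: h5 h6; clear; lia.
by exists d; rewrite -E.
Qed.

Lemma r_plus : is_r_plus L1 (r_pt R p q).
Proof.
have p0 := p_gt0 _ podd; have pi0 := @pi_gt0 R.
have P1 : 1 <= P by rewrite /P ler1n.
have E00 : pil (L1 0) = pil (0, 0) by rewrite /L1 /= !mulr0.
have vI : 0 <= (0 : R) <= pi by rewrite lexx ltW.
split.
  near (0 : R)^'+ => e0; have sm0 : small R p q e0.
    by near: e0; exact: small_near.
  have [e00 _ _] := sm0.
  have sm eps : 0 < eps < e0 -> small R p q eps.
    by move=> /andP[h1 h2]; apply: (small_le _ _ sm0); rewrite h1 ltW.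
  have ct eps : `|eps| * `|m| * 2 <= P ->
      (fun eps => pil (L1 (crossing_time R p q 0 eps))) x @[x --> eps] --> pil
        (L1 (crossing_time R p q 0 eps)).
    move=> em; apply: (@cont_comp _ _ _ _ _ _ pil_L1_continuous).
    exact: crossing_time_continuous.
  exists e0 => //; split.
  - by move=> eps /sm sme; apply: crossing_pt_crossing => //; left.
  - apply: continuous_in_subspaceT => eps; rewrite inE/= in_itv/= => eI.
    by apply: ct; apply: small_bound; exact: sm.
  - have := ct 0; rewrite normr0 !mul0r => /(_ (ltW P0)).
    rewrite crossing_time0// mulr0 mul0r E00 => H.
    by apply: cvg_within_filter; exact: H.
move=> r' [e0 e00 [cr' _ lim']].
have nb : nbhs (pil (L1 0)) (~` ((fun t => pil (L1 t)) @` `[pi / P, pi])).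
  apply: arc_nbhs => //; first by rewrite divr_ge0 ?ltW.
  by rewrite negb_and -ltNge divr_gt0.
rewrite E00 in nb.
near=> eps.
have sm : small R p q eps by near: eps; exact: small_near.
have eI : 0 < eps < e0.
  apply/andP; split; first by near: eps; exact: nbhs_right_gt.
  by near: eps; exact: nbhs_right_lt.
have far : (~` ((fun t => pil (L1 t)) @` `[pi / P, pi])) (crv L1 (r' eps).2).
  by near: eps; exact: (lim' _ nb).
have cr := cr' _ eI; have [_ + _ _] := cr.
rewrite /params /L1 /= eqxx /= in_itv/= => /andP[t0 t1].
have t2 : (r' eps).2 < pi / P.
  rewrite ltNge; apply/negP => h; apply: far; exists (r' eps).2 => //=.
  by rewrite in_itv/= h.
have [|d [dE _ ->]] := crossing_index eps (r' eps) 0 sm cr.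
  move: t2; rewrite ltr_pdivlMr// => t2.
  by have := mulr_ge0 (ltW P0) t0; rewrite mulr0 !add0r => h; apply/andP; split; lra.
by case: dE => [->|[]].
Unshelve. all: by end_near.
Qed.

Lemma x_crossing (l : nat) (b : bool) : (1 <= l <= p.-1./2)%N ->
  is_x_crossing p q l b (x_pt R p q l b).
Proof.
move=> lI; have p0 := p_gt0 _ podd; have pi0 := @pi_gt0 R.
have /andP[l0 lp] := lI.
have lP : l%:R * 2 + 1 <= P.
  by rewrite /P -[2]/(2%:R) -natrM natr1 ler_nat muln2 -half_p//.
have l1 : 1 <= l%:R :> R by rewrite ler1n.
set ts := 2 * pi * l%:R / P.
have tsI : 0 <= ts <= pi.
  apply/andP; split; first by apply: divr_ge0; [nra|exact: ltW].
  by rewrite /ts ler_pdivrMr// -subr_ge0; nra.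
pose K1 := (fun t => pil (L1 t)) @` `[0, pi * (2 * l%:R - 1) / P].
pose K2 := (fun t => pil (L1 t)) @` `[pi * (2 * l%:R + 1) / P, pi].
exists (~` K1 `&` ~` K2).
  rewrite /x_point -/L1 -/ts; apply: filterI.
    apply: arc_nbhs => //; first by rewrite ler_pdivrMr//; nra.
    by rewrite negb_and -!ltNge; apply/orP; right;
      rewrite /ts ltr_pM2r ?invr_gt0//; nra.
  apply: arc_nbhs => //; first by rewrite divr_ge0 ?ltW//; nra.
  by rewrite negb_and -!ltNge; apply/orP; left; rewrite /ts ltr_pM2r ?invr_gt0//; nra.
move=> N nN NK.
have lim : pil (L1 (crossing_pt R p q l eps).2) @[eps --> (0 : R)] --> pil (L1 ts).
  have -> : ts = crossing_time R p q l 0 by rewrite crossing_time0.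
  apply: (@cont_comp _ _ _ _ _ _ pil_L1_continuous).
  by apply: crossing_time_continuous => //; rewrite normr0 !mul0r ltW.
have nearN : \forall eps \near (0 : R)^'+, N (pil (L1 (x_pt R p q l b eps).2)).
  have : (fun eps : R => (if b then -1 else 1) * Num.sg (branch R p q l) * eps) x
    @[x --> (0 : R)^'+] --> (0 : R).
    rewrite -[X in _ --> X](mulr0 ((if b then -1 else 1) * Num.sg (branch R p q l))).
    by apply: cvg_within_filter; apply: cvgM; [exact: cvg_cst|exact: cvg_id].
  by move=> /cvg_comp /(_ lim) /(_ _ nN).
near=> eps.
have NN : N (pil (L1 (x_pt R p q l b eps).2)) by near: eps; exact: nearN.
move=> y.
have gd : good R p q eps by near: eps; exact: good_near.
have [sm _] := gd; have [e0 e1 _] := sm.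
have dE := x_pt_d R p q podd pq l b eps lI.
have dE' : (if b then -1 else 1) * Num.sg (branch R p q l) * eps = eps \/
  (if b then -1 else 1) * Num.sg (branch R p q l) * eps = - eps.
  by case: dE => [|[]]; [left|right].
have c1 (s : R) : (1 - eps * cos s) / (1 + eps * cos s) < 1 <-> 0 < cos s.
  have := cos_le1 s; have := cos_geN1 s => h1 h2.
  rewrite ltr_pdivrMr ?mul1r; last by nra.
  by rewrite -(pmulr_rgt0 (cos s) e0); split; lra.
have c2 (s : R) : 1 < (1 - eps * cos s) / (1 + eps * cos s) <-> cos s < 0.
  have := cos_le1 s; have := cos_geN1 s => h1 h2.
  rewrite ltr_pdivlMr ?mul1r; last by nra.
  by rewrite -(pmulr_rlt0 (cos s) e0); split; lra.
rewrite L0_velocity /=; split=> [[cr Ny sl]|->].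
  have [pt0 + E _] := cr; rewrite /params /L1 /= eqxx /= in_itv/= => /andP[t0 t1].
  have [nK1 nK2] := NK _ Ny.
  have t2 : pi * (2 * l%:R - 1) / P < y.2.
    rewrite ltNge; apply/negP => h; apply: nK1; exists y.2 => //=.
    by rewrite in_itv/= t0.
  have t3 : y.2 < pi * (2 * l%:R + 1) / P.
    rewrite ltNge; apply/negP => h; apply: nK2; exists y.2 => //=.
    by rewrite in_itv/= h.
  have [|d [{}dE _ yE]] := crossing_index eps y l sm cr.
    by move: t2 t3; rewrite ltr_pdivrMr// ltr_pdivlMr// ![_ * P]mulrC => -> ->.
  have [|b' yE'] := x_pt_all R p q podd pq l eps d lI.
    by case: dE => [|[]]; [left|right].
  have := x_pt_cos R p q podd pq l b' eps gd lI; rewrite -yE' -yE => h.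
  have cy : 0 < (if b then 1 else -1) * cos y.1.
    by case: (b) sl => [/c1|/c2]; lra.
  have bb : b' = b.
    by move: h cy; case: (b'); case: (b) => // h cy; absurd_lra R.
  by rewrite yE yE' bb.
split.
- by apply: crossing_pt_crossing.
- by rewrite /crv crossing_pt_pil.
have := x_pt_cos R p q podd pq l b eps gd lI.
move: (x_pt R p q l b eps).1 => s.
by case: (b) => h; [apply/c1|apply/c2]; lra.
Unshelve. all: by end_near.
Qed.

End CrossingFamilies.

(** * Relative gradings *)

Section Gradings.
Variables (R : realType) (p : nat) (q : int).
Hypothesis podd : odd p.
Hypothesis pq : coprimez p%:Z q.
Variable z : (R -> pillowcase R) -> 'Z_4.
Hypothesis hz : is_pillow_class z.
Let m : R := (2 * q - p%:Z)%:~R.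
Let P : R := p%:R.
Let L1 := L1_curve R p q.
Let P0 : 0 < P. Proof. by rewrite ltr0n p_gt0. Qed.

Variable eps : R.
Hypothesis sm : small R p q eps.
Let L0 := L0_curve eps.

Let e0 : 0 < eps. Proof. by case: sm. Qed.
Let e1 : 0 < eps < 1. Proof. by case: sm => h1 h2 _; apply/andP; split; lra. Qed.

(** The class evaluated on a loop that follows the figure eight from [x] to [y]
    and returns along the arc. *)
Definition grading_value (x y : R * R) : 'Z_4 :=
  loop_value R z L0 L1 x.1 y.1 y.2 x.2.

Lemma crossing_data (x : R * R) : crossings L0 L1 x ->
  0 < x.2 < pi /\ pil (L0 x.1) = pil (L1 x.2).
Proof.
move=> /(crossingsP _ _ _ podd pq _ _ sm)[l [d [lp dE ->]]]; split.
  exact: (crossing_pt_itv _ _ q podd l eps d sm dE lp).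
by apply: crossing_pt_pil => //; case: dE => [|[]]; [left|right].
Qed.

Lemma grading_loop_value (x y : R * R) (a0 a1 : R -> R) :
  crossings L0 L1 x -> crossings L0 L1 y ->
  param_path L0 x.1 y.1 a0 -> param_path L1 y.2 x.2 a1 ->
  z (grading_loop L0 L1 a0 a1) = grading_value x y.
Proof.
move=> /crossing_data[xI xE] /crossing_data[yI yE].
move=> [ca0 [k0 a00] [k1 a01] _] [ca1 [j0 a10] [j1 a11] dom1].
have pE : period L0 = 2 * pi by [].
have pE1 : period L1 = 0 by [].
rewrite pE mulrC in a00; rewrite pE mulrC in a01.
rewrite pE1 mulr0 addr0 in a10; rewrite pE1 mulr0 addr0 in a11.
have a1I u : 0 <= u <= 1 -> 0 < a1 u < pi.
  move=> uI; have [|d1 /pillow_star_pil s1] := dom1 u; first by rewrite in_itv.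
  move: d1; rewrite /L1 /= in_itv/= => /andP[h1 h2].
  rewrite !lt_neqAle h1 h2 !andbT; apply/andP; split; apply/eqP => h; apply: s1.
    by exists 0, 0; rewrite /L1 /= -h !mulr0.
  by exists q, (q - p%:Z); rewrite h /L1 /= ![_ * pi]mulrC.
have cL0 := @L0_continuous R eps; have cL1 := @L1_continuous R p q.
have sL0 s : ~ lattice (L0 s) by exact: L0_not_lattice.
have sL1 t : 0 < t < pi -> ~ lattice (L1 t) by exact: L1_star.
have per s : pil (L0 (s + 2 * pi)) = pil (L0 s) by exact: L0_period.
have triv : z (fun u => pil (L0 (2 * pi * u))) = 0 by exact: L0_loop_trivial.
have shift s k : pil (L0 (s + 2 * pi * k%:~R)) = pil (L0 s).
  by apply/pil_eqP; exists false, (- k), (- k); rewrite expr0 /L0 /=;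
    rewrite (_ : 2 * pi * k%:~R = pi * (0 + 2 * k)%:~R) ?sin_pi_int ?isign_double;
    [rewrite /isign expr0 !rmorphD rmorphN rmorphM/=; split; ring
    |rewrite add0r rmorphM/=; ring].
rewrite /grading_value.
rewrite -(loop_value_mod R z hz.1 L0 L1 cL0 cL1 sL0 sL1 per triv x.1 y.1 y.2 x.2
  k0 k1)//.
by apply: loop_value_path => //; [exact: hz.1|rewrite shift|rewrite shift].
Qed.

Lemma param_path_L0 (x y : R) : param_path L0 x y (lin x y).
Proof.
split; first by apply: continuous_subspaceT; exact: lin_cont.
- by exists 0; rewrite lin0 mul0r addr0.
- by exists 0; rewrite lin1 mul0r addr0.
by move=> u _; split=> //; apply/pillow_star_pil/L0_not_lattice.
Qed.

Lemma param_path_L1 (x y : R) : 0 < x < pi -> 0 < y < pi ->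
  param_path L1 x y (lin x y).
Proof.
move=> xI yI; split; first by apply: continuous_subspaceT; exact: lin_cont.
- by exists 0; rewrite lin0 mul0r addr0.
- by exists 0; rewrite lin1 mul0r addr0.
move=> u; rewrite in_itv/= => uI; have I := lin_convex _ _ _ _ _ _ xI yI uI.
split; last by apply/pillow_star_pil/L1_star.
by rewrite /L1 /= in_itv/= !ltW//; case/andP: I.
Qed.

Lemma grading_value_cocycle (x y w : R * R) :
  crossings L0 L1 x -> crossings L0 L1 y -> crossings L0 L1 w ->
  grading_value x w = grading_value x y + grading_value y w.
Proof.
move=> /crossing_data[xI xE] /crossing_data[yI yE] /crossing_data[wI wE].
apply: loop_value_cocycle => //; [exact: hz.1|exact: L0_continuous
  |exact: L1_continuous|move=> s; exact: L0_not_lattice|move=> t; exact: L1_star].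
Qed.

Lemma crossing_rel_grading (x y : R * R) (g : 'Z_4) :
  crossings L0 L1 x -> crossings L0 L1 y ->
  rel_grading L0 L1 z x y g <-> g = grading_value x y.
Proof.
move=> cx cy; have [_ _ em] := sm.
have em' : eps * `|(2 * q - p%:Z)%:~R| < p%:R.
  have := normr_ge0 m; rewrite -/m -/P in em *.
  by have := mulr_ge0 (ltW e0) (normr_ge0 m); lra.
split=> [/(rel_gradingP _ _ _ _ _ _ _ _ e0 em' (p_gt0 _ podd))[a0 [a1 [P1 P2
  ->]]]|->].
  exact: grading_loop_value.
apply/(rel_gradingP _ _ _ _ _ _ _ _ e0 em' (p_gt0 _ podd)).
have [xI _] := crossing_data _ cx; have [yI _] := crossing_data _ cy.
exists (lin x.1 y.1), (lin y.2 x.2); have A := param_path_L0 x.1 y.1.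
have B := param_path_L1 _ _ yI xI.
by split=> //; rewrite grading_loop_value.
Qed.

Lemma sin_le_id (x : R) : 0 <= x -> sin x <= x.
Proof.
move=> x0; have := @sin_lipschitz R x 0; rewrite sin0 !subr0 (ger0_norm x0).
by apply: le_trans; exact: ler_norm.
Qed.

(** The loop that follows the figure eight from [x_l^+] to [x_l^-] and returns
    along the arc circles one corner. *)
Lemma x_grading_value (l : nat) : good R p q eps -> (1 <= l <= p.-1./2)%N ->
  grading_value (x_pt R p q l true eps) (x_pt R p q l false eps) = 1.
Proof.
move=> gd lI; have p2 := @pi_ge2 R; have [ep e2 _] := sm.
have b0 := branch_neq0 R p q podd pq l lI; set S := branch R p q l in b0.
pose ts := 2 * pi * l%:R / P.
have SE : S = sin (m * ts / 2) by [].
(* [e] is the sign relating the lifts of the two curves *)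
pose e : R := isign l%:Z * Num.sg S.
have sg2 : Num.sg S * Num.sg S = 1 by rewrite -expr2 sqr_sg b0.
have e_cases : e = 1 \/ e = -1.
  rewrite /e; case: (isign_cases R l%:Z) => ->; case: (sgrP S) b0 => // _ _;
    rewrite ?mulr1 ?mul1r ?mulrNN ?mulr1 ?mul1r; by [left|right].
pose f (t : R) := e * (m * t / 2 - pi * l%:R).
have fsin t : sin (f t) = Num.sg S * sin (m * t / 2).
  have -> : sin (f t) = e * sin (m * t / 2 + pi * (- l%:Z)%:~R).
    rewrite rmorphN mulrN /f.
    by case: e_cases => ->; rewrite ?mul1r// !mulN1r sinN.
  rewrite sin_pi_int isignN /e -[RHS]mul1r -(isign_sqr R l%:Z); ring.
have fcos t : cos (f t) = isign l%:Z * cos (m * t / 2).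
  have -> : cos (f t) = cos (m * t / 2 + pi * (- l%:Z)%:~R).
    rewrite rmorphN mulrN /f.
    by case: e_cases => ->; rewrite ?mul1r// !mulN1r cosN.
  by rewrite cos_pi_int isignN.
(* [U] is the position along the diagonal, normalized to lie in [(0, pi)] *)
have [j /andP[j0 j1]] := mod_2pi _ (f ts).
pose U t := f t - 2 * pi * j%:~R.
have Uper t (h : R -> R) : (forall x k, h (x + pi * (0 + 2 * k)%:~R) = h x) -> h
  (U t) = h (f t).
  move=> H; rewrite -(H (f t) (- j)); congr h;
    rewrite /U add0r rmorphM rmorphN/=; ring.
have sP x k : sin (x + pi * (0 + 2 * k)%:~R) = sin x :> R.
  by rewrite sin_pi_int isign_double /isign expr0 mul1r.
have cP x k : cos (x + pi * (0 + 2 * k)%:~R) = cos x :> R.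
  by rewrite cos_pi_int isign_double /isign expr0 mul1r.
have Ts : sin (U ts) = `|S| by rewrite Uper// fsin -SE -normrEsg.
have S0 : 0 < `|S| by rewrite normr_gt0.
have Us : `|S| <= U ts /\ `|S| <= pi - U ts.
  have Upi : U ts <= pi.
    rewrite leNgt; apply/negP => h; have : 0 <= sin (U ts - pi).
      by apply: sin_ge0_pi; apply/andP; rewrite /U; split; [rewrite /U in h|]; lra.
    rewrite -[pi]mulr1 -mulrN -[X in _ * X]/((-1)%:~R) sin_pi_int Ts /isign
      expr1; lra.
  split; first by rewrite -Ts; apply: sin_le_id.
  rewrite -Ts (_ : sin (U ts) = sin (pi - U ts)); first by apply: sin_le_id; lra.
  by rewrite addrC sinDpi sinN opprK.
have UI d : d = eps \/ d = - eps -> 0 < U (crossing_time R p q l d) < pi.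
  move=> dE; have [de _] := small_norm _ _ _ _ _ sm dE.
  have := crossing_time_near R p q (p_gt0 _ podd) l d; rewrite de -/P => near.
  have : `|U (crossing_time R p q l d) - U ts| < `|S|.
    rewrite -(ltr_pM2l P0); apply: le_lt_trans (gd.2 l lI).
    rewrite -{1}(gtr0_norm P0) -normrM.
    rewrite (_ : P * _ = e * m * (P * crossing_time R p q l d / 2 - pi * l%:~R)).
      rewrite -mulrA normrM (_ : `|e| = 1); last first.
        by case: e_cases => ->; rewrite ?normrN normr1.
      by rewrite mul1r normrM mulrC ler_wpM2r.
    by rewrite /U /f /ts; field; rewrite gt_eqF.
  by rewrite ltr_norml => /andP[h1 h2]; case: Us => h3 h4; apply/andP; split; lra.
pose dp := (-1) * Num.sg S * eps; pose dm := 1 * Num.sg S * eps.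
have dpE : dp = eps \/ dp = - eps.
  by have [|[]] := x_pt_d R p q podd pq l true eps lI; [left|right].
have dmE : dm = eps \/ dm = - eps.
  by have [|[]] := x_pt_d R p q podd pq l false eps lI; [left|right].
pose tp := crossing_time R p q l dp; pose tm := crossing_time R p q l dm.
have Ip : 0 < U tp < pi := UI _ dpE; have Im : 0 < U tm < pi := UI _ dmE.
have Ep : P * tp / 2 - pi * l%:R = dp * cos (m * tp / 2).
  by have := crossing_time_eq R p q (p_gt0 _ podd) l dp; rewrite -/tp -/P -/m; lra.
have Em : P * tm / 2 - pi * l%:R = dm * cos (m * tm / 2).
  by have := crossing_time_eq R p q (p_gt0 _ podd) l dm; rewrite -/tm -/P -/m; lra.
have edp : e * dp = - (isign l%:Z * eps).
  by rewrite /e /dp (_ : _ * _ = - isign l%:Z * (Num.sg S * Num.sg S) * eps);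
    [rewrite sg2|]; ring.
have edm : e * dm = isign l%:Z * eps.
  by rewrite /e /dm (_ : _ * _ = isign l%:Z * (Num.sg S * Num.sg S) * eps);
    [rewrite sg2|]; ring.
pose s_p := U tp - pi / 2; pose s_m := 2 * pi - U tm - pi / 2.
have [kp kpE] : exists k : int, (x_pt R p q l true eps).1 = s_p + 2 * pi * k%:~R.
  rewrite /x_pt /crossing_pt -/S -/dp -/tp /=;
    have [k ->] := wrap2piE R (- (isign l * Num.sg dp) * (m * tp / 2 - pi * l%:R)
      - pi / 2).
  exists (k + j); rewrite /s_p /U /f rmorphD/=.
  have -> : - (isign l * Num.sg dp) = e.
    by rewrite /dp !sgrM sgrN1 sgr_id (gtr0_sg e0) /e; ring.
  by ring.
have [km kmE] : exists k : int, (x_pt R p q l false eps).1 = s_m + 2 * pi * k%:~R.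
  rewrite /x_pt /crossing_pt -/S -/dm -/tm /=;
    have [k ->] := wrap2piE R (- (isign l * Num.sg dm) * (m * tm / 2 - pi * l%:R)
      - pi / 2).
  exists (k - j - 1); rewrite /s_m /U /f !rmorphB/=.
  have -> : - (isign l * Num.sg dm) = - e.
    by rewrite /dm !sgrM sgr1 sgr_id (gtr0_sg e0) /e; ring.
  by ring.
have /crossing_data[Tp Pp] : crossings L0 L1 (x_pt R p q l true eps).
  by apply: crossing_pt_crossing => //;
    [exact: (x_pt_d R p q podd pq l true eps lI)|case/andP: lI].
have /crossing_data[Tm Pm] : crossings L0 L1 (x_pt R p q l false eps).
  by apply: crossing_pt_crossing => //;
    [exact: (x_pt_d R p q podd pq l false eps lI)|case/andP: lI].
have cL0 := @L0_continuous R eps; have cL1 := @L1_continuous R p q.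
have sL0 s : ~ lattice (L0 s) by exact: L0_not_lattice.
have sL1 t : 0 < t < pi -> ~ lattice (L1 t) by exact: L1_star.
have per s : pil (L0 (s + 2 * pi)) = pil (L0 s) by exact: L0_period.
have triv : z (fun u => pil (L0 (2 * pi * u))) = 0 by exact: L0_loop_trivial.
rewrite /grading_value.
have -> : (x_pt R p q l true eps).2 = tp by [].
have -> : (x_pt R p q l false eps).2 = tm by [].
have lv := loop_value_mod R z hz.1 L0 L1 cL0 cL1 sL0 sL1 per triv
  (x_pt R p q l true eps).1 (x_pt R p q l false eps).1 tm tp (- kp) (- km).
rewrite -lv// kpE kmE !rmorphN !mulrN !addrK {lv}.
(* the lift of the loop, in diagonal coordinates around [(pi, pi)] *)
pose X := Defs.cat_path (fun u => lin s_p s_m u - pi / 2)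
                        (fun u => pi - U (lin tm tp u)).
pose Y := Defs.cat_path (fun u => - (eps * sin (lin s_p s_m u)))
                        (fun u => e * (P * lin tm tp u / 2 - pi * l%:R)).
rewrite /loop_value.
have -> : Defs.cat_path (fun u => pil (L0 (lin s_p s_m u)))
    (fun u => pil (L1 (lin tm tp u))) = (fun u => pil (diag_pt 1 (X u) (Y u))).
  apply/funext => u; rewrite /X /Y /Defs.cat_path; case: ifP => _.
    by rewrite /L0 (L0_diag _ _ _ 1); congr (pil (diag_pt 1 _ _)); field.
  apply/pil_eqP; rewrite L1_coords -/m -/P /diag_pt /U /f.
  move: (lin tm tp _) => t; case: e_cases => ->.
    by exists true, (1 + j + l%:Z), (1 + j); rewrite /= expr1 !rmorphD/=; split;
      field.
  exists false, (1 + j - l%:Z), (1 + j).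
  by rewrite /= expr0 rmorphB !rmorphD/=; split; field.
have sc (x : R) : sin (x - pi / 2) = - cos x by exact: sinBpihalf.
have Ulin u : U (lin tm tp u) = lin (U tm) (U tp) u.
  by rewrite /U /f /lin; field.
have Yp : - (eps * sin s_p) = isign l%:Z * eps * cos (m * tp / 2).
  by rewrite /s_p sc Uper// fcos; ring.
have Ym : - (eps * sin s_m) = isign l%:Z * eps * cos (m * tm / 2).
  rewrite /s_m sc (_ : 2 * pi - U tm = - U tm + pi * (0 + 2 * 1)%:~R).
    by rewrite cP cosN Uper// fcos; ring.
  by rewrite add0r mulr1; ring.
have Yp' : e * (P * tp / 2 - pi * l%:R) = - (isign l%:Z * eps * cos (m * tp / 2)).
  by rewrite Ep mulrA edp; ring.
have Ym' : e * (P * tm / 2 - pi * l%:R) = isign l%:Z * eps * cos (m * tm / 2).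
  by rewrite Em mulrA edm.
have Ybd t : - eps <= isign l%:Z * eps * cos (m * t / 2) <= eps.
  have h : `|eps * cos (m * t / 2)| <= eps.
    by rewrite normrM (gtr0_norm ep) ler_piMr ?cos_max// ltW.
  rewrite -ler_norml -mulrA normrM (_ : `|isign l%:Z| = 1) ?mul1r//.
  by case: (isign_cases R l%:Z) => ->; rewrite ?normrN normr1.
clear kp kpE km kmE Pp Pm Tp Tm edp edm Ep Em dpE dmE UI Us S0 Ts fsin fcos.
clear sP cP Uper j0 j1 e_cases sg2 SE b0 sc cL0 cL1 sL0 sL1 per triv gd lI.
apply: corner_ccw => //.
- apply: cat_continuous; [by cont|by rewrite /U /f; cont|].
  by rewrite lin1 lin0 /s_m; field.
- apply: cat_continuous; [by cont|by cont|].
  by rewrite lin1 lin0 Ym Ym'.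
- move=> u uI; rewrite /X /Y /Defs.cat_path; case: (lerP u 2^-1) => h.
    have vI : 0 <= 2 * u <= 1 by apply/andP; split; lra.
    move: (2 * u) vI => v vI.
    have s1 := @sin_le1 R (lin s_p s_m v); have s2 := @sin_geN1 R (lin s_p s_m v).
    have XI : - pi < lin s_p s_m v - pi / 2 < pi.
      have : - pi / 2 < lin s_p s_m v < 3 * pi / 2.
        by apply: lin_convex => //; rewrite /s_p /s_m; apply/andP; split; lra.
      by move=> /andP[h1 h2]; apply/andP; split; lra.
    split; [by apply/andP; split; lra|by apply/andP; split; nra|move=> X0].
    by rewrite (_ : lin s_p s_m v = pi / 2) ?sin_pihalf ?mulr1; lra.
  have vI : 0 <= 2 * u - 1 <= 1 by apply/andP; split; lra.
  move: (2 * u - 1) vI => v vI.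
  have UIv : 0 < U (lin tm tp v) < pi by rewrite Ulin; exact: lin_convex.
  split; [by apply/andP; split; lra| |by move=> X0; exfalso; lra].
  rewrite (_ : 2 * _ = lin (2 * (e * (P * tm / 2 - pi * l%:R)))
      (2 * (e * (P * tp / 2 - pi * l%:R))) v); last by rewrite /lin; field.
  rewrite Yp' Ym'; have := Ybd tp; have := Ybd tm => /andP[h1 h2] /andP[h3 h4].
  by apply: lin_convex => //; apply/andP; split; lra.
- by rewrite /X cat0 lin0 /s_p; lra.
- by rewrite /X cat0 cat1 lin0 lin1 /s_p; field.
- by rewrite /Y cat0 cat1 lin0 lin1 Yp Yp'.
Qed.

End Gradings.

(** * The embedded arc *)

Section Arc.
Variables (R : realType) (p : nat) (q : int).
Hypothesis podd : odd p.
Hypothesis pq : coprimez p%:Z q.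
Let L1 := L1_curve R p q.

Lemma arc_embedding (X : topologicalType) (f : X -> pillowcase R) (phi : R -> X) :
  is_arc_parametrization 0 pi phi ->
  (forall t, t \in `[0, pi] -> f (phi t) = pil (L1 t)) ->
  topological_embedding f.
Proof.
move=> [cphi [psi [cpsi psiI phiK psiK]]] fphi.
have fE : f = (fun x => pil (L1 (psi x))).
  by apply/funext => x; rewrite -fphi// phiK.
have cL := L1_continuous R p q.
split.
- by rewrite fE; cont.
- move=> x y; rewrite fE => E; rewrite -(phiK x) -(phiK y); congr phi.
  by apply: (L1_inj R p q podd pq); [have := psiI x|have := psiI y|]; rewrite ?in_itv.
move=> U oU.
have cfU : closed (f @` (~` U)).
  apply: compact_closed; first exact: pillowcase_hausdorff.
  apply: continuous_compact; first by apply: continuous_subspaceT; rewrite fE; cont.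
  have -> : ~` U = setT `&` ~` U by rewrite setTI.
  apply: compact_closedI; last exact: open_closedC.
  have -> : [set: X] = phi @` `[0, pi].
    by apply/seteqP; split=> // x _; exists (psi x); rewrite ?phiK//; exact: psiI.
  by apply: continuous_compact => //; exact: segment_compact.
exists (~` (f @` (~` U))); first exact: closed_openC.
apply/seteqP; split=> x /=.
  move=> Ux [y nUy E]; apply: nUy; suff -> : y = x by [].
  move: E; rewrite fE => E; rewrite -(phiK x) -(phiK y); congr phi.
  by apply: (L1_inj R p q podd pq); [have := psiI y|have := psiI x|]; rewrite ?in_itv.
by move=> H; apply: contrapT => nUx; apply: H; exists x.
Qed.

Lemma arc_range (X : Type) (f : X -> pillowcase R) (phi : R -> X) (psi : X -> R) :
  (forall x, psi x \in `[0, pi]) -> cancel psi phi ->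
  (forall t, t \in `[0, pi] -> f (phi t) = pil (L1 t)) ->
  range f = (pil \o L1) @` `[0, pi].
Proof.
move=> psiI phiK fphi; apply/seteqP; split=> y [x].
  by move=> _ <-; exists (psi x); rewrite /= ?psiI// -fphi// phiK.
by move=> /= xI <-; exists (phi x) => //; rewrite fphi.
Qed.

Lemma affine_smooth (a b : R) : smooth1 (fun t => a * t + b).
Proof.
have A n : exists c d, derive1n n (fun t => a * t + b) = (fun t => c * t + d).
  elim: n => [|n [c [d IH]]]; first by exists a, b.
  exists 0, c; rewrite derive1nS IH; apply/funext => t.
  rewrite derive1E mul0r add0r.
  have D : is_derive t 1 (fun t => c * t + d) c.
    by apply: is_derive_eq; rewrite addr0 -[RHS]mulr1.
  exact: derive_val.
move=> n t; have [c [d ->]] := A n.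
have D : is_derive t 1 (fun t => c * t + d) c.
  by apply: is_derive_eq; rewrite addr0 -[RHS]mulr1.
exact: ex_derive.
Qed.

Let a : R := q%:~R.
Let b : R := (q - p%:Z)%:~R.
Let V : R := Num.sqrt (a ^+ 2 + b ^+ 2).

Let V2 : V ^+ 2 = a ^+ 2 + b ^+ 2.
Proof. by rewrite sqr_sqrtr// addr_ge0// sqr_ge0. Qed.

Let V0 : 0 < V.
Proof.
rewrite sqrtr_gt0 lt_neqAle addr_ge0 ?sqr_ge0// andbT eq_sym.
rewrite paddr_eq0 ?sqr_ge0// !sqrf_eq0 negb_and /a /b !intr_eq0.
by have := p_gt0 _ podd; lia.
Qed.

(** A lattice point on the line through the arc is an integer multiple of its end
    point; the others are at distance at least [pi / V]. *)
Lemma arc_dist (t d : R) : 0 <= t <= pi -> 0 < d -> d * V <= pi ->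
  truncated_plane d (L1 t) <-> d <= t * V /\ d <= (pi - t) * V.
Proof.
move=> /andP[t0 t1] d0 dV.
have sq (x : R) : 0 <= x -> Num.sqrt ((x * V) ^+ 2) = x * V.
  by move=> x0; rewrite sqrtr_sqr ger0_norm// mulr_ge0// ltW.
split=> [H|[h1 h2] c [k [l ->]]].
  split.
    rewrite -sq//; have := H (0, 0); rewrite /dist2 /= !subr0.
    move=> /(_ _)/le_trans; apply; first by exists 0, 0; rewrite mulr0.
    rewrite -/a -/b (_ : (t * V) ^+ 2 = (a * t) ^+ 2 + (b * t) ^+ 2)//.
    by rewrite [LHS]exprMn V2; ring.
  rewrite -sq ?subr_ge0//; have := H (pi * q%:~R, pi * (q - p%:Z)%:~R).
  rewrite /dist2 /= -/a -/b => /(_ _)/le_trans; apply; first by exists q, (q - p%:Z).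
  rewrite (_ : ((pi - t) * V) ^+ 2 = (a * t - pi * a) ^+ 2 + (b * t - pi * b) ^+ 2)//.
  by rewrite [LHS]exprMn V2; ring.
rewrite /dist2 /= -/a -/b.
(* the distance to a lattice point off the line is bounded below by a cross
   product, a nonzero multiple of [pi] *)
suff : d ^+ 2 <= (a * t - pi * k%:~R) ^+ 2 + (b * t - pi * l%:~R) ^+ 2.
  by move=> /ler_wsqrtr; rewrite sqrtr_sqr ger0_norm// ltW.
have [kl|kl] := eqVneq (k * (q - p%:Z)) (l * q).
  have /coprimezP[[u v] /= uv] := pq.
  pose j := (v + u) * k - u * l.
  have jk : k = j * q.
    have -> : j * q = k * (u * p%:Z + v * q) + u * (k * (q - p%:Z) - l * q).
      by rewrite /j; ring.
    by rewrite uv kl; ring.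
  have jl : l = j * (q - p%:Z).
    have -> : j * (q - p%:Z) = l * (u * p%:Z + v * q) + (u + v) * (k * (q - p%:Z)
      - l * q).
      by rewrite /j; ring.
    by rewrite uv kl; ring.
  have -> : (a * t - pi * k%:~R) ^+ 2 + (b * t - pi * l%:~R) ^+ 2 =
      ((t - pi * j%:~R) * V) ^+ 2.
    by rewrite [RHS]exprMn V2 jk jl !(rmorphM _ j)/= -/a -/b; ring.
  have pi0 := @pi_gt0 R; have [j0|j1] := lerP j 0.
    have : pi * j%:~R <= pi * 0 :> R by rewrite ler_pM2l// -[0]/(0%:~R) ler_int.
    rewrite mulr0 => h; have h3 : d <= (t - pi * j%:~R) * V.
      by apply: le_trans h1 _; rewrite ler_pM2r//; lra.
    have h0 := lt_le_trans d0 h3.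
    by rewrite lerXn2r// nnegrE ltW.
  have : pi * 1 <= pi * j%:~R :> R by rewrite ler_pM2l// -[1]/(1%:~R) ler_int.
  rewrite mulr1 => h.
  have -> : ((t - pi * j%:~R) * V) ^+ 2 = ((pi * j%:~R - t) * V) ^+ 2 by ring.
  have h3 : d <= (pi * j%:~R - t) * V.
    by apply: le_trans h2 _; rewrite ler_pM2r//; lra.
  have h0 := lt_le_trans d0 h3.
  by rewrite lerXn2r// nnegrE ltW.
have c2 : 1 <= (k%:~R * b - l%:~R * a) ^+ 2.
  have -> : k%:~R * b - l%:~R * a = (k * (q - p%:Z) - l * q)%:~R.
    by rewrite rmorphB !rmorphM.
  by rewrite -rmorphXn/= -[1]/(1%:~R) ler_int; move: kl; nia.
rewrite -(ler_pM2r (exprn_gt0 2 V0)).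
apply: (@le_trans _ _ (pi ^+ 2 * (k%:~R * b - l%:~R * a) ^+ 2)).
  apply: (@le_trans _ _ (pi ^+ 2)).
    by rewrite -exprMn lerXn2r ?nnegrE ?pi_ge0// mulr_ge0 ?ltW.
  by rewrite ler_peMr// sqr_ge0.
have -> : ((a * t - pi * k%:~R) ^+ 2 + (b * t - pi * l%:~R) ^+ 2) * V ^+ 2 =
  pi ^+ 2 * (k%:~R * b - l%:~R * a) ^+ 2 +
  ((a * t - pi * k%:~R) * a + (b * t - pi * l%:~R) * b) ^+ 2.
  by rewrite V2; ring.
by rewrite lerDl sqr_ge0.
Qed.

Lemma arc_restricted : restricted_immersed_arc ((pil \o L1) @` `[0, pi]).
Proof.
have pi0 := @pi_gt0 R.
exists 0, pi, L1; split=> //.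
- split.
    have := affine_smooth a 0.
    by rewrite (_ : (fun t => a * t + 0) = fst \o L1)//; apply/funext => t;
      rewrite addr0.
  have := affine_smooth b 0.
  by rewrite (_ : (fun t => b * t + 0) = snd \o L1)//; apply/funext => t;
    rewrite addr0.
- by move=> t _; rewrite L1_velocity; apply: L1_velocity_neq0; exact: p_gt0.
- split; first by exists 0, 0; rewrite /L1 /= !mulr0.
    by exists q, (q - p%:Z); rewrite /L1 /= ![_ * pi]mulrC.
  by move=> t; rewrite in_itv/=; exact: L1_star.
have V3 : 0 < pi / (3 * V) by rewrite divr_gt0// mulr_gt0.
(* the truncated arc is the part at parameter distance [d / V] from the ends *)
near=> d; have d0 : 0 < d by near: d; exact: nbhs_right_gt.
have : d < pi / (3 * V) by near: d; exact: nbhs_right_lt.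
rewrite ltr_pdivlMr ?mulr_gt0// => dV.
have dV' : d < pi * V / 3 by near: d; apply: nbhs_right_lt;
  rewrite divr_gt0// mulr_gt0.
have dvI : 0 < d / V by rewrite divr_gt0.
have dV3 : d / V * 3 < pi.
  by rewrite -(ltr_pM2r V0); rewrite (_ : _ * V = d * 3); [lra|field; rewrite gt_eqF].
have dVV : d / V * V = d by rewrite divfK// gt_eqF.
have I1 : 0 <= d / V <= pi by apply/andP; split; lra.
have I2 : 0 <= pi - d / V <= pi by apply/andP; split; lra.
exists (d / V), (pi - d / V); split.
- by split; [apply/andP; split; lra|lra].
- have dV1 : d * V <= pi by lra.
  apply/seteqP; split=> t /=; rewrite !in_itv/=.
    move=> [tI /(arc_dist _ _ tI d0 dV1)[h1 h2]].
    by apply/andP; split; rewrite -(ler_pM2r V0) ?mulrBl ?dVV; lra.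
  move=> /andP[h1 h2]; have tI : 0 <= t <= pi by apply/andP; split; lra.
  split=> //; apply/(arc_dist _ _ tI d0 dV1).
  by split; rewrite -[leLHS]dVV ler_pM2r//; lra.
- have S x : 0 < x -> Num.sqrt ((x * V) ^+ 2) = x * V.
    by move=> x0; rewrite sqrtr_sqr ger0_norm// mulr_ge0// ltW.
  have V20 : 0 < V ^+ 2 by rewrite exprn_gt0.
  split.
    exists (0, 0); split; first by exists 0, 0; rewrite mulr0.
      rewrite /dist2 /= !subr0 -/a -/b -[RHS]dVV -S//; congr Num.sqrt.
      by rewrite [RHS]exprMn V2; ring.
    rewrite L1_velocity /= !subr0 -/a -/b.
    rewrite (_ : _ + _ = d / V * V ^+ 2); last by rewrite V2; ring.
    by rewrite gt_eqF// mulr_gt0.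
  exists (pi * a, pi * b); split; first by exists q, (q - p%:Z).
    rewrite /dist2 /= -/a -/b -[RHS]dVV -S//; congr Num.sqrt.
    by rewrite [RHS]exprMn V2; ring.
  rewrite L1_velocity /= -/a -/b.
  rewrite (_ : _ + _ = - (d / V * V ^+ 2)); last by rewrite V2; ring.
  by rewrite oppr_eq0 gt_eqF// mulr_gt0.
- by move=> /(L1_inj R p q podd pq _ _ I1 I2); lra.
move=> s t; rewrite !in_itv/= => sI tI [H [_ HH]].
have J : (1 : R) \in `[0, 1] by rewrite in_itv/= ler01 lexx.
have [_ E1 _ E2 _] := HH 1 1 J J; move: E2;
  rewrite E1 !mul1r ![d / V + _]addrC !subrK.
move=> /esym/(L1_inj R p q podd pq s t); apply; apply/andP; split; lra.
Unshelve. all: by end_near.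
Qed.

End Arc.

(** * Lifting squares to the plane *)

(** Compactness of the unit interval, as an induction principle: a property of
    intervals that is additive and holds locally holds for the whole interval. *)
Lemma interval_induction (R : realType) (Q : R -> R -> Prop) :
  (forall x, 0 <= x <= 1 -> exists2 d, 0 < d & forall a b,
     0 <= a <= x -> x <= b <= 1 -> x - d < a -> b < x + d -> Q a b) ->
  (forall a b c, 0 <= a <= b -> b <= c <= 1 -> Q a b -> Q b c -> Q a c) ->
  Q 0 1.
Proof.
move=> loc add; pose E := [set c | 0 <= c <= 1 /\ Q 0 c].
have I0 : 0 <= (0 : R) <= 1 by rewrite lexx ler01.
have E0 : E 0.
  by split=> //; have [d d0 H] := loc 0 I0; apply: H; rewrite ?lexx//; lra.
have ubE : has_ubound E by exists 1 => c [/andP[]].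
have sE : has_sup E by split=> //; exists 0.
have s0 : 0 <= sup E by exact: ub_le_sup.
have s1 : sup E <= 1 by apply: ge_sup; [exists 0|move=> c [/andP[]]].
have [d d0 H] := loc (sup E) (andb_true_intro (conj s0 s1)).
have [c [cI Qc] cs] := sup_adherent d0 sE.
have c_le : c <= sup E by exact: ub_le_sup.
have step s' : sup E <= s' <= 1 -> s' < sup E + d -> Q 0 s'.
  move=> /andP[s2 s3] s4; case/andP: cI => c0 _; apply: (add 0 c s') => //.
  - by rewrite lexx.
  - by apply/andP; split; lra.
  - by apply: H; try lra; apply/andP; split; lra.
have [e1|lt1] := eqVneq (sup E) 1.
  by apply: step; rewrite ?e1 ?lexx//; lra.
have {}lt1 : sup E < 1 by rewrite lt_neqAle lt1.
pose s' := Num.min 1 (sup E + d / 2).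
have s'1 : s' <= 1 by rewrite /s' ge_min lexx.
have s's : sup E < s' by rewrite /s' lt_min; apply/andP; split; lra.
have s'd : s' < sup E + d by rewrite /s' gt_min; apply/orP; right; lra.
suff : s' <= sup E by lra.
apply: ub_le_sup => //; split; first by apply/andP; split; lra.
by apply: step => //; rewrite s'1 ltW.
Qed.

(** The deck transformations of the plane over the pillowcase. *)
Definition deck {R : realType} (e : bool) (k l : int) (w : R * R) : R * R :=
  ((-1) ^+ e * w.1 + 2 * pi * k%:~R, (-1) ^+ e * w.2 + 2 * pi * l%:~R).

Lemma pil_deck (R : realType) (e : bool) (k l : int) (w : R * R) :
  pil (deck e k l w) = pil w.
Proof. by apply/esym/pil_eqP; exists e, k, l. Qed.

Lemma continuous_clamp_itv (R : realType) (X : topologicalType) (a b : R) (f : R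
  -> X) :
  a <= b -> {within `[a, b], continuous f} ->
  exists2 g : R -> X, continuous g & forall x, a <= x <= b -> g x = f x.
Proof.
move=> ab /subspace_continuousP cf.
pose c (x : R) := (a + b + `|x - a| - `|x - b|) / 2.
have cI x : a <= c x <= b.
  by rewrite /c; case: (ger0P (x - a)) => h1; case: (ger0P (x - b)) => h2;
    apply/andP; split; lra.
have cc : continuous c by rewrite /c; cont.
exists (f \o c) => [x|x /andP[xa xb]]; last first.
  congr f; rewrite /c ger0_norm ?subr_ge0// ler0_norm ?subr_le0//; lra.
have I : `[a, b]%classic (c x) by rewrite /= in_itv/= cI.
apply: (@cvg_comp _ _ _ c f _ _ _ _ (cf _ I)) => A /= fA.
have H : \forall y \near x, `[a, b]%classic (c y) -> A (c y).
  exact: cc _ fA.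
by near=> y; have /(_ _)/= := near H y; apply => //; rewrite in_itv/= cI.
Unshelve. all: by end_near.
Qed.

Lemma IVT_sign (R : realType) (a b x : R) (h : R -> R) : a <= x <= b ->
  continuous h -> (forall y, a <= y <= b -> h y != 0) -> h a < 0 -> h x < 0.
Proof.
move=> /andP[ax xb] ch nz ha; rewrite ltNge; apply/negP => hx.
have [|y] := @IVT R h a x 0 ax (continuous_subspaceT ch).
  have h0 := le_trans (ltW ha) hx; rewrite min_l// max_r// hx andbT.
  exact: ltW.
rewrite in_itv/= => /andP[ya yx] y0.
by have := nz y; rewrite y0 eqxx ya (le_trans yx xb) => /(_ isT).
Qed.

(** Two lifts of a path differ by a single deck transformation. *)
Lemma lift_rigid (R : realType) (a b : R) (F G : R -> R * R) : a <= b ->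
  continuous F -> continuous G ->
  (forall x, a <= x <= b -> ~ lattice (F x)) ->
  (forall x, a <= x <= b -> pil (F x) = pil (G x)) ->
  exists e k l, forall x, a <= x <= b -> G x = deck e k l (F x).
Proof.
move=> ab cF cG nF E.
have aI : a <= a <= b by rewrite lexx ab.
(* [f] vanishes where the lifts differ by a translation, [g] where they differ
   by a half turn; away from the lattice they have no common zero *)
pose f x := (1 - cos ((G x).1 - (F x).1)) + (1 - cos ((G x).2 - (F x).2)).
pose g x := (1 - cos ((G x).1 + (F x).1)) + (1 - cos ((G x).2 + (F x).2)).
have f0 x : 0 <= f x.
  by rewrite /f addr_ge0// subr_ge0 cos_le1.
have g0 x : 0 <= g x.
  by rewrite /g addr_ge0// subr_ge0 cos_le1.
have fP x : f x = 0 -> cos ((G x).1 - (F x).1) = 1 /\ cos ((G x).2 - (F x).2) = 1.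
  move=> fx; have := @cos_le1 R ((G x).1 - (F x).1).
  by have := @cos_le1 R ((G x).2 - (F x).2); move: fx; rewrite /f; split; lra.
have gP x : g x = 0 -> cos ((G x).1 + (F x).1) = 1 /\ cos ((G x).2 + (F x).2) = 1.
  move=> gx; have := @cos_le1 R ((G x).1 + (F x).1).
  by have := @cos_le1 R ((G x).2 + (F x).2); move: gx; rewrite /g; split; lra.
have c2 (k : int) : cos (2 * pi * k%:~R) = 1 :> R by apply/cos_eq1P; exists k.
have fg x : a <= x <= b -> f x = 0 \/ g x = 0.
  move=> xI; have /pil_eqP[[] [k [l [E1 E2]]]] := E x xI;
    rewrite ?expr1 ?expr0 in E1 E2.
    have h1 : (G x).1 + (F x).1 = 2 * pi * k%:~R by rewrite E1; ring.
    have h2 : (G x).2 + (F x).2 = 2 * pi * l%:~R by rewrite E2; ring.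
    by right; rewrite /g h1 h2 !c2 subrr addr0.
  have h1 : (G x).1 - (F x).1 = 2 * pi * k%:~R by rewrite E1; ring.
  have h2 : (G x).2 - (F x).2 = 2 * pi * l%:~R by rewrite E2; ring.
  by left; rewrite /f h1 h2 !c2 subrr addr0.
have nfg x : a <= x <= b -> f x = 0 -> g x = 0 -> False.
  move=> xI /fP[/cos_eq1P[k1 h1] /cos_eq1P[k2 h2]] /gP[/cos_eq1P[l1 h3]
    /cos_eq1P[l2 h4]].
  apply: (nF x xI); exists (l1 - k1), (l2 - k2).
  by rewrite [LHS]surjective_pairing !rmorphB/=; congr (_, _); lra.
have cf : continuous f by rewrite /f; cont.
have cg : continuous g by rewrite /g; cont.
have const (h : R -> R) : continuous h -> (forall x, a <= x <= b -> cos (h x) = 1) ->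
    forall x, a <= x <= b -> h x = h a.
  move=> ch H x xI; have /andP[ax xb] := xI.
  suff : h a / 2 = h x / 2 by lra.
  apply: (@pi_multiple_constant R a x (fun x => h x / 2)) => //.
    by apply: continuous_subspaceT; cont.
  move=> y /andP[ay yx];
    have /cos_eq1P[k ->] := H y (andb_true_intro (conj ay (le_trans yx xb))).
  by apply/sin_eq0P; exists k; field.
have [fa|ga] := fg a aI.
  have Z x : a <= x <= b -> f x = 0.
    move=> xI; have [//|gx] := fg x xI.
    have : f x - g x < 0.
      apply: (@IVT_sign R a b x (fun x => f x - g x)) => //; first by cont.
        move=> y yI; apply/eqP; have := nfg y yI.
        by case: (fg y yI) => -> H; rewrite ?subr0 ?sub0r => h; apply: H => //; lra.
      have := g0 a; rewrite le_eqVlt => /orP[/eqP/esym ga|]; last by lra.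
      by case: (nfg a aI fa ga).
    by have := f0 x; rewrite gx; lra.
  have [/cos_eq1P[k h1] /cos_eq1P[l h2]] := fP a fa.
  exists false, k, l => x xI; rewrite [LHS]surjective_pairing /deck expr0 !mul1r.
  have c1' : continuous (fun x => (G x).1 - (F x).1) by cont.
  have e1 := const _ c1' (fun x xI => (fP x (Z x xI)).1) x xI.
  have c2' : continuous (fun x => (G x).2 - (F x).2) by cont.
  have e2 := const _ c2' (fun x xI => (fP x (Z x xI)).2) x xI.
  by rewrite -h1 -h2 -e1 -e2; congr (_, _); ring.
have Z x : a <= x <= b -> g x = 0.
  move=> xI; have [fx|//] := fg x xI.
  have : g x - f x < 0.
    apply: (@IVT_sign R a b x (fun x => g x - f x)) => //; first by cont.
      move=> y yI; apply/eqP; have := nfg y yI.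
      by case: (fg y yI) => -> H; rewrite ?subr0 ?sub0r => h; apply: H => //; lra.
    have := f0 a; rewrite le_eqVlt => /orP[/eqP/esym fa|]; last by lra.
    by case: (nfg a aI fa ga).
  by have := g0 x; rewrite fx; lra.
have [/cos_eq1P[k h1] /cos_eq1P[l h2]] := gP a ga.
exists true, k, l => x xI; rewrite [LHS]surjective_pairing /deck expr1 !mulN1r.
have c1' : continuous (fun x => (G x).1 + (F x).1) by cont.
  have e1 := const _ c1' (fun x xI => (gP x (Z x xI)).1) x xI.
have c2' : continuous (fun x => (G x).2 + (F x).2) by cont.
  have e2 := const _ c2' (fun x xI => (gP x (Z x xI)).2) x xI.
by rewrite -h1 -h2 -e1 -e2; congr (_, _); ring.
Qed.

Section LiftSquare.
Variables (R : realType).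

(** A continuous map of the plane that lifts [W] over a rectangle. *)
Definition lifts_over (W : R -> R -> pillowcase R) (a b c d : R) : Prop :=
  exists2 F : R * R -> R * R, continuous F &
    forall s t, a <= s <= b -> c <= t <= d -> W s t = pil (F (s, t)).

Lemma lifts_over_swap (W : R -> R -> pillowcase R) (a b c d : R) :
  lifts_over W a b c d -> lifts_over (fun s t => W t s) c d a b.
Proof.
move=> [F cF E]; exists (fun w => F (w.2, w.1)); first by cont.
by move=> s t sI tI; exact: E.
Qed.

Lemma lifts_over_glue (W : R -> R -> pillowcase R) (a b c d e : R) :
  a <= b -> c <= d -> d <= e ->
  (forall s, a <= s <= b -> pillow_star (W s d)) ->
  lifts_over W a b c d -> lifts_over W a b d e -> lifts_over W a b c e.
Proof.
move=> ab cd de star [F cF EF] [G cG EG].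
have cI : c <= d <= d by rewrite lexx cd.
have dI : d <= d <= e by rewrite lexx de.
pose cl (x : R) := (a + b + `|x - a| - `|x - b|) / 2.
have clI x : a <= cl x <= b.
  by rewrite /cl; case: (ger0P (x - a)) => h1; case: (ger0P (x - b)) => h2;
    apply/andP; split; lra.
have clid x : a <= x <= b -> cl x = x.
  by move=> /andP[h1 h2];
    rewrite /cl ger0_norm ?subr_ge0// ler0_norm ?subr_le0//; lra.
have cc : continuous cl by rewrite /cl; cont.
have [||||e0 [k [l H]]] := @lift_rigid R a b (fun s => G (s, d)) (fun s => F (s,
  d)) ab.
- by cont.
- by cont.
- by move=> x xI; apply/pillow_star_pil; rewrite -EG//; exact: star.
- by move=> x xI; rewrite -EG// -EF.
exists (fun w => if w.2 - d <= 0 then F (cl w.1, w.2) else deck e0 k l (G (cl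
  w.1, w.2))).
  apply: paste; [by cont|by cont|by rewrite /deck; cont|].
  by move=> w /eqP; rewrite subr_eq0 => /eqP ->; rewrite H.
move=> s t sI /andP[ct te] /=; rewrite clid// subr_le0; case: lerP => td.
  by apply: EF => //; rewrite ct.
by rewrite pil_deck; apply: EG => //; rewrite te ltW.
Qed.

Lemma lift_square (W : R -> R -> pillowcase R) :
  (forall s t, 0 <= s <= 1 -> 0 <= t <= 1 -> pillow_star (W s t)) ->
  (forall s t, 0 <= s <= 1 -> 0 <= t <= 1 ->
     exists2 F : R * R -> R * R, continuous F & exists2 d, 0 < d &
       forall s' t', 0 <= s' <= 1 -> 0 <= t' <= 1 -> `|s' - s| < d -> `|t' - t| < d ->
       W s' t' = pil (F (s', t'))) ->
  lifts_over W 0 1 0 1.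
Proof.
move=> star loc.
have strip s : 0 <= s <= 1 -> exists2 d, 0 < d & forall a b,
    0 <= a <= s -> s <= b <= 1 -> s - d < a -> b < s + d -> lifts_over W a b 0 1.
  move=> sI.
  apply: (@interval_induction R (fun c e => exists2 d, 0 < d & forall a b,
    0 <= a <= s -> s <= b <= 1 -> s - d < a -> b < s + d -> lifts_over W a b c e)).
    move=> t tI; have [F cF [d d0 H]] := loc s t sI tI.
    exists d => // c e /andP[c1 c2] /andP[e1 e2] c3 e3; exists d => //.
    move=> a b /andP[a1 a2] /andP[b1 b2] a3 b3; exists F => //.
    move=> s' t' /andP[h1 h2] /andP[h3 h4].
    by apply: H; rewrite ?ltr_norml; apply/andP; split; lra.
  move=> c e g /andP[c0 ce] /andP[eg g1] [d1 d10 H1] [d2 d20 H2].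
  exists (Num.min d1 d2); first by rewrite lt_min d10.
  move=> a b aI bI; rewrite ltrBlDr -ltrBlDl lt_min => /andP[a1 a2].
  rewrite -ltrBlDl lt_min => /andP[b1 b2].
  apply: (@lifts_over_glue W a b c e g) => //.
  - by case/andP: aI => _ h1; case/andP: bI => h2 _; exact: le_trans h2.
  - move=> s' s'I; apply: star; last by apply/andP; split; lra.
    by case/andP: aI => h1 h2; case/andP: bI => h3 h4; case/andP: s'I => h5 h6;
      apply/andP; split; lra.
  - by apply: H1 => //; lra.
  - by apply: H2 => //; lra.
apply: (@interval_induction R (fun a b => lifts_over W a b 0 1)) => // a b c.
move=> /andP[a0 ab] /andP[bc c1] /lifts_over_swap H1 /lifts_over_swap H2.
have := @lifts_over_glue (fun s t => W t s) 0 1 a b c ler01 ab bc _ H1 H2.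
move=> /(_ _)/lifts_over_swap; apply.
by move=> t tI; apply: star => //; apply/andP; split; lra.
Qed.

End LiftSquare.

(** * Bigons *)

Lemma is_derive_partial1 (R : realType) (g : R * R -> R) (x y : R) :
  derivable g (x, y) (1, 0) ->
  is_derive x 1 (fun x => g (x, y)) ('D_(1, 0) g (x, y)).
Proof.
have E : (fun h : R => h^-1 *: (((fun x => g (x, y)) \o shift x) (h *: (1 : R)) -
  g (x, y))) =
  (fun h => h^-1 *: ((g \o shift (x, y)) (h *: ((1, 0) : R * R)) - g (x, y))).
  apply/funext => h /=; congr (_ *: (g _ - _)).
  by congr (_, _); rewrite /= scaler0 add0r.
by move=> D; split; rewrite /derivable /derive E.
Qed.

Lemma is_derive_partial2 (R : realType) (g : R * R -> R) (x y : R) :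
  derivable g (x, y) (0, 1) ->
  is_derive y 1 (fun y => g (x, y)) ('D_(0, 1) g (x, y)).
Proof.
have E : (fun h : R => h^-1 *: (((fun y => g (x, y)) \o shift y) (h *: (1 : R)) -
  g (x, y))) =
  (fun h => h^-1 *: ((g \o shift (x, y)) (h *: ((0, 1) : R * R)) - g (x, y))).
  apply/funext => h /=; congr (_ *: (g _ - _)).
  by congr (_, _); rewrite /= scaler0 add0r.
by move=> D; split; rewrite /derivable /derive E.
Qed.

Lemma MVT_any (R : realType) (f df : R -> R) (a h : R) :
  (forall x : R, is_derive x 1 f (df x)) ->
  exists2 c, `|c - a| <= `|h| & f (a + h) - f a = df c * h.
Proof.
move=> D; have cf x y : {within `[x, y], continuous f}.
  apply: continuous_subspaceT => u; apply: differentiable_continuous.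
  by apply/derivable1_diffP; exact: ex_derive.
have [h0|h0] := orP (le_total 0 h).
  have ah : a <= a + h by lra.
  have [c] := @MVT_segment R f df a (a + h) ah (fun x _ => D x) (cf _ _).
  rewrite in_itv/= => /andP[c1 c2] E; exists c; last by rewrite E; congr (_ * _);
    ring.
  by rewrite !ger0_norm; lra.
have ah : a + h <= a by lra.
have [c] := @MVT_segment R f df (a + h) a ah (fun x _ => D x) (cf _ _).
rewrite in_itv/= => /andP[c1 c2] E; exists c; last by rewrite -opprB E; ring.
by rewrite !ler0_norm; lra.
Qed.

(** The chain rule for a function of class C^1 along a curve [(s, c s)]. *)
Lemma chain_rule_graph (R : realType) (g : R * R -> R) (c : R -> R) (s dc : R) :
  (forall w v, derivable g w v) -> continuous ('D_(1, 0) g) ->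
  is_derive s 1 c dc ->
  is_derive s 1 (fun s => g (s, c s))
    ('D_(1, 0) g (s, c s) + 'D_(0, 1) g (s, c s) * dc).
Proof.
move=> Dg cD Dc.
have D2 : is_derive s 1 (fun x => g (s, c x)) ('D_(0, 1) g (s, c s) * dc).
  exact: (@is_derive1_comp R (fun y => g (s, y)) c s _ _ (is_derive_partial2 _ _
    _ _ (Dg _ _)) Dc).
have cc : {for s, continuous c}.
  apply: differentiable_continuous; apply/derivable1_diffP; exact: ex_derive.
set l := _ + _.
suff H : (fun h => h^-1 *: (((fun s => g (s, c s)) \o shift s) (h *: (1 : R)) - g
  (s, c s))) x
    @[x --> 0^'] --> l.
  by split; [apply/cvg_ex; exists l|rewrite /derive; apply: cvg_lim].
have H2 : (fun h => h^-1 *: (((fun x => g (s, c x)) \o shift s) (h *: (1 : R)) -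
  g (s, c s))) x
    @[x --> 0^'] --> 'D_(0, 1) g (s, c s) * dc.
  have [ex <-] := D2; exact: ex.
have cs : (fun h : R => c (h + s)) x @[x --> 0^'] --> c s.
  apply: cvg_within_filter.
  have sh : (fun h : R => h + s) x @[x --> 0] --> s.
    rewrite -[X in _ --> X](add0r s).
    by apply: (@cvgD _ _ _ _ _ (fun h => h) (fun=> s));
      [exact: cvg_id|exact: cvg_cst].
  exact: (@cvg_comp _ _ _ (fun h => h + s) c _ _ _ sh cc).
apply/cvgrPdist_lt => e e0; have e2 : 0 < e / 2 by rewrite divr_gt0.
have := cD (s, c s); move=> /cvgrPdist_lt/(_ _ e2)[[A B] /= [nA nB] AB].
have [r /= r0 rA] := nA.
near=> h.
have h1 : `|'D_(0, 1) g (s, c s) * dc -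
    h^-1 *: (((fun x => g (s, c x)) \o shift s) (h *: (1 : R)) - g (s, c s))| < e / 2.
  by near: h; move/cvgrPdist_lt: H2; exact.
have hB : B (c (h + s)) by near: h; exact: (cs _ nB).
have hr : `|h| < r.
  near: h; have := @nbhs_dnbhs _ (0 : R); apply; apply/nbhs_ballP; exists r => //= y.
  by rewrite /ball/= sub0r normrN.
have h0 : h != 0 by near: h; exact: nbhs_dnbhs_neq.
have [xi x1 x2] := @MVT_any R (fun x => g (x, c (h + s)))
  (fun x => 'D_(1, 0) g (x, c (h + s))) s h (fun x => is_derive_partial1 _ _ _ _
    (Dg _ _)).
have h3 : `|'D_(1, 0) g (s, c s) - 'D_(1, 0) g (xi, c (h + s))| < e / 2.
  apply: AB; split=> //=; apply: rA; rewrite /ball/= distrC.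
  exact: le_lt_trans x1 hr.
have -> : h^-1 *: (((fun s => g (s, c s)) \o shift s) (h *: (1 : R)) - g (s, c s)) =
  'D_(1, 0) g (xi, c (h + s)) +
  h^-1 *: (((fun x => g (s, c x)) \o shift s) (h *: (1 : R)) - g (s, c s)).
  rewrite /= /GRing.scale /= mulr1.
  have -> : 'D_(1, 0) g (xi, c (h + s)) = h^-1 * (g (h + s, c (h + s)) - g (s, c
    (h + s))).
    rewrite (_ : g (h + s, _) - _ = 'D_(1, 0) g (xi, c (h + s)) * h).
      by rewrite mulrCA mulVf// mulr1.
    by rewrite -x2 [s + h]addrC.
  by ring.
rewrite /l opprD addrACA; apply: (le_lt_trans (ler_normD _ _)); lra.
Unshelve. all: by end_near.
Qed.

Section NoBigon.
Variables (R : realType) (p : nat) (q : int).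
Hypothesis podd : odd p.
Hypothesis pq : coprimez p%:Z q.
Let m : R := (2 * q - p%:Z)%:~R.
Let P : R := p%:R.
Let L1 := L1_curve R p q.
Let P0 : 0 < P. Proof. by rewrite ltr0n p_gt0. Qed.

Lemma smooth2_continuous (f : R * R -> R * R) : smooth2 f -> continuous f.
Proof.
move=> sf; have [c1 c2] := sf 0%N; rewrite /= in c1 c2.
have -> : f = (fun w => ((fst \o f) w, (snd \o f) w)).
  by apply/funext => w; rewrite /= -surjective_pairing.
by cont.
Qed.

(** The rectangle collapsed onto the standard bigon. *)
Definition bigon_square (w : R * R) : R * R :=
  (2 * w.1 - 1, (2 * w.2 - 1) * (1 - (2 * w.1 - 1) * (2 * w.1 - 1))).

Lemma bigon_square_in (w : R * R) : 0 <= w.1 <= 1 -> 0 <= w.2 <= 1 ->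
  bigon_domain (bigon_square w).
Proof.
move=> sI tI; rewrite /bigon_domain /bigon_square /=.
have y1 : 0 <= 1 - (2 * w.1 - 1) * (2 * w.1 - 1).
  by case/andP: sI => s0 s1; nra.
rewrite normrM (ger0_norm y1) expr2 ler_piMl//.
by case: (ger0P (2 * w.2 - 1)) => h; lra.
Qed.

(** The bigon is simply connected: an immersed bigon lifts to the plane. *)
Lemma bigon_lift (u : R * R -> pillowcase R) :
  (forall w, bigon_domain w -> pillow_star (u w) /\
     exists f : R * R -> R * R, [/\ smooth2 f, 0 < Defs.jacobian f w
       & \forall w' \near w, bigon_domain w' -> u w' = pil (f w')]) ->
  lifts_over R (fun s t => u (bigon_square (s, t))) 0 1 0 1.
Proof.
move=> H; have cS : continuous bigon_square by rewrite /bigon_square; cont.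
apply: lift_square => [s t sI tI|s t sI tI].
  by apply: (H _ (bigon_square_in (s, t) sI tI)).1.
have [_ [f [sf _ nf]]] := H _ (bigon_square_in (s, t) sI tI).
have cf := smooth2_continuous f sf.
exists (fun w => f (bigon_square w)); first by cont.
have := cS (s, t) _ nf; rewrite /= => /nbhs_ballP[d /= d0 dH].
exists d => // s' t' sI' tI' hs ht; apply: (dH (s', t')).
  by split; rewrite /ball/= distrC.
exact: (bigon_square_in (s', t')).
Qed.

(** In the plane, a lift of the arc and a lift of the figure eight meet at most
    once: the former is steeper than the latter in diagonal coordinates. *)
Lemma arc_meets_once (eps : R) (e0 e1 : bool) (k0 l0 k1 l1 : int) (s s' t t' : R) :
  small R p q eps ->
  deck e0 k0 l0 (L0_curve eps s) = deck e1 k1 l1 (L1 t) ->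
  deck e0 k0 l0 (L0_curve eps s') = deck e1 k1 l1 (L1 t') -> t = t'.
Proof.
move=> [ep _ em]; rewrite !L1_coords -/m -/P /deck /= => -[E1 E2] [E3 E4].
have sg (e : bool) (x : R) : `|(-1) ^+ e * x| = `|x|.
  by case: e; rewrite ?expr1 ?expr0 ?mul1r ?mulN1r ?normrN.
have D1 : (-1) ^+ e1 * (P * (t - t')) = (-1) ^+ e0 * (2 * eps * (sin s - sin s')).
  by lra.
have D2 : (-1) ^+ e1 * (m * (t - t')) = (-1) ^+ e0 * (2 * (s - s')) by lra.
have := congr1 Num.norm D1; have := congr1 Num.norm D2.
rewrite !sg !normrM (gtr0_norm P0) (gtr0_norm ep) (ger0_norm (ler0n R 2)) => h2 h1.
have h3 := sin_lipschitz R s s'.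
have h4 : P * `|t - t'| <= eps * `|m| * `|t - t'|.
  by rewrite h1 -[leRHS]mulrA h2; have := ler_wpM2l (ltW ep) h3; lra.
apply/eqP; rewrite -subr_eq0 -normr_le0 leNgt; apply/negP => t0.
have : eps * `|m| * `|t - t'| < P * `|t - t'|.
  rewrite ltr_pM2r//; have := mulr_ge0 (ltW ep) (normr_ge0 m); move: em;
    rewrite -/m -/P; lra.
by rewrite ltNge h4.
Qed.

(** Both corners of an immersed bigon would be the same point of the arc. *)
Lemma bigon_same_param (eps : R) (x y : R * R) (u : R * R -> pillowcase R)
    (a1 : R -> R) : small R p q eps ->
  is_bigon (L0_curve eps) L1 x y u ->
  {within `[-1, 1], continuous a1} ->
  (forall s, s \in `[-1, 1] -> dom L1 (a1 s) /\ u (s, s ^+ 2 - 1) = crv L1 (a1 s)) ->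
  a1 (-1) = a1 1.
Proof.
move=> sm [H [a0 [ca0 _ _ E0]] _] ca1 E1.
have [F cF EF] := bigon_lift u H.
have n11 : (-1 : R) <= 1 by lra.
have [A0 cA0 EA0] := continuous_clamp_itv R R (-1) 1 a0 n11 ca0.
have [A1 cA1 EA1] := continuous_clamp_itv R R (-1) 1 a1 n11 ca1.
have cL0 := @L0_continuous R eps; have cL1 := @L1_continuous R p q.
have I0 : 0 <= (0 : R) <= 1 by rewrite lexx ler01.
have I1 : 0 <= (1 : R) <= 1 by rewrite lexx ler01.
have J (s : R) : 0 <= s <= 1 -> -1 <= 2 * s - 1 <= 1 by move=> sI; apply/andP;
  split; lra.
have star s t : 0 <= s <= 1 -> 0 <= t <= 1 -> ~ lattice (F (s, t)).
  move=> sI tI; apply/pillow_star_pil; rewrite -EF//.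
  by apply: (H _ (bigon_square_in (s, t) sI tI)).1.
have bot s : 0 <= s <= 1 -> pil (F (s, 0)) = pil (L1 (A1 (2 * s - 1))).
  move=> sI; rewrite -EF// EA1 ?J//.
  have [|_ E] := E1 (2 * s - 1); first by rewrite in_itv/= J.
  rewrite -[RHS]/(crv L1 (a1 (2 * s - 1))) -E.
  by congr u; rewrite /bigon_square /=; congr (_, _); ring.
have top s : 0 <= s <= 1 -> pil (F (s, 1)) = pil (L0_curve eps (A0 (2 * s - 1))).
  move=> sI; rewrite -EF// EA0 ?J//.
  have [|_ E] := E0 (2 * s - 1); first by rewrite in_itv/= J.
  rewrite -[RHS]/(crv (L0_curve eps) (a0 (2 * s - 1))) -E.
  by congr u; rewrite /bigon_square /=; congr (_, _); ring.
have side s : s = 0 \/ s = 1 -> F (s, 0) = F (s, 1).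
  move=> s01; have sI : 0 <= s <= 1 by case: s01 => ->.
  have [||||e [k [l h]]] := @lift_rigid R 0 1 (fun=> F (s, 0)) (fun t => F (s,
    t)) ler01.
  - by cont.
  - by cont.
  - by move=> t tI; exact: star.
  - move=> t tI; rewrite -!EF//; congr u; rewrite /bigon_square /=.
    by case: s01 => ->; congr (_, _); ring.
  exact: etrans (h 0 I0) (esym (h 1 I1)).
have [||||e1 [k1 [l1 h1]]] :=
  @lift_rigid R 0 1 (fun s => L1 (A1 (2 * s - 1))) (fun s => F (s, 0)) ler01.
- by cont.
- by cont.
- by move=> s sI; apply/pillow_star_pil; rewrite -bot//; apply/pillow_star_pil/star.
- by move=> s sI; rewrite bot.
have [||||e0 [k0 [l0 h0]]] :=
  @lift_rigid R 0 1 (fun s => L0_curve eps (A0 (2 * s - 1))) (fun s => F (s, 1))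
    ler01.
- by cont.
- by cont.
- by move=> s sI; apply/pillow_star_pil; rewrite -top//; apply/pillow_star_pil/star.
- by move=> s sI; rewrite top.
have B0 := side 0 (or_introl erefl); have B1 := side 1 (or_intror erefl).
rewrite h1// h0// in B0; rewrite h1// h0// in B1.
have := arc_meets_once _ _ _ _ _ _ _ _ _ _ _ sm (esym B0) (esym B1).
rewrite mulr0 sub0r mulr1 (_ : 2 - 1 = 1 :> R); last by ring.
by rewrite !EA1//; apply/andP; split; lra.
Qed.

(** The lower edge of an immersed bigon moves along the arc with nonzero speed. *)
Lemma bigon_edge_regular (u : R * R -> pillowcase R) (a1 : R -> R) (s : R) :
  -1 < s < 1 -> {within `[-1, 1], continuous a1} ->
  (forall w, bigon_domain w -> pillow_star (u w) /\
     exists f : R * R -> R * R, [/\ smooth2 f, 0 < Defs.jacobian f w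
       & \forall w' \near w, bigon_domain w' -> u w' = pil (f w')]) ->
  (forall s, s \in `[-1, 1] -> dom L1 (a1 s) /\ u (s, s ^+ 2 - 1) = crv L1 (a1 s)) ->
  derivable a1 s 1 /\ ~ is_derive s 1 a1 0.
Proof.
move=> sI ca1 H E1; have n11 : (-1 : R) <= 1 by lra.
have [A1 cA1 EA1] := continuous_clamp_itv R R (-1) 1 a1 n11 ca1.
have cL1 := @L1_continuous R p q.
pose c (x : R) := x * x - 1.
have inD x : -1 <= x <= 1 -> bigon_domain (x, c x).
  move=> xI; rewrite /bigon_domain /c /= ler0_norm ?expr2; first by lra.
  by case/andP: xI => h1 h2; nra.
have sI' : -1 <= s <= 1 by case/andP: sI => h1 h2; rewrite !ltW.
have [_ [f [sf jf nf]]] := H _ (inD s sI').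
have cf := smooth2_continuous f sf.
pose e (x : R) := (x, c x).
have ce : continuous e by rewrite /e /c; cont.
have := ce s _ nf; rewrite /= => /nbhs_ballP[r /= r0 rH].
pose d := Num.min (r / 2) (Num.min ((s + 1) / 2) ((1 - s) / 2)).
have /andP[s1 s2] := sI.
have d0 : 0 < d by rewrite /d !lt_min; apply/and3P; split; lra.
have dr : d <= r / 2 by rewrite /d ge_min lexx.
have d1 : d <= (s + 1) / 2 by rewrite /d !ge_min lexx orbT.
have d2 : d <= (1 - s) / 2 by rewrite /d !ge_min lexx !orbT.
have near1 x : s - d <= x <= s + d -> -1 <= x <= 1.
  by move=> /andP[h1 h2]; apply/andP; split; lra.
have uE x : -1 <= x <= 1 -> u (e x) = pil (L1 (A1 x)).
  move=> xI; rewrite EA1//; have [|_ E] := E1 x; first by rewrite in_itv.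
  by rewrite -[RHS]/(crv L1 (a1 x)) -E /e /c expr2.
have fE x : s - d <= x <= s + d -> u (e x) = pil (f (e x)).
  move=> xI; apply: rH; last by apply: inD; exact: near1.
  by rewrite /ball/=; case/andP: xI => h1 h2; rewrite ltr_norml; apply/andP;
    split; lra.
have [|||||e0 [k [l hd]]] := @lift_rigid R (s - d) (s + d) (fun x => L1 (A1 x))
  (fun x => f (e x)).
- by lra.
- by cont.
- by cont.
- move=> x xI; apply/pillow_star_pil; rewrite -uE ?near1//.
  by apply: (H _ (inD x (near1 x xI))).1.
- by move=> x xI; rewrite -uE ?near1// fE.
have sq : (-1) ^+ e0 * (-1) ^+ e0 = 1 :> R by rewrite -expr2 sqrr_sign.
have nearE : \forall x \near s, s - d <= x <= s + d.
  apply/nbhs_ballP; exists d => //= x; rewrite /ball/= ltr_norml => /andP[h1 h2].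
  by apply/andP; split; lra.
have dc : is_derive s 1 c (s + s).
  by apply: is_derive_eq; rewrite subr0 /GRing.scale /=; ring.
have [[_ cD1 _] [_ cD2 _]] := (sf 1%N); have [[D1 _ _] [D2 _ _]] := (sf 1%N).
have ch1 := chain_rule_graph R (fst \o f) c s _ D1 cD1 dc.
have ch2 := chain_rule_graph R (snd \o f) c s _ D2 cD2 dc.
set v1 := _ + _ in ch1; set v2 := _ + _ in ch2.
(* along the edge, the parameter is an affine function of the lift *)
have aE : \forall x \near s, (-1) ^+ e0 / P * ((fst \o f) (x, c x) - (snd \o f)
  (x, c x)
    - 2 * pi * (k - l)%:~R) = a1 x.
  near=> x; have xI : s - d <= x <= s + d by near: x; exact: nearE.
  have := hd x xI; rewrite L1_coords -/m -/P /e => hx.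
  rewrite /comp hx /deck /= EA1 ?near1// rmorphB/=.
  transitivity ((-1) ^+ e0 * (-1) ^+ e0 * a1 x); last by rewrite sq mul1r.
  by field; rewrite gt_eqF.
have D : is_derive s 1 a1 ((-1) ^+ e0 / P * (v1 - v2)).
  apply: near_eq_is_derive aE _; apply: is_derive_eq.
  by rewrite subr0.
split; first exact: ex_derive.
move=> D0.
have fE1 : \forall x \near s, (-1) ^+ e0 * (q%:~R * a1 x) + 2 * pi * k%:~R = (fst
  \o f) (x, c x).
  near=> x; have xI : s - d <= x <= s + d by near: x; exact: nearE.
  by have := hd x xI; rewrite /e /= => ->; rewrite /deck /L1 /= EA1 ?near1.
have fE2 : \forall x \near s, (-1) ^+ e0 * ((q - p%:Z)%:~R * a1 x) + 2 * pi *
  l%:~R = (snd \o f) (x, c x).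
  near=> x; have xI : s - d <= x <= s + d by near: x; exact: nearE.
  by have := hd x xI; rewrite /e /= => ->; rewrite /deck /L1 /= EA1 ?near1.
have z1 : v1 = 0.
  have F1 : is_derive s 1 (fun x => (fst \o f) (x, c x)) 0.
    apply: near_eq_is_derive fE1 _; apply: is_derive_eq.
    by rewrite /GRing.scale /= !(mulr0, addr0).
  by rewrite -(@derive_val _ _ _ _ _ _ _ ch1) (@derive_val _ _ _ _ _ _ _ F1).
have z2 : v2 = 0.
  have F2 : is_derive s 1 (fun x => (snd \o f) (x, c x)) 0.
    apply: near_eq_is_derive fE2 _; apply: is_derive_eq.
    by rewrite /GRing.scale /= !(mulr0, addr0).
  by rewrite -(@derive_val _ _ _ _ _ _ _ ch2) (@derive_val _ _ _ _ _ _ _ F2).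
move: jf z1 z2; rewrite /Defs.jacobian /v1 /v2.
move: ('D_(1, 0) (fst \o f) _) ('D_(0, 1) (fst \o f) _) => x1 y1.
move: ('D_(1, 0) (snd \o f) _) ('D_(0, 1) (snd \o f) _) => x2 y2 jf z1 z2.
have j0 : x1 * y2 - y1 * x2 = (x1 + y1 * (s + s)) * y2 - y1 * (x2 + y2 * (s + s))
  by ring.
by move: jf; rewrite j0 z1 z2 mul0r mulr0 subrr ltxx.
Unshelve. all: by end_near.
Qed.

Lemma no_bigon (eps : R) (x y : R * R) (u : R * R -> pillowcase R) :
  small R p q eps -> ~ is_bigon (L0_curve eps) L1 x y u.
Proof.
move=> sm B; have [H _ [a1 [ca1 _ _ E1]]] := B.
have reg s (sI : -1 < s < 1) := bigon_edge_regular u a1 s sI ca1 H E1.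
have [|||c] := @Rolle R a1 (-1) 1 _ _ ca1.
- by lra.
- by move=> s; rewrite in_itv/= => sI; have [] := reg s sI.
- exact: bigon_same_param sm B ca1 E1.
by rewrite in_itv/= => cI; have [] := reg c cI.
Qed.

End NoBigon.

(** * The complex *)

Lemma fset_set_image_card (T : choiceType) (F : nat -> T) (n : nat) :
  {in `I_n &, injective F} ->
  finite_set (F @` `I_n) /\ #|` fset_set (F @` `I_n)| = n.
Proof.
move=> Finj; have fin : finite_set (F @` `I_n).
  by apply: finite_image; exact: finite_II.
split=> //.
have -> : fset_set (F @` `I_n) = seq_fset tt (map F (iota 0 n)).
  apply/fsetP => x; rewrite in_fset_set// seq_fsetE; apply/idP/mapP.
    by rewrite inE => -[k /= kn <-]; exists k => //; rewrite mem_iota.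
  by move=> [k]; rewrite mem_iota /= => kn ->; rewrite inE; exists k.
rewrite size_seq_fset undup_id ?size_map ?size_iota// map_inj_in_uniq ?iota_uniq//.
by move=> i j; rewrite !mem_iota /= => ip jp; apply: Finj; rewrite inE.
Qed.

Lemma dim_floer_complex (R : realType) (L0 L1 : curve R) :
  \dim {: floer_complex L0 L1} = #|` fset_set (crossings L0 L1)|.
Proof. by rewrite dimvf /dim /= -cardfE muln1. Qed.

Section NoBigons.
Local Open Scope quotient_scope.
Variables (R : realType) (L0 L1 : curve R).
Hypothesis no_bigons : forall x y, bigons L0 L1 x y = set0.

Lemma differential_eq0 : differential L0 L1 = 0.
Proof.
apply/lfunP => c; rewrite lfunE zero_lfunE; apply/ffunP => y; rewrite !ffunE.
by apply: big1 => x _; rewrite no_bigons fset_set0 cardfs0 mulr0.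
Qed.

(** The cycles are all chains and the boundaries vanish. *)
Lemma homology_iso : exists f : {additive floer_complex L0 L1 -> homology L0 L1},
  bijective f.
Proof.
have d0 := differential_eq0.
have inker c : c \in lker (differential L0 L1) by rewrite memv_ker d0 zero_lfunE.
have bd0 x : (x \in boundaries L0 L1) = (x == 0).
  rewrite /boundaries -memv_preim lfunE /= (_ : limg _ = 0%VS);
    last by rewrite d0 lim0g.
  by rewrite memv0 -(inj_eq val_inj).
pose K := lker (differential L0 L1).
pose f (c : floer_complex L0 L1) : homology L0 L1 :=
  \pi_(Quotient.quot (pred_of_vspace (boundaries L0 L1))) (vsproj K c).
have fB : zmod_morphism f.
  by move=> x y; rewrite /f !raddfB.
pose F := GRing.isZmodMorphism.Build _ _ f fB.
pose Fa : {additive floer_complex L0 L1 -> homology L0 L1} := HB.pack f F.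
pose Q := Quotient.quot (pred_of_vspace (boundaries L0 L1)).
exists Fa; exists (fun h : Q => vsval (repr h)) => [c|h] /=.
  have E : repr (f c : Q) = vsproj K c.
    by apply/eqP; rewrite -subr_eq0 -bd0 Quotient.idealrBE reprK.
  by rewrite E vsprojK// inker.
by rewrite /f vsvalK reprK.
Qed.

End NoBigons.

(** The slope of the arc is never 1 or -1, as [p] is odd. *)
Lemma slope_cases (R : realType) (p : nat) (q : int) : odd p -> coprimez p%:Z q ->
  (1 < p)%N ->
  let slope : R := (q - p%:Z)%:~R / q%:~R in 1 < `|slope| \/ `|slope| < 1.
Proof.
move=> podd pq p1 slope.
have q0 : q != 0 by apply: contraTneq pq => ->; rewrite coprimezE /coprime gcdn0; lia.
have Q0 : 0 < `|q%:~R| :> R by rewrite normr_gt0 intr_eq0.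
rewrite /slope normrM normfV ltr_pdivlMr// ltr_pdivrMr// mul1r -!intr_norm !ltr_int.
have : `|q| != `|q - p%:Z| by move: podd; lia.
by case: ltgtP => //; [left|right].
Qed.

Theorem theorem7p1 (R : realType) (p : nat) (q : int)
    (* the exterior of the tangle (Y, T), with R(Y, T) = [0, pi] *)
    (T : tangle_group) (phi : R -> charvar R T)
    (z : (R -> pillowcase R) -> 'Z_4) (sigma : int) :
  odd p -> coprimez p%:Z q ->
  is_arc_parametrization 0 pi phi ->
  (forall t, t \in `[0, pi] ->
     restriction (phi t) = pil (q%:~R * t, (q - p%:Z)%:~R * t)) ->
  is_pillow_class z ->
  two_bridge_signature R p q sigma ->
  let L1 := L1_curve R p q in
  let slope : R := (q - p%:Z)%:~R / q%:~R in
  [/\ linearly_embedded_arc (@restriction R T) (q - p%:Z)%:~R q%:~R,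
      restricted_immersed_arc (range (@restriction R T))
    & exists (r : R -> R * R) (xp xm : nat -> R -> R * R),
      [/\ is_r_plus L1 r,
          forall l, (1 <= l <= (p.-1)./2)%N -> is_x_crossing p q l true (xp l),
          forall l, (1 <= l <= (p.-1)./2)%N -> is_x_crossing p q l false (xm l)
        & \forall eps \near (0 : R)^'+,
          let L0 := L0_curve eps in
          let formulas (gr : R * R -> 'Z_4) :=
            gr (r eps) = sigma%:~R /\
            forall l, (1 <= l <= (p.-1)./2)%N ->
              gr (xp l eps) - gr (xm l eps) = 1 /\
              forall x, (1 < `|slope| /\ x = xp l eps) \/
                        (`|slope| < 1 /\ x = xm l eps) ->
              forall alpha0 alpha1,
                param_path L0 (r eps).1 x.1 alpha0 ->
                param_path L1 x.2 (r eps).2 alpha1 ->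
                gr (r eps) - gr x = z (grading_loop L0 L1 alpha0 alpha1) in
          [/\ finite_set (crossings L0 L1) /\ \dim {: floer_complex L0 L1} = p,
              crossings L0 L1 =
                [set y | y = r eps \/ exists2 l, (1 <= l <= (p.-1)./2)%N &
                                        y = xp l eps \/ y = xm l eps],
              forall x y, crossings L0 L1 x -> crossings L0 L1 y ->
                exists! g, rel_grading L0 L1 z x y g,
              exists gr, [/\ is_grading L0 L1 z gr, formulas gr
                & forall gr', formulas gr' ->
                    forall x, crossings L0 L1 x -> gr' x = gr x]
            & [/\ forall x y, crossings L0 L1 x -> crossings L0 L1 y ->
                    finite_set (bigons L0 L1 x y),
                  differential L0 L1 = 0
                & exists f : {additive floer_complex L0 L1 -> homology L0 L1},
                    bijective f]]]].
Proof.
move=> podd pq arc fphi hz _ L1 slope.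
have [_ [psi [_ psiI phiK _]]] := arc.
have p0 := p_gt0 _ podd.
split.
- split; first exact: (arc_embedding R p q podd pq _ _ _ arc fphi).
  exists 0, pi, phi, (0, 0), (q%:~R, (q - p%:Z)%:~R); split=> //.
  + exact: pi_gt0.
  + exact: L1_velocity_neq0.
  + by move=> t /fphi ->; rewrite /= !add0r ![t * _]mulrC.
- rewrite (arc_range R p q _ _ phi psi psiI phiK fphi).
  exact: arc_restricted.
exists (r_pt R p q), (fun l => x_pt R p q l true), (fun l => x_pt R p q l false); split.
- exact: r_plus.
- by move=> l; exact: x_crossing.
- by move=> l; exact: x_crossing.
near=> eps.
set L0 := L0_curve eps.
have gd : good R p q eps by near: eps; exact: good_near.
have [sm _] := gd.
have list := crossings_list R p q podd pq eps sm; rewrite -/L1 -/L0 in list.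
have cr_r : crossings L0 L1 (r_pt R p q eps) by rewrite list; left.
have cr_x l b : (1 <= l <= p.-1./2)%N -> crossings L0 L1 (x_pt R p q l b eps).
  by move=> lI; rewrite list; right; exists l => //; case: b; [left|right].
have image := crossing_seq_image R p q podd pq eps sm; rewrite -/L1 -/L0 in image.
have [fin card] := fset_set_image_card _ _ p (crossing_seq_inj R p q podd pq eps gd).
pose V := grading_value R p q z eps.
have rel x y g := crossing_rel_grading R p q podd pq z hz eps sm x y g.
have coc x y w := grading_value_cocycle R p q podd pq z hz eps sm x y w.
have val x y a0 a1 := grading_loop_value R p q podd pq z hz eps sm x y a0 a1.
have Vrr : V (r_pt R p q eps) (r_pt R p q eps) = 0.
  by have /eqP := coc _ _ _ cr_r cr_r cr_r;
    rewrite -[X in X == _]addr0 (inj_eq (addrI _)) => /eqP/esym.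
have Vx l : (1 <= l <= p.-1./2)%N ->
    V (x_pt R p q l true eps) (x_pt R p q l false eps) = 1.
  by move=> lI; exact: x_grading_value.
have nb x y : bigons L0 L1 x y = set0.
  by rewrite -subset0 => c [u B _]; case: (no_bigon R p q podd eps x y u sm B).
(* the absolute grading, normalized at [r_+] *)
pose gr x := sigma%:~R - V (r_pt R p q eps) x.
have grB x y : crossings L0 L1 x -> crossings L0 L1 y -> gr x - gr y = V x y.
  by move=> cx cy; rewrite /gr /V (coc _ _ _ cr_r cx cy); ring.
split.
- by rewrite dim_floer_complex image.
- exact: list.
- move=> x y cx cy; exists (V x y); split; first exact/rel.
  by move=> g /(rel _ _ _ cx cy).
- exists gr; split.
  + by move=> x y g cx cy /(rel _ _ _ cx cy) ->; exact: grB.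
  + split; first by rewrite /gr Vrr subr0.
    move=> l lI; split; first by rewrite grB ?Vx//; exact: cr_x.
    move=> x H a0 a1 P0 P1.
    have cx : crossings L0 L1 x by case: H => -[_ ->]; exact: cr_x.
    by rewrite (val _ _ _ _ cr_r cx P0 P1) grB.
  + move=> gr' [gr'r H] x; rewrite {1}list => -[->|[l lI xE]].
      by rewrite gr'r /gr Vrr subr0.
    have [H1 H2] := H l lI.
    have p1 : (1 < p)%N by move: (podd) lI; clear; lia.
    have [rI _] := crossing_data R p q podd pq eps sm _ cr_r.
    have path y : crossings L0 L1 y -> (1 < `|slope| /\ y = x_pt R p q l true eps) \/
        (`|slope| < 1 /\ y = x_pt R p q l false eps) -> gr' y = gr y.
      move=> cy yE; have [yI _] := crossing_data R p q podd pq eps sm _ cy.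
      have P0 := param_path_L0 R p q eps sm (r_pt R p q eps).1 y.1.
      have P1 := param_path_L1 R p q podd pq _ _ yI rI.
      have := H2 y yE _ _ P0 P1; rewrite (val _ _ _ _ cr_r cy P0 P1) gr'r => E.
      by rewrite /gr /V -E; ring.
    have G := grB _ _ (cr_x l true lI) (cr_x l false lI); rewrite Vx// in G.
    have [s1|s1] := slope_cases R p q podd pq p1.
      have E := path _ (cr_x l true lI) (or_introl (conj s1 erefl)).
      case: xE => -> //.
      by move: H1; rewrite E -G => /addrI/oppr_inj.
    have E := path _ (cr_x l false lI) (or_intror (conj s1 erefl)).
    case: xE => -> //.
    by move: H1; rewrite E -G => /addIr.
- split.
  + by move=> x y _ _; rewrite nb; exact: finite_set0.
  + exact: differential_eq0.
  + exact: homology_iso.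
Unshelve. all: by end_near.
Qed.
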